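(* If $\mathcal C$ is a corepita 2-category and $\mathcal T$ is a finite higher-order theory, then any internal topos $E\in\mathcal C$ admits a semi-strict cotensor $(E^{\mathcal T})^{\mathrm{iso}}$ by $\mathcal T$.
   Context: **Corepita 2-categories.** All 2-categories are strict. A functor $p:\mathbf C\to\mathbf D$ is an isofibration if every isomorphism $X\to Y$ in $\mathbf D$ lifts along $p$ to an isomorphism with any prescribed domain over $X$; a 1-cell $p:X\to Y$ in $\mathcal C$ is an isofibration if $\mathcal C(A,X)\to\mathcal C(A,Y)$ is one for each $A$. A strict pullback square (strict terminal object) is one sent by each $\mathcal C(A,-)$ to a pullback square of categories (the terminal category). A strict arrow object of $X$ is an object $X^\to$ with a 2-cell between 1-cells $X^\to\to X$ inducing an isomorphism $\mathcal C(A,X^\to)\cong\mathcal C(A,X)^\to$ onto the arrow category for every $A$. An object $X$ is groupoidal (a groupoid) if $\mathcal C(A,X)$ is a groupoid for all $A$. A 1-cell $f:X\to Y$ is an arrow-wise iso if $\alpha$ followed by $f$ is invertible for every 2-cell $\alpha$ between 1-cells $A\to X$. A core of $X$ is a groupoidal $X^{\mathrm{iso}}$ with an arrow-wise iso $X^{\mathrm{iso}}\to X$ through which every arrow-wise iso $A\to X$, and every invertible 2-cell between arrow-wise isos $A\to X$, factors uniquely. $\mathcal C$ is corepita if it has a strict terminal object, strict pullbacks of isofibrations, strict arrow objects, and cores. **Internal topoi.** ''Topos'' means elementary topos; a functor between topoi is logical if it preserves finite limits and power objects. An internal topos in $\mathcal C$ is an object $E$ such that $\mathcal C(A,E)$ is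 a topos for every groupoid $A\in\mathcal C$, and $f^*:\mathcal C(A',E)\to\mathcal C(A,E)$ is logical for every 1-cell $f:A\to A'$ between groupoids. **Higher-order theories.** A signature $\mathcal L$ is a multi-sorted first-order signature (sorts, function symbols $f:\vec A\to B$, relation symbols of given arities). Its extension $\mathcal L^{\uparrow}$ adjoins sorts $\mathcal P^nA$ for each sort $A$ and $n\ge1$ (with $\mathcal P^0A=A$) and relation symbols $\in_{A,n}$ of arity $\langle\mathcal P^nA,\mathcal P^{n+1}A\rangle$ for $n\ge0$. A higher-order formula over $\mathcal L$ is a first-order formula over $\mathcal L^\uparrow$. A higher-order theory $\mathcal T$ over $\mathcal L$ is a set of higher-order sentences; it is finite if both this set and $\mathcal L$ (its sorts, function symbols and relation symbols) are finite. An interpretation $M:\mathcal L\to\mathbf C$ in a topos assigns an object $MA$ to each sort, a chosen product $M\vec A$ to each sequence $\vec A$ of sorts occurring as the arity of a symbol, a morphism $M\vec A\to MB$ to each $f:\vec A\to B$, and a monomorphism $MR\to M\vec A$ to each relation symbol $R$ of arity $\vec A$. It extends, uniquely up to unique isomorphism, to $\mathcal L^\uparrow$ by interpreting $\mathcal P^{n+1}A$ as a power object of the interpretation of $\mathcal P^nA$ and $\in_{A,n}$ as the membership relation; sentences are then interpreted in the usual way in the internal logic of the topos. $M$ is a model of $\mathcal T$ if it satisfies all sentences in $\mathcal T$. An isomorphism of interpretations is a family of isomorphisms $M_0A\cong M_1A$ compatible with all function and relation symbols. $(\mathbf C^{\mathcal T})^{\mathrm{iso}}$ denotes the groupoid of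 models of $\mathcal T$ in $\mathbf C$ and their isomorphisms. A logical functor $F:\mathbf C\to\mathbf D$ induces $F_*:(\mathbf C^{\mathcal T})^{\mathrm{iso}}\to(\mathbf D^{\mathcal T})^{\mathrm{iso}}$ by composition, and an invertible natural transformation between logical functors induces a natural isomorphism. **Semi-strict cotensor.** For an internal topos $E\in\mathcal C$, a semi-strict cotensor of $E$ by $\mathcal T$ is a groupoid $(E^{\mathcal T})^{\mathrm{iso}}\in\mathcal C$ together with a model $\mathrm{ev}$ of $\mathcal T$ in the topos $\mathcal C((E^{\mathcal T})^{\mathrm{iso}},E)$ such that, for each groupoid $A\in\mathcal C$, the induced functor $\mathcal C(A,(E^{\mathcal T})^{\mathrm{iso}})\to(\mathcal C(A,E)^{\mathcal T})^{\mathrm{iso}}$, sending $f$ to the image of $\mathrm{ev}$ under the logical functor $f^*:\mathcal C((E^{\mathcal T})^{\mathrm{iso}},E)\to\mathcal C(A,E)$ (and acting correspondingly on 2-cells), is an equivalence of categories which is surjective on objects. (The notation $(E^{\mathcal T})^{\mathrm{iso}}$ is atomic.) *)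

(* Defs.v *)
From Stdlib Require Import List Fin FinFun ProofIrrelevance FunctionalExtensionality.
Set Implicit Arguments.
Unset Strict Implicit.

Record Category := {
  ob : Type;
  hom : ob -> ob -> Type;
  idm : forall a, hom a a;
  comp : forall a b c, hom b c -> hom a b -> hom a c;
  comp_id_l : forall a b (f : hom a b), comp (idm b) f = f;
  comp_id_r : forall a b (f : hom a b), comp f (idm a) = f;
  comp_assoc : forall a b c d (h : hom c d) (g : hom b c) (f : hom a b),
    comp (comp h g) f = comp h (comp g f)
}.
Arguments hom {_} _ _.
Arguments idm {_} _.
Arguments comp {_ _ _ _} _ _.

Declare Scope cat_scope.
Delimit Scope cat_scope with cat.
Notation "g ∘ f" := (comp g f) (at level 40, left associativity) : cat_scope.
Local Open Scope cat_scope.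

(* Equality of morphisms whose boundaries are not syntactically the same.
   [heq f g] implies that the boundaries are equal. *)
Inductive heq {C : Category} {a b : ob C} (f : hom a b)
  : forall {c d : ob C}, hom c d -> Prop :=
| heq_refl : heq f f.

Definition is_iso {C : Category} {a b : ob C} (f : hom a b) : Prop :=
  exists g : hom b a, g ∘ f = idm a /\ f ∘ g = idm b.

Definition is_groupoid (C : Category) : Prop :=
  forall (a b : ob C) (f : hom a b), is_iso f.

Record Functor (C D : Category) := {
  fob :> ob C -> ob D;
  fmap : forall a b, hom a b -> hom (fob a) (fob b);
  fmap_id : forall a, fmap (idm a) = idm (fob a);
  fmap_comp : forall a b c (g : hom b c) (f : hom a b),
    fmap (g ∘ f) = fmap g ∘ fmap f
}.
Arguments fmap {_ _} _ {_ _} _.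

Definition fid (C : Category) : Functor C C :=
  {| fob := fun a => a; fmap := fun a b f => f;
     fmap_id := fun _ => eq_refl; fmap_comp := fun _ _ _ _ _ => eq_refl |}.

Definition fcomp {C D E : Category} (G : Functor D E) (F : Functor C D) : Functor C E.
Proof.
  refine {| fob := fun a => G (F a); fmap := fun a b f => fmap G (fmap F f) |}.
  - intro a. now rewrite !fmap_id.
  - intros. now rewrite !fmap_comp.
Defined.

(* Strict equality of functors, stated extensionally. *)
Definition feq {C D : Category} (F G : Functor C D) : Prop :=
  (forall a, F a = G a) /\
  (forall (a b : ob C) (f : hom a b), heq (fmap F f) (fmap G f)).

Definition is_cat_iso {C D : Category} (F : Functor C D) : Prop :=
  exists G : Functor D C, feq (fcomp G F) (fid C) /\ feq (fcomp F G) (fid D).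

Record NatTrans {C D : Category} (F G : Functor C D) := {
  nt :> forall a, hom (F a) (G a);
  nt_nat : forall a b (f : hom a b), nt b ∘ fmap F f = fmap G f ∘ nt a
}.

Definition nat_isomorphic {C D : Category} (F G : Functor C D) : Prop :=
  exists t : NatTrans F G, forall a, is_iso (t a).

Definition is_equivalence {C D : Category} (F : Functor C D) : Prop :=
  exists G : Functor D C,
    nat_isomorphic (fcomp G F) (fid C) /\ nat_isomorphic (fcomp F G) (fid D).

Definition surjective_on_objects {C D : Category} (F : Functor C D) : Prop :=
  forall d, exists c, F c = d.

Definition isofibration {C D : Category} (p : Functor C D) : Prop :=
  forall (x : ob C) (d : ob D) (phi : hom (p x) d), is_iso phi ->
    exists (y : ob C) (psi : hom x y), is_iso psi /\ heq (fmap p psi) phi.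

Definition is_terminal_cat (C : Category) : Prop :=
  (exists! x : ob C, True) /\ (forall a b : ob C, exists! f : hom a b, True).

Definition is_pullback_cat {W X Y Z : Category}
  (P : Functor W X) (Q : Functor W Y) (F : Functor X Z) (G : Functor Y Z) : Prop :=
  feq (fcomp F P) (fcomp G Q) /\
  forall (D : Category) (U : Functor D X) (V : Functor D Y),
    feq (fcomp F U) (fcomp G V) ->
    exists H : Functor D W,
      (feq (fcomp P H) U /\ feq (fcomp Q H) V) /\
      forall H' : Functor D W, feq (fcomp P H') U -> feq (fcomp Q H') V -> feq H H'.

Definition prod_cat (C D : Category) : Category.
Proof.
  refine {| ob := (ob C * ob D)%type;
            hom := fun x y => (hom (fst x) (fst y) * hom (snd x) (snd y))%type;
            idm := fun x => (idm (fst x), idm (snd x));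
            comp := fun x y z g f => (fst g ∘ fst f, snd g ∘ snd f) |}.
  - intros a b [f g]; simpl; now rewrite !comp_id_l.
  - intros a b [f g]; simpl; now rewrite !comp_id_r.
  - intros; simpl; now rewrite !comp_assoc.
Defined.

Record ArrowMor {C : Category} (u v : {x : ob C & {y : ob C & hom x y}}) := {
  am_src : hom (projT1 u) (projT1 v);
  am_tgt : hom (projT1 (projT2 u)) (projT1 (projT2 v));
  am_sq : am_tgt ∘ projT2 (projT2 u) = projT2 (projT2 v) ∘ am_src
}.

Lemma ArrowMor_eq (C : Category) (u v : {x : ob C & {y : ob C & hom x y}})
  (f g : ArrowMor u v) : am_src f = am_src g -> am_tgt f = am_tgt g -> f = g.
Proof.
  destruct f, g; simpl; intros; subst. f_equal. apply proof_irrelevance.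
Qed.

Definition arrow_cat (C : Category) : Category.
Proof.
  refine {| ob := {x : ob C & {y : ob C & hom x y}};
            hom := @ArrowMor C;
            idm := fun u => {| am_src := idm (projT1 u);
                               am_tgt := idm (projT1 (projT2 u)); am_sq := _ |};
            comp := fun u v w g f => {| am_src := am_src g ∘ am_src f;
                                        am_tgt := am_tgt g ∘ am_tgt f; am_sq := _ |} |}.
  Unshelve.
  - intros; apply ArrowMor_eq; simpl; apply comp_id_l.
  - intros; apply ArrowMor_eq; simpl; apply comp_id_r.
  - intros; apply ArrowMor_eq; simpl; apply comp_assoc.
  - now rewrite comp_id_l, comp_id_r.
  - now rewrite comp_assoc, am_sq, <- comp_assoc, am_sq, comp_assoc.
Defined.

Definition arrow_functor {C D : Category} {F G : Functor C D} (t : NatTrans F G)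
  : Functor C (arrow_cat D).
Proof.
  refine (@Build_Functor C (arrow_cat D)
            (fun a => existT _ (F a) (existT _ (G a) (t a)))
            (fun a b f =>
               @Build_ArrowMor D (existT _ (F a) (existT _ (G a) (t a)))
                 (existT _ (F b) (existT _ (G b) (t b)))
                 (fmap F f) (fmap G f) _) _ _).
  Unshelve.
  - intro a; apply ArrowMor_eq; simpl; apply fmap_id.
  - intros; apply ArrowMor_eq; simpl; apply fmap_comp.
  - simpl. symmetry. apply nt_nat.
Defined.

(* [hcomp (g, f)] is the composite "f, then g". The unit and associativity laws say that
   the two functors agree on 1-cells and on 2-cells. *)
Record TwoCat := {
  ob2 : Type;
  hom2 : ob2 -> ob2 -> Category;
  id1 : forall X, ob (hom2 X X);
  hcomp : forall X Y Z, Functor (prod_cat (hom2 Y Z) (hom2 X Y)) (hom2 X Z);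
  hcomp_id_l1 : forall X Y (f : ob (hom2 X Y)), hcomp X Y Y (id1 Y, f) = f;
  hcomp_id_l2 : forall X Y (f g : ob (hom2 X Y)) (a : hom f g),
    heq (@fmap _ _ (hcomp X Y Y) (id1 Y, f) (id1 Y, g) (idm (id1 Y), a)) a;
  hcomp_id_r1 : forall X Y (f : ob (hom2 X Y)), hcomp X X Y (f, id1 X) = f;
  hcomp_id_r2 : forall X Y (f g : ob (hom2 X Y)) (a : hom f g),
    heq (@fmap _ _ (hcomp X X Y) (f, id1 X) (g, id1 X) (a, idm (id1 X))) a;
  hcomp_assoc1 : forall W X Y Z
    (h : ob (hom2 Y Z)) (g : ob (hom2 X Y)) (f : ob (hom2 W X)),
    hcomp W X Z (hcomp X Y Z (h, g), f) = hcomp W Y Z (h, hcomp W X Y (g, f));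
  hcomp_assoc2 : forall W X Y Z
    (h h' : ob (hom2 Y Z)) (g g' : ob (hom2 X Y)) (f f' : ob (hom2 W X))
    (c : hom h h') (b : hom g g') (a : hom f f'),
    heq
      (@fmap _ _ (hcomp W X Z) (hcomp X Y Z (h, g), f) (hcomp X Y Z (h', g'), f')
         (@fmap _ _ (hcomp X Y Z) (h, g) (h', g') (c, b), a))
      (@fmap _ _ (hcomp W Y Z) (h, hcomp W X Y (g, f)) (h', hcomp W X Y (g', f'))
         (c, @fmap _ _ (hcomp W X Y) (g, f) (g', f') (b, a)))
}.
Arguments hom2 {_} _ _.
Arguments id1 {_} _.
Arguments hcomp {_} _ _ _.

Section TwoCat.
Context {C : TwoCat}.

Definition comp1 {X Y Z : ob2 C} (g : ob (hom2 Y Z)) (f : ob (hom2 X Y)) : ob (hom2 X Z) :=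
  hcomp X Y Z (g, f).

Definition comp2 {X Y Z : ob2 C} {g g' : ob (hom2 Y Z)} {f f' : ob (hom2 X Y)}
  (b : hom g g') (a : hom f f') : hom (comp1 g f) (comp1 g' f') :=
  @fmap _ _ (hcomp X Y Z) (g, f) (g', f') (b, a).

Lemma comp2_id {X Y Z : ob2 C} (g : ob (hom2 Y Z)) (f : ob (hom2 X Y)) :
  comp2 (idm g) (idm f) = idm (comp1 g f).
Proof. exact (fmap_id (hcomp X Y Z) (g, f)). Qed.

Lemma comp2_comp {X Y Z : ob2 C} {g g' g'' : ob (hom2 Y Z)} {f f' f'' : ob (hom2 X Y)}
  (b' : hom g' g'') (b : hom g g') (a' : hom f' f'') (a : hom f f') :
  comp2 (b' ∘ b) (a' ∘ a) = comp2 b' a' ∘ comp2 b a.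
Proof.
  exact (@fmap_comp _ _ (hcomp X Y Z) (g, f) (g', f') (g'', f'') (b', a') (b, a)).
Qed.

Definition post (A : ob2 C) {X Y : ob2 C} (p : ob (hom2 X Y))
  : Functor (hom2 A X) (hom2 A Y).
Proof.
  refine {| fob := fun g => comp1 p g; fmap := fun g h a => comp2 (idm p) a |}.
  - intro; apply comp2_id.
  - intros. rewrite <- comp2_comp. now rewrite comp_id_l.
Defined.

Definition pre {A B : ob2 C} (f : ob (hom2 A B)) (E : ob2 C)
  : Functor (hom2 B E) (hom2 A E).
Proof.
  refine {| fob := fun g => comp1 g f; fmap := fun g h b => comp2 b (idm f) |}.
  - intro; apply comp2_id.
  - intros. rewrite <- comp2_comp. now rewrite comp_id_l.
Defined.

Definition post_nat (A : ob2 C) {X Y : ob2 C} {s t : ob (hom2 X Y)} (k : hom s t)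
  : NatTrans (post A s) (post A t).
Proof.
  refine (@Build_NatTrans _ _ (post A s) (post A t) (fun g => comp2 k (idm g)) _).
  intros g h a; simpl. rewrite <- !comp2_comp.
  now rewrite !comp_id_l, !comp_id_r.
Defined.

Definition pre_nat {A B : ob2 C} {f g : ob (hom2 A B)} (a : hom f g) (E : ob2 C)
  : NatTrans (pre f E) (pre g E).
Proof.
  refine (@Build_NatTrans _ _ (pre f E) (pre g E) (fun h => comp2 (idm h) a) _).
  intros h k b; simpl. rewrite <- !comp2_comp.
  now rewrite !comp_id_l, !comp_id_r.
Defined.

Definition isofibration1 {X Y : ob2 C} (p : ob (hom2 X Y)) : Prop :=
  forall A, isofibration (post A p).

Definition strict_terminal (T : ob2 C) : Prop :=
  forall A, is_terminal_cat (hom2 A T).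

Definition strict_pullback {W X Y Z : ob2 C}
  (p : ob (hom2 W X)) (q : ob (hom2 W Y)) (f : ob (hom2 X Z)) (g : ob (hom2 Y Z)) : Prop :=
  forall A, is_pullback_cat (post A p) (post A q) (post A f) (post A g).

Definition strict_arrow_object (X P : ob2 C) (s t : ob (hom2 P X)) (k : hom s t) : Prop :=
  forall A, is_cat_iso (arrow_functor (post_nat A k)).

Definition groupoidal (X : ob2 C) : Prop := forall A, is_groupoid (hom2 A X).

Definition arrowwise_iso {X Y : ob2 C} (f : ob (hom2 X Y)) : Prop :=
  forall A (g h : ob (hom2 A X)) (a : hom g h), is_iso (fmap (post A f) a).

Definition is_core (X K : ob2 C) (i : ob (hom2 K X)) : Prop :=
  groupoidal K /\ arrowwise_iso i /\
  (forall A (f : ob (hom2 A X)), arrowwise_iso f ->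
     exists! g : ob (hom2 A K), comp1 i g = f) /\
  (forall A (f f' : ob (hom2 A X)) (a : hom f f'),
     arrowwise_iso f -> arrowwise_iso f' -> is_iso a ->
     exists (g g' : ob (hom2 A K)) (b : hom g g'),
       heq (fmap (post A i) b) a /\
       forall (h h' : ob (hom2 A K)) (c : hom h h'),
         heq (fmap (post A i) c) a -> heq b c).

End TwoCat.

Definition corepita (C : TwoCat) : Prop :=
  (exists T : ob2 C, strict_terminal T) /\
  (forall (X Y Z : ob2 C) (f : ob (hom2 X Z)) (g : ob (hom2 Y Z)), isofibration1 f ->
     exists (W : ob2 C) (p : ob (hom2 W X)) (q : ob (hom2 W Y)), strict_pullback p q f g) /\
  (forall X : ob2 C, exists (P : ob2 C) (s t : ob (hom2 P X)) (k : hom s t),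
     strict_arrow_object k) /\
  (forall X : ob2 C, exists (K : ob2 C) (i : ob (hom2 K X)), is_core i).

Record Cone {J C : Category} (D : Functor J C) := {
  apex : ob C;
  leg : forall j, hom apex (D j);
  leg_nat : forall j k (f : hom j k), fmap D f ∘ leg j = leg k
}.

Definition is_limit {J C : Category} {D : Functor J C} (c : Cone D) : Prop :=
  forall c' : Cone D, exists! h : hom (apex c') (apex c), forall j, leg c j ∘ h = leg c' j.

Definition map_cone {J C C' : Category} {D : Functor J C} (F : Functor C C') (c : Cone D)
  : Cone (fcomp F D).
Proof.
  refine (@Build_Cone _ _ (fcomp F D) (F (apex c)) (fun j => fmap F (leg c j)) _).
  intros j k f; simpl. now rewrite <- fmap_comp, leg_nat.
Defined.

Definition finite_cat (J : Category) : Prop :=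
  Finite (ob J) /\ forall a b : ob J, Finite (hom a b).

Definition has_finite_limits (C : Category) : Prop :=
  forall (J : Category) (D : Functor J C), finite_cat J -> exists c : Cone D, is_limit c.

Definition preserves_finite_limits {C C' : Category} (F : Functor C C') : Prop :=
  forall (J : Category) (D : Functor J C) (c : Cone D),
    finite_cat J -> is_limit c -> is_limit (map_cone F c).

Definition is_mono {C : Category} {a b : ob C} (m : hom a b) : Prop :=
  forall (c : ob C) (f g : hom c a), m ∘ f = m ∘ g -> f = g.

Definition is_product {C : Category} {n : nat} (X : Fin.t n -> ob C)
  (P : ob C) (pi : forall i, hom P (X i)) : Prop :=
  forall (Y : ob C) (f : forall i, hom Y (X i)),
    exists! h : hom Y P, forall i, pi i ∘ h = f i.

Record Product {C : Category} {n : nat} (X : Fin.t n -> ob C) := {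
  pr_ob : ob C;
  pr : forall i, hom pr_ob (X i);
  pr_spec : is_product pr
}.

Definition is_pullback {C : Category} {w x y z : ob C}
  (p : hom w x) (q : hom w y) (f : hom x z) (g : hom y z) : Prop :=
  f ∘ p = g ∘ q /\
  forall (v : ob C) (a : hom v x) (b : hom v y), f ∘ a = g ∘ b ->
    exists! h : hom v w, p ∘ h = a /\ q ∘ h = b.

Definition is_equalizer {C : Category} {w x y : ob C} (e : hom w x) (f g : hom x y) : Prop :=
  f ∘ e = g ∘ e /\
  forall (v : ob C) (a : hom v x), f ∘ a = g ∘ a -> exists! h : hom v w, e ∘ h = a.

(* Representatives of subobjects, preordered by [sub_le]. *)
Record Sub {C : Category} (X : ob C) := {
  sub_ob : ob C;
  sub_arr : hom sub_ob X;
  sub_mono : is_mono sub_arr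
}.

Definition sub_le {C : Category} {X : ob C} (m n : Sub X) : Prop :=
  exists k, sub_arr n ∘ k = sub_arr m.

(* [n] represents the pullback of [m] along [f]. *)
Definition sub_pullback {C : Category} {X Y : ob C} (f : hom X Y) (m : Sub Y) (n : Sub X)
  : Prop :=
  exists k, is_pullback (sub_arr n) k f (sub_arr m).

Definition pair_family {T : Type} (a b : T) : Fin.t 2 -> T :=
  fun i => Fin.caseS' i (fun _ => T) a (fun _ => b).

Definition fst_ix : Fin.t 2 := Fin.F1.
Definition snd_ix : Fin.t 2 := Fin.FS Fin.F1.

(* For a two-term family [X] with product [Q]: [e] exhibits the second object of [X] as a
   power object of the first one. *)
Definition is_power {C : Category} {X : Fin.t 2 -> ob C} (Q : Product X) (e : Sub (pr_ob Q))
  : Prop :=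
  forall (Y : ob C) (R : Product (pair_family (X fst_ix) Y)) (r : Sub (pr_ob R)),
    exists! chi : hom Y (X snd_ix),
      exists h : hom (pr_ob R) (pr_ob Q),
        pr Q fst_ix ∘ h = pr R fst_ix /\
        pr Q snd_ix ∘ h = chi ∘ pr R snd_ix /\
        sub_pullback h e r.

Definition is_topos (C : Category) : Prop :=
  has_finite_limits C /\
  forall X : ob C, exists (P : ob C) (Q : Product (pair_family X P)) (e : Sub (pr_ob Q)),
    is_power e.

Definition discrete (T : Type) : Category.
Proof.
  refine {| ob := T; hom := fun a b => a = b; idm := fun a => eq_refl;
            comp := fun a b c g f => eq_trans f g |};
  intros; apply proof_irrelevance.
Defined.

Lemma discrete_finite n : finite_cat (discrete (Fin.t n)).
Proof.
  split; [apply Fin_Finite|].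
  intros a b; simpl. destruct (Fin.eq_dec a b) as [e|e].
  - exists (e :: nil). intro e'. left. apply proof_irrelevance.
  - exists nil. intro e'. now destruct e.
Qed.

Definition discrete_diagram {T : Type} {C : Category} (X : T -> ob C)
  : Functor (discrete T) C.
Proof.
  refine (@Build_Functor (discrete T) C X
    (fun a b (e : a = b) => match e in _ = c return hom (X a) (X c) with
                            | eq_refl => idm _ end) _ _).
  - reflexivity.
  - intros a b c g f; simpl in *. destruct g, f; simpl. now rewrite comp_id_l.
Defined.

Definition discrete_cone {T : Type} {C : Category} (D : Functor (discrete T) C) (P : ob C)
  (pi : forall i : T, hom P (D i)) : Cone D.
Proof.
  refine (@Build_Cone (discrete T) C D P pi _).
  intros j k f; simpl in f; destruct f.
  rewrite (fmap_id D j : fmap D eq_refl = idm _). apply comp_id_l.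
Defined.

Lemma preserves_product (C C' : Category) (F : Functor C C') n (X : Fin.t n -> ob C)
  (P : ob C) (pi : forall i, hom P (X i)) :
  preserves_finite_limits F -> is_product pi ->
  @is_product C' n (fun i => F (X i)) (F P) (fun i => fmap F (pi i)).
Proof.
  intros HF Hpi.
  assert (L : is_limit (discrete_cone (D := discrete_diagram X) pi)).
  { intro c. exact (Hpi (apex c) (leg c)). }
  apply (HF _ _ _ (discrete_finite n)) in L.
  intros Y f.
  exact (L (discrete_cone (D := fcomp F (discrete_diagram X)) f)).
Qed.

Inductive cospan_ob := cs_l | cs_r | cs_c.

Definition cospan_hom (a b : cospan_ob) : Type :=
  match a, b with
  | cs_l, cs_l | cs_r, cs_r | cs_c, cs_c | cs_l, cs_c | cs_r, cs_c => unit
  | _, _ => Empty_set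
  end.

Definition cospan : Category.
Proof.
  unshelve refine {| ob := cospan_ob; hom := cospan_hom |}.
  - intros []; exact tt.
  - intros [] [] []; simpl; (exact (fun _ _ => tt) || (intros [] []) || (intros ? [])).
  - intros [] []; simpl; intros []; reflexivity.
  - intros [] []; simpl; intros []; reflexivity.
  - intros [] [] [] []; simpl; intros h g f; destruct h; destruct g; destruct f; reflexivity.
Defined.

Lemma cospan_finite : finite_cat cospan.
Proof.
  split.
  - exists (cs_l :: cs_r :: cs_c :: nil). intros []; simpl; auto.
  - intros [] []; simpl;
      ((exists (tt :: nil); intros []; now left) || (exists nil; intros [])).
Qed.

Definition cospan_diagram {C : Category} {x y z : ob C} (f : hom x z) (g : hom y z)
  : Functor cospan C.
Proof.
  unshelve refine (@Build_Functor cospan C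
    (fun j => match j with cs_l => x | cs_r => y | cs_c => z end) _ _ _).
  - intros [] []; simpl;
      first [ intros []; fail | exact (fun _ => idm _)
            | exact (fun _ => f) | exact (fun _ => g) | intros [] ].
  - intros []; reflexivity.
  - intros [] [] []; simpl; intros h k; destruct h; destruct k; simpl;
      now rewrite ?comp_id_l, ?comp_id_r.
Defined.

Definition cospan_cone {C : Category} (D : Functor cospan C) (w : ob C)
  (p : hom w (D cs_l)) (q : hom w (D cs_r))
  (e : @fmap _ _ D cs_l cs_c tt ∘ p = @fmap _ _ D cs_r cs_c tt ∘ q) : Cone D.
Proof.
  unshelve refine (@Build_Cone cospan C D w
    (fun j => match j with cs_l => p | cs_r => q
                      | cs_c => @fmap _ _ D cs_l cs_c tt ∘ p end) _).
  assert (I : forall j (v : hom w (D j)) (u : @hom cospan j j), fmap D u ∘ v = v).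
  { intros j v u. replace u with (@idm cospan j) by (destruct j, u; reflexivity).
    rewrite fmap_id. apply comp_id_l. }
  intros [] []; try apply I; intro u; simpl in u; destruct u;
    [reflexivity | symmetry; exact e].
Defined.

Lemma preserves_pullback (C C' : Category) (F : Functor C C') (w x y z : ob C)
  (p : hom w x) (q : hom w y) (f : hom x z) (g : hom y z) :
  preserves_finite_limits F -> is_pullback p q f g ->
  is_pullback (fmap F p) (fmap F q) (fmap F f) (fmap F g).
Proof.
  intros HF [e H].
  assert (L : is_limit (cospan_cone (D := cospan_diagram f g) (p := p) (q := q) e)).
  { intro c.
    assert (E1 := leg_nat c (tt : @hom cospan cs_l cs_c)).
    assert (E2 := leg_nat c (tt : @hom cospan cs_r cs_c)). simpl in E1, E2.
    destruct (H (apex c) (leg c cs_l) (leg c cs_r)) as [h [[h1 h2] hu]].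
    { now rewrite E1, E2. }
    exists h; split.
    - intros []; simpl; auto. now rewrite comp_assoc, h1.
    - intros h' Hh'. apply hu. split; [exact (Hh' cs_l) | exact (Hh' cs_r)]. }
  apply (HF _ _ _ cospan_finite) in L.
  split; [now rewrite <- !fmap_comp, e|].
  intros v a b E.
  destruct (L (cospan_cone (D := fcomp F (cospan_diagram f g)) (p := a) (q := b) E))
    as [h [h1 hu]]; simpl in *.
  exists h; split.
  - split; [exact (h1 cs_l) | exact (h1 cs_r)].
  - intros h' [E1 E2]. apply hu. intros []; simpl; auto.
    now rewrite fmap_comp, comp_assoc, E1.
Qed.

Lemma mono_pullback (C : Category) (a b : ob C) (m : hom a b) :
  is_mono m <-> is_pullback (idm a) (idm a) m m.
Proof.
  split.
  - intro H; split; auto. intros v f g E. exists f.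
    apply H in E. subst g. split.
    + split; apply comp_id_l.
    + intros h [E _]. now rewrite comp_id_l in E.
  - intros [_ H] c f g E. destruct (H c f g E) as [h [[E1 E2] _]].
    rewrite comp_id_l in E1, E2. congruence.
Qed.

Lemma preserves_mono (C C' : Category) (F : Functor C C') (a b : ob C) (m : hom a b) :
  preserves_finite_limits F -> is_mono m -> is_mono (fmap F m).
Proof.
  intros HF H. apply mono_pullback in H. apply mono_pullback.
  rewrite <- fmap_id. now apply preserves_pullback.
Qed.

Definition map_product {C C' : Category} (F : Functor C C') (HF : preserves_finite_limits F)
  {n : nat} {X : Fin.t n -> ob C} (Q : Product X) : Product (fun i => F (X i)) :=
  {| pr_ob := F (pr_ob Q); pr := fun i => fmap F (pr Q i);
     pr_spec := preserves_product HF (pr_spec Q) |}.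

Definition map_sub {C C' : Category} (F : Functor C C') (HF : preserves_finite_limits F)
  {X : ob C} (m : Sub X) : Sub (F X) :=
  {| sub_ob := F (sub_ob m); sub_arr := fmap F (sub_arr m);
     sub_mono := preserves_mono HF (@sub_mono _ _ m) |}.

Record logical {C C' : Category} (F : Functor C C') : Prop := {
  log_lim : preserves_finite_limits F;
  log_pow : forall (X : Fin.t 2 -> ob C) (Q : Product X) (e : Sub (pr_ob Q)),
    is_power e -> is_power (Q := map_product log_lim Q) (map_sub log_lim e)
}.

Definition internal_topos {C : TwoCat} (E : ob2 C) : Prop :=
  (forall A : ob2 C, groupoidal A -> is_topos (hom2 A E)) /\
  (forall (A A' : ob2 C) (f : ob (hom2 A A')), groupoidal A -> groupoidal A' ->
     logical (pre f E)).

Record seq (I : Type) := { len : nat; item :> Fin.t len -> I }.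
Arguments item {_} _ _.

Definition seq_nil {I : Type} : seq I := {| len := 0; item := Fin.case0 (fun _ => I) |}.

Definition seq_cons {I : Type} (a : I) (w : seq I) : seq I :=
  {| len := S (len w);
     item := fun i => Fin.caseS' i (fun _ => I) a (item w) |}.

Record Signature := {
  sort : Type;
  fsym : Type;
  rsym : Type;
  dom : fsym -> seq sort;
  cod : fsym -> sort;
  arity : rsym -> seq sort
}.

(* In the extended signature the pair [(A, n)] is the n-fold power sort of [A];
   [inr (A, n)] is the symbol for membership of elements of [(A, n)] in those of
   [(A, S n)]. *)
Definition up_seq {I : Type} (w : seq I) : seq (I * nat) :=
  {| len := len w; item := fun i => (w i, 0) |}.

Definition mem_arity {I : Type} (A : I) (n : nat) : seq (I * nat) :=
  {| len := 2; item := pair_family (A, n) (A, S n) |}.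

Definition up (L : Signature) : Signature :=
  {| sort := sort L * nat;
     fsym := fsym L;
     rsym := rsym L + sort L * nat;
     dom := fun f => up_seq (dom f);
     cod := fun f => (cod f, 0);
     arity := fun R => match R with
                       | inl R => up_seq (arity R)
                       | inr (A, n) => mem_arity A n
                       end |}.

(* Variables are positions in the context; a binder adds position [F1]. *)
Inductive term {L : Signature} (G : seq (sort L)) : sort L -> Type :=
| tvar : forall i, term G (item G i)
| tapp : forall f : fsym L, (forall i, term G (item (dom f) i)) -> term G (cod f).
Arguments tvar {_} _ _.
Arguments tapp {_ _} _ _.

Inductive formula {L : Signature} (G : seq (sort L)) : Type :=
| frel : forall R : rsym L, (forall i, term G (item (arity R) i)) -> formula G
| feql : forall A : sort L, term G A -> term G A -> formula G
| ftop : formula G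
| fbot : formula G
| fand : formula G -> formula G -> formula G
| for_ : formula G -> formula G -> formula G
| fimp : formula G -> formula G -> formula G
| fall : forall A : sort L, formula (seq_cons A G) -> formula G
| fex : forall A : sort L, formula (seq_cons A G) -> formula G.

Arguments frel {_ _} _ _.
Arguments feql {_ _ _} _ _.
Arguments ftop {_} _.
Arguments fbot {_} _.
Arguments fall {_ _} _ _.
Arguments fex {_ _} _ _.

Definition sentence (L : Signature) : Type := formula (@seq_nil (sort L)).

Definition Theory (L : Signature) : Type := sentence (up L) -> Prop.

Definition finite_theory {L : Signature} (T : Theory L) : Prop :=
  Finite (sort L) /\ Finite (fsym L) /\ Finite (rsym L) /\
  exists l : list (sentence (up L)), forall phi, T phi -> In phi l.

Record Structure (L : Signature) (C : Category) := {
  st_sort : sort L -> ob C;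
  st_dom : forall f : fsym L, Product (fun i => st_sort (dom f i));
  st_fun : forall f : fsym L, hom (pr_ob (st_dom f)) (st_sort (cod f));
  st_arity : forall R : rsym L, Product (fun i => st_sort (arity R i));
  st_rel : forall R : rsym L, Sub (pr_ob (st_arity R))
}.
Arguments st_dom {_ _} _ _.
Arguments st_fun {_ _} _ _.
Arguments st_arity {_ _} _ _.
Arguments st_rel {_ _} _ _.

Unset Implicit Arguments.
Section Semantics.
Context {L : Signature} {C : Category} (M : Structure L C).

Definition Ctx (G : seq (sort L)) : Type := Product (fun i => st_sort M (G i)).

(* [term_den X t h]: the morphism [h] is the denotation of [t] in context [X]. *)
Fixpoint term_den {G : seq (sort L)} (X : Ctx G) {A : sort L} (t : term G A)
  : hom (pr_ob X) (st_sort M A) -> Prop :=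
  match t in term _ A return hom (pr_ob X) (st_sort M A) -> Prop with
  | tvar _ i => fun h => h = pr X i
  | tapp f ts => fun h =>
      exists k : hom (pr_ob X) (pr_ob (st_dom M f)),
        (forall i, term_den X (ts i) (pr (st_dom M f) i ∘ k)) /\ h = st_fun M f ∘ k
  end.

(* [form_den phi X m]: the monomorphism [m] represents the subobject of [X] denoted by
   [phi]. The subobject clauses are the lattice and Heyting operations of the subobject
   preorder, and the right and left adjoints of pullback along a projection. *)
Fixpoint form_den {G : seq (sort L)} (phi : formula G)
  : forall X : Ctx G, Sub (pr_ob X) -> Prop :=
  match phi with
  | frel R ts => fun X m =>
      exists k : hom (pr_ob X) (pr_ob (st_arity M R)),
        (forall i, term_den X (ts i) (pr (st_arity M R) i ∘ k)) /\
        sub_pullback k (st_rel M R) m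
  | feql t1 t2 => fun X m =>
      exists h1 h2, term_den X t1 h1 /\ term_den X t2 h2 /\ is_equalizer (sub_arr m) h1 h2
  | ftop _ => fun X m => forall n : Sub (pr_ob X), sub_le n m
  | fbot _ => fun X m => forall n : Sub (pr_ob X), sub_le m n
  | fand p q => fun X m =>
      exists a b, form_den p X a /\ form_den q X b /\
        forall n, sub_le n m <-> (sub_le n a /\ sub_le n b)
  | for_ p q => fun X m =>
      exists a b, form_den p X a /\ form_den q X b /\
        forall n, sub_le m n <-> (sub_le a n /\ sub_le b n)
  | fimp p q => fun X m =>
      exists a b, form_den p X a /\ form_den q X b /\
        forall n c, (forall d, sub_le d c <-> (sub_le d n /\ sub_le d a)) ->
          (sub_le n m <-> sub_le c b)
  | fall A p => fun X m =>
      exists (Y : Ctx (seq_cons A G)) (a : Sub (pr_ob Y)) (q : hom (pr_ob Y) (pr_ob X)),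
        form_den p Y a /\
        (forall i, pr X i ∘ q = pr Y (Fin.FS i)) /\
        forall n n', sub_pullback q n n' -> (sub_le n m <-> sub_le n' a)
  | fex A p => fun X m =>
      exists (Y : Ctx (seq_cons A G)) (a : Sub (pr_ob Y)) (q : hom (pr_ob Y) (pr_ob X)),
        form_den p Y a /\
        (forall i, pr X i ∘ q = pr Y (Fin.FS i)) /\
        forall n n', sub_pullback q n n' -> (sub_le m n <-> sub_le a n')
  end.

Definition st_satisfies (phi : sentence L) : Prop :=
  exists (X : Ctx seq_nil) (m : Sub (pr_ob X)),
    form_den phi X m /\ forall n : Sub (pr_ob X), sub_le n m.

End Semantics.
Set Implicit Arguments.

Definition occurs {L : Signature} (w : seq (sort L)) : Prop :=
  (exists f : fsym L, dom f = w) \/ (exists R : rsym L, arity R = w).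

Lemma occurs_dom {L : Signature} (f : fsym L) : occurs (dom f).
Proof. left; now exists f. Qed.

Lemma occurs_arity {L : Signature} (R : rsym L) : occurs (arity R).
Proof. right; now exists R. Qed.

(* One product is chosen for each sequence of sorts that occurs as an arity, shared by all
   symbols of that arity. *)
Record Interp (L : Signature) (C : Category) := {
  in_sort : sort L -> ob C;
  in_seq : forall w : seq (sort L), occurs w -> Product (fun i => in_sort (w i));
  in_fun : forall f : fsym L, hom (pr_ob (in_seq (occurs_dom f))) (in_sort (cod f));
  in_rel : forall R : rsym L, Sub (pr_ob (in_seq (occurs_arity R)))
}.
Arguments in_seq {_ _} _ {_} _.
Arguments in_fun {_ _} _ _.
Arguments in_rel {_ _} _ _.

Definition up_ob {I T : Type} (M : I -> T) (P : I -> nat -> T) (A : I * nat) : T :=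
  match snd A with 0 => M (fst A) | S n => P (fst A) n end.

(* [pe_ob A n] interprets the (n+1)-fold power sort of [A]; the 0-fold one is [A] itself. *)
Record PowerExt {L : Signature} {C : Category} (M : Interp L C) := {
  pe_ob : sort L -> nat -> ob C;
  pe_prod : forall A n, Product (fun i => up_ob (in_sort M) pe_ob (mem_arity A n i));
  pe_mem : forall A n, Sub (pr_ob (pe_prod A n));
  pe_power : forall A n, is_power (pe_mem A n)
}.
Arguments pe_ob {_ _ _} _ _ _.
Arguments pe_prod {_ _ _} _ _ _.
Arguments pe_mem {_ _ _} _ _ _.

Definition extend {L : Signature} {C : Category} {M : Interp L C} (P : PowerExt M)
  : Structure (up L) C :=
  let s : sort (up L) -> ob C := up_ob (in_sort M) (pe_ob P) in
  @Build_Structure (up L) C s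
    (fun f : fsym (up L) => in_seq M (occurs_dom (L := L) f))
    (fun f : fsym (up L) => in_fun M f)
    (fun R : rsym (up L) =>
       match R return Product (fun i => s (arity (s := up L) R i)) with
       | inl R => in_seq M (occurs_arity R)
       | inr (A, n) => pe_prod P A n
       end)
    (fun R : rsym (up L) =>
       match R as R return
         Sub (pr_ob (match R return Product (fun i => s (arity (s := up L) R i)) with
                     | inl R => in_seq M (occurs_arity R)
                     | inr (A, n) => pe_prod P A n
                     end)) with
       | inl R => in_rel M R
       | inr (A, n) => pe_mem P A n
       end).

(* Extensions exist in a topos and are unique up to isomorphism, so it does not matter
   which one is used. *)
Definition satisfies {L : Signature} {C : Category} (M : Interp L C) (phi : sentence (up L))
  : Prop :=
  exists P : PowerExt M, st_satisfies (extend P) phi.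

Definition is_model {L : Signature} {C : Category} (T : Theory L) (M : Interp L C) : Prop :=
  forall phi, T phi -> satisfies M phi.

(* [ii_fun] and [ii_rel]: [h] is the morphism induced on the products, and [k] the
   restriction to the relations. *)
Record InterpIso {L : Signature} {C : Category} (M N : Interp L C) := {
  ii :> forall A : sort L, hom (in_sort M A) (in_sort N A);
  ii_iso : forall A, is_iso (ii A);
  ii_fun : forall f : fsym L,
    exists h : hom (pr_ob (in_seq M (occurs_dom f))) (pr_ob (in_seq N (occurs_dom f))),
      (forall i, pr (in_seq N (occurs_dom f)) i ∘ h
                 = ii (dom f i) ∘ pr (in_seq M (occurs_dom f)) i) /\
      in_fun N f ∘ h = ii (cod f) ∘ in_fun M f;
  ii_rel : forall R : rsym L,
    exists (h : hom (pr_ob (in_seq M (occurs_arity R))) (pr_ob (in_seq N (occurs_arity R))))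
           (k : hom (sub_ob (in_rel M R)) (sub_ob (in_rel N R))),
      (forall i, pr (in_seq N (occurs_arity R)) i ∘ h
                 = ii (arity R i) ∘ pr (in_seq M (occurs_arity R)) i) /\
      is_iso k /\
      sub_arr (in_rel N R) ∘ k = h ∘ sub_arr (in_rel M R)
}.

Lemma InterpIso_eq (L : Signature) (C : Category) (M N : Interp L C) (u v : InterpIso M N) :
  (forall A, u A = v A) -> u = v.
Proof.
  destruct u as [u a b c], v as [v a' b' c']; simpl; intro H.
  assert (u = v) by now apply functional_extensionality_dep.
  subst. f_equal; apply proof_irrelevance.
Qed.

Lemma is_iso_id (C : Category) (a : ob C) : is_iso (idm a).
Proof. exists (idm a). now rewrite comp_id_l. Qed.

Lemma is_iso_comp (C : Category) (a b c : ob C) (g : hom b c) (f : hom a b) :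
  is_iso g -> is_iso f -> is_iso (g ∘ f).
Proof.
  intros [g' [E1 E2]] [f' [E3 E4]]. exists (f' ∘ g'). split.
  - now rewrite comp_assoc, <- (comp_assoc g' g f), E1, comp_id_l.
  - now rewrite comp_assoc, <- (comp_assoc f f' g'), E4, comp_id_l.
Qed.

Lemma is_iso_fmap (C D : Category) (F : Functor C D) (a b : ob C) (f : hom a b) :
  is_iso f -> is_iso (fmap F f).
Proof.
  intros [g [E1 E2]]. exists (fmap F g). now rewrite <- !fmap_comp, E1, E2, !fmap_id.
Qed.

Definition interp_id {L : Signature} {C : Category} (M : Interp L C) : InterpIso M M.
Proof.
  refine (@Build_InterpIso L C M M (fun A => idm _) _ _ _).
  - intro; apply is_iso_id.
  - intro f. exists (idm _). split; intros; now rewrite comp_id_l, comp_id_r.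
  - intro R. exists (idm _), (idm _). repeat split; intros.
    + now rewrite comp_id_l, comp_id_r.
    + apply is_iso_id.
    + now rewrite comp_id_l, comp_id_r.
Defined.

Definition interp_comp {L : Signature} {C : Category} {M N K : Interp L C}
  (v : InterpIso N K) (u : InterpIso M N) : InterpIso M K.
Proof.
  refine (@Build_InterpIso L C M K (fun A => v A ∘ u A) _ _ _).
  - intro; apply is_iso_comp; apply ii_iso.
  - intro f. destruct (ii_fun u f) as [h [h1 h2]], (ii_fun v f) as [h' [h1' h2']].
    exists (h' ∘ h). split.
    + intro i. now rewrite <- comp_assoc, h1', comp_assoc, h1, comp_assoc.
    + now rewrite <- comp_assoc, h2', comp_assoc, h2, comp_assoc.
  - intro R. destruct (ii_rel u R) as [h [k [h1 [h2 h3]]]],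
      (ii_rel v R) as [h' [k' [h1' [h2' h3']]]].
    exists (h' ∘ h), (k' ∘ k). repeat split.
    + intro i. now rewrite <- comp_assoc, h1', comp_assoc, h1, comp_assoc.
    + now apply is_iso_comp.
    + now rewrite <- comp_assoc, h3', comp_assoc, h3, comp_assoc.
Defined.

Definition interp_cat (L : Signature) (C : Category) : Category.
Proof.
  refine {| ob := Interp L C; hom := @InterpIso L C; idm := interp_id;
            comp := fun M N K => @interp_comp L C M N K |}.
  - intros; apply InterpIso_eq; intro; apply comp_id_l.
  - intros; apply InterpIso_eq; intro; apply comp_id_r.
  - intros; apply InterpIso_eq; intro; apply comp_assoc.
Defined.

Definition full_subcat (C : Category) (P : ob C -> Prop) : Category.
Proof.
  refine {| ob := {a : ob C | P a};
            hom := fun a b => hom (proj1_sig a) (proj1_sig b);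
            idm := fun a => idm (proj1_sig a);
            comp := fun a b c g f => g ∘ f |}.
  - intros; apply comp_id_l.
  - intros; apply comp_id_r.
  - intros; apply comp_assoc.
Defined.

Definition corestrict {C D : Category} (P : ob D -> Prop) (F : Functor C D)
  (H : forall a, P (F a)) : Functor C (full_subcat P).
Proof.
  refine (@Build_Functor C (full_subcat P) (fun a => exist _ (F a) (H a))
            (fun a b f => fmap F f) _ _).
  - intro; apply fmap_id.
  - intros; apply fmap_comp.
Defined.

Definition model_cat {L : Signature} (T : Theory L) (C : Category) : Category :=
  full_subcat (C := interp_cat L C) (is_model T).

Definition push {L : Signature} {C D : Category} {F : Functor C D} (HF : logical F)
  (M : Interp L C) : Interp L D :=
  @Build_Interp L D
    (fun A => F (in_sort M A))
    (fun w o => map_product (log_lim HF) (in_seq M o))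
    (fun f => fmap F (in_fun M f))
    (fun R => map_sub (log_lim HF) (in_rel M R)).

Definition push_nat {L : Signature} {C D : Category} {F G : Functor C D}
  (HF : logical F) (HG : logical G) (t : NatTrans F G) (Ht : forall a, is_iso (t a))
  (M : Interp L C) : InterpIso (push HF M) (push HG M).
Proof.
  refine (@Build_InterpIso L D (push HF M) (push HG M) (fun A => t (in_sort M A)) _ _ _).
  - intro; apply Ht.
  - intro f. exists (t _). split; intros; simpl; symmetry; apply nt_nat.
  - intro R. exists (t _), (t _). repeat split; intros; simpl.
    + symmetry; apply nt_nat.
    + apply Ht.
    + symmetry; apply nt_nat.
Defined.

Lemma pre_nat_iso {C : TwoCat} {A B : ob2 C} (HB : groupoidal B) {f g : ob (hom2 A B)}
  (a : hom f g) (E : ob2 C) : forall h, is_iso (pre_nat a E h).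
Proof.
  intro h. destruct (HB A f g a) as [b [E1 E2]].
  exists (comp2 (idm h) b). simpl. rewrite <- !comp2_comp.
  now rewrite E1, E2, comp_id_l, !comp2_id.
Qed.

(* The functor sending [f] to the image of [ev] under precomposition with [f]. *)
Definition cotensor_functor {C : TwoCat} {L : Signature} {E : ob2 C} (HE : internal_topos E)
  {X : ob2 C} (HX : groupoidal X) (ev : Interp L (hom2 X E))
  {A : ob2 C} (HA : groupoidal A) : Functor (hom2 A X) (interp_cat L (hom2 A E)).
Proof.
  refine (@Build_Functor (hom2 A X) (interp_cat L (hom2 A E))
    (fun f => push (proj2 HE A X f HA HX) ev)
    (fun f g a => push_nat (proj2 HE A X f HA HX) (proj2 HE A X g HA HX)
                    (t := pre_nat a E) (pre_nat_iso HX a (E := E)) ev) _ _).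
  - intro f. apply InterpIso_eq; intro S; simpl. apply comp2_id.
  - intros f g h b a. apply InterpIso_eq; intro S; simpl.
    rewrite <- comp2_comp. now rewrite comp_id_l.
Defined.

(* In [sc_univ], [H] says that the functor takes its values in models, as images of models
   under logical functors do. *)
Record SemiStrictCotensor {C : TwoCat} {L : Signature} (T : Theory L) {E : ob2 C}
  (HE : internal_topos E) := {
  sc_ob : ob2 C;
  sc_groupoidal : groupoidal sc_ob;
  sc_ev : Interp L (hom2 sc_ob E);
  sc_model : is_model T sc_ev;
  sc_univ : forall (A : ob2 C) (HA : groupoidal A),
    exists H : forall f, is_model T (cotensor_functor HE sc_groupoidal sc_ev HA f),
      let K : Functor (hom2 A sc_ob) (model_cat T (hom2 A E)) := corestrict H in
      is_equivalence K /\ surjective_on_objects K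
}.

(* Main.v *)
From Stdlib Require Import List Fin FinFun ProofIrrelevance FunctionalExtensionality
  ClassicalEpsilon Classical_Prop.
Require Import Defs.
Set Implicit Arguments.
Unset Strict Implicit.
Local Open Scope cat_scope.

(** The cotensor has to classify, at each groupoid [A], the models of [T] in the topos of
    1-cells [A -> E] together with their isomorphisms. The comparison functor is an
    equivalence as soon as it is fully faithful and surjective on objects
    ([ff_surjective_equivalence]), so the universal property can be handled one groupoid at a
    time, and strict equality matters for objects only.

    An interpretation of the signature is a diagram on a finite graph, with a vertex for each
    sort, each sequence of sorts with a chosen product and each relation symbol, and an edge
    for each projection, function symbol and inclusion of a relation. The diagram is subject
    to conditions: some cones are products, some edges are monic. Unconditioned diagrams are
    classified by a pullback of powers of the arrow object of [E] and of the core of [E]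
    ([diagram_classifier]). An isomorphism of interpretations, which is given on sorts only,
    extends uniquely to the other vertices ([interp_iso_extend], [natural_family_unique]).

    Each condition is detected by a single 2-cell, in the sense that a stage satisfies the
    condition exactly when the 2-cell becomes invertible there. A cone is a product when its
    comparison with a product is invertible ([product_detected]), a morphism is monic when the
    diagonal of its kernel pair is ([mono_detected]), and a sentence holds when the inclusion
    of its truth value in the terminal object is ([sentence_detected]). Finitely many 2-cells
    are inverted universally by pulling back the arrow object of the core of [E] along the
    1-cells that name them ([inverter]). Inverting first the 2-cells for products and
    monomorphisms, then those for the sentences, gives the cotensor. Finiteness of the theory
    enters because only finite powers are available.

    The logic is in [sentence_detected]: logical functors preserve the denotations of
    formulas, although implications, disjunctions and quantifiers are characterized by
    universal properties among all subobjects, and the target has subobjects outside the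
    image. The remedy is to express all of them through finite limits and power objects.
    Formulas are given a Kripke-Joyal semantics [forces], in which falsity, disjunction and
    existence are encoded by quantification over subobjects. Everything then reduces to one
    quantifier, agreement of two predicates for all elements of an object [A], which is an
    equalizer of two maps into the power object of [A] ([definable_all_iff]) and is therefore
    preserved ([forces_definable]). The denotations are exactly the subobjects that represent
    this semantics ([form_den_represents]), and power objects being unique up to isomorphism,
    the choice of power sorts does not affect truth ([power_structures_iso]). *)

(** * Heterogeneous equality of morphisms *)

Lemma dep_choice (J : Type) (B : J -> Type) (R : forall j, B j -> Prop) :
  (forall j, exists b, R j b) -> exists f : forall j, B j, forall j, R j (f j).
Proof.
  intro H.
  exists (fun j => proj1_sig (constructive_indefinite_description _ (H j))).
  intro j. exact (proj2_sig (constructive_indefinite_description _ (H j))).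
Qed.

Section Heq.
Context {C : Category}.

Lemma heq_bounds {a b c d : ob C} {f : hom a b} {g : hom c d} :
  heq f g -> a = c /\ b = d.
Proof. intros []; auto. Qed.

Lemma heq_sigma {a b c d : ob C} {f : hom a b} {g : hom c d} :
  heq f g ->
  existT (fun x => {y : ob C & hom x y}) a (existT _ b f) = existT _ c (existT _ d g).
Proof. now intros []. Qed.

Lemma sigma_heq {a b c d : ob C} {f : hom a b} {g : hom c d} :
  existT (fun x => {y : ob C & hom x y}) a (existT _ b f) = existT _ c (existT _ d g) ->
  heq f g.
Proof.
  intro H.
  change (heq (projT2 (projT2 (existT (fun x => {y : ob C & hom x y}) a (existT _ b f))))
              g).
  rewrite H. constructor.
Qed.

Lemma heq_eq {a b : ob C} {f g : hom a b} : heq f g -> f = g.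
Proof.
  intro H. apply heq_sigma in H.
  apply ProofIrrelevanceTheory.EqdepTheory.inj_pairT2 in H.
  now apply ProofIrrelevanceTheory.EqdepTheory.inj_pairT2 in H.
Qed.

Lemma eq_heq {a b : ob C} {f g : hom a b} : f = g -> heq f g.
Proof. intros []; constructor. Qed.

Lemma heq_sym {a b c d : ob C} {f : hom a b} {g : hom c d} : heq f g -> heq g f.
Proof. intros []; constructor. Qed.

Lemma heq_trans {a b c d a' b' : ob C} {f : hom a b} {g : hom c d} {h : hom a' b'} :
  heq f g -> heq g h -> heq f h.
Proof. now intros []. Qed.

Lemma heq_idm {a b : ob C} : a = b -> heq (idm a) (idm b).
Proof. intros []; constructor. Qed.

Lemma heq_comp {a b c a' b' c' : ob C} {g : hom b c} {f : hom a b}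
  {g' : hom b' c'} {f' : hom a' b'} : heq f f' -> heq g g' -> heq (g ∘ f) (g' ∘ f').
Proof.
  intros Hf Hg. destruct (heq_bounds Hf), (heq_bounds Hg). subst.
  apply heq_eq in Hf, Hg. subst. constructor.
Qed.

Lemma heq_fmap {D : Category} (F : Functor C D) {a b c d : ob C} {f : hom a b}
  {g : hom c d} : heq f g -> heq (fmap F f) (fmap F g).
Proof. intros []; constructor. Qed.

Lemma heq_iso {a b c d : ob C} {f : hom a b} {g : hom c d} :
  heq f g -> is_iso f -> is_iso g.
Proof. now intros []. Qed.

Definition cast {a b a' b' : ob C} (E1 : a = a') (E2 : b = b') (f : hom a b) : hom a' b' :=
  match E1 in _ = x, E2 in _ = y return hom x y with eq_refl, eq_refl => f end.

Lemma cast_heq {a b a' b' : ob C} (E1 : a = a') (E2 : b = b') (f : hom a b) :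
  heq (cast E1 E2 f) f.
Proof. destruct E1, E2; constructor. Qed.

Lemma iso_epi {a b c : ob C} {f : hom a b} {g h : hom b c} :
  is_iso f -> g ∘ f = h ∘ f -> g = h.
Proof.
  intros [k [_ E]] H.
  rewrite <- (comp_id_r g), <- (comp_id_r h), <- E, <- !comp_assoc. now rewrite H.
Qed.

Lemma iso_mono {a b c : ob C} {f : hom b c} {g h : hom a b} :
  is_iso f -> f ∘ g = f ∘ h -> g = h.
Proof.
  intros [k [E _]] H.
  rewrite <- (comp_id_l g), <- (comp_id_l h), <- E, !comp_assoc. now rewrite H.
Qed.

Lemma heq_cancel {a b c a' b' c' : ob C} {f : hom a b} {g : hom b c}
  {f' : hom a' b'} {g' : hom b' c'} :
  is_iso f -> heq f f' -> heq (g ∘ f) (g' ∘ f') -> heq g g'.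
Proof.
  intros Hi Hf Hg. destruct (heq_bounds Hf), (heq_bounds Hg). subst.
  apply heq_eq in Hf, Hg. subst. apply eq_heq. now apply (iso_epi Hi).
Qed.

Lemma iso_inv {a b : ob C} {f : hom a b} :
  is_iso f -> exists g, is_iso g /\ g ∘ f = idm a /\ f ∘ g = idm b.
Proof. intros [g [E1 E2]]. exists g. split; [now exists f|auto]. Qed.

End Heq.

(** * Limits of categories, read off on objects and morphisms *)

Definition walking_hom (a b : bool) : Type :=
  match a, b with true, false => Empty_set | _, _ => unit end.

Definition walking_arrow : Category.
Proof.
  unshelve refine {| ob := bool; hom := walking_hom |}.
  - intros []; exact tt.
  - intros [] [] []; simpl; intros h k; first [exact tt | now destruct h | now destruct k].
  - intros [] []; simpl; intros []; reflexivity.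
  - intros [] []; simpl; intros []; reflexivity.
  - intros [] [] [] []; simpl; intros h g f; destruct h; destruct g; destruct f; reflexivity.
Defined.

Definition generic_arrow : @hom walking_arrow false true := tt.

Definition arrow_diagram {C : Category} {x y : ob C} (f : hom x y)
  : Functor walking_arrow C.
Proof.
  unshelve refine (@Build_Functor walking_arrow C
    (fun j => match j with false => x | true => y end) _ _ _).
  - intros [] []; simpl;
      first [ intros []; fail | exact (fun _ => idm _) | exact (fun _ => f) ].
  - intros []; reflexivity.
  - intros [] [] []; simpl; intros h k; destruct h; destruct k; simpl;
      now rewrite ?comp_id_l, ?comp_id_r.
Defined.

(** Maps out of the walking arrow turn a universal property among all functors into one among
    morphisms, and, through identities, among objects. *)
Lemma feq_walking_arrow {C : Category} (F G : Functor walking_arrow C) :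
  heq (fmap F generic_arrow) (fmap G generic_arrow) -> feq F G.
Proof.
  intro H. destruct (heq_bounds H) as [E1 E2].
  split; [now intros [] |].
  assert (I : forall a : bool, F a = G a -> forall f : @hom walking_arrow a a,
             heq (fmap F f) (fmap G f)).
  { intros a E f. replace f with (@idm walking_arrow a) by (destruct a, f; reflexivity).
    rewrite !fmap_id. now apply heq_idm. }
  intros [] [] f; try (now apply I).
  - destruct f.
  - destruct f. exact H.
Qed.

Section PullbackCat.
Context {W X Y Z : Category} {P : Functor W X} {Q : Functor W Y}
  {F : Functor X Z} {G : Functor Y Z} (H : is_pullback_cat P Q F G).

Lemma pullback_cat_lift {x x' : ob X} {y y' : ob Y} (u : hom x x') (v : hom y y') :
  heq (fmap F u) (fmap G v) ->
  exists (w w' : ob W) (c : hom w w'), heq (fmap P c) u /\ heq (fmap Q c) v.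
Proof.
  intro E.
  destruct (proj2 H _ (arrow_diagram u) (arrow_diagram v)) as [K [[E1 E2] _]].
  { apply feq_walking_arrow. exact E. }
  exists (K false), (K true), (fmap K generic_arrow). split.
  - exact (proj2 E1 _ _ generic_arrow).
  - exact (proj2 E2 _ _ generic_arrow).
Qed.

Lemma pullback_cat_unique {w w' z z' : ob W} (c : hom w w') (d : hom z z') :
  heq (fmap P c) (fmap P d) -> heq (fmap Q c) (fmap Q d) -> heq c d.
Proof.
  intros E1 E2.
  assert (S : feq (fcomp F (fcomp P (arrow_diagram c)))
                  (fcomp G (fcomp Q (arrow_diagram c)))).
  { apply feq_walking_arrow. exact (proj2 (proj1 H) _ _ c). }
  destruct (proj2 H _ _ _ S) as [K [_ U]].
  assert (K1 : feq K (arrow_diagram c)).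
  { apply U; apply feq_walking_arrow; constructor. }
  assert (K2 : feq K (arrow_diagram d)).
  { apply U; apply feq_walking_arrow; now apply heq_sym. }
  exact (heq_trans (heq_sym (proj2 K1 _ _ generic_arrow)) (proj2 K2 _ _ generic_arrow)).
Qed.

End PullbackCat.

Section CatIso.
Context {C D : Category} {F : Functor C D} (H : is_cat_iso F).

Lemma cat_iso_ob (d : ob D) : exists c, F c = d.
Proof. destruct H as [G [_ E]]. exists (G d). exact (proj1 E d). Qed.

Lemma cat_iso_unique {a b a' b' : ob C} (f : hom a b) (g : hom a' b') :
  heq (fmap F f) (fmap F g) -> heq f g.
Proof.
  destruct H as [G [E _]]. intro K. apply (heq_fmap G) in K.
  exact (heq_trans (heq_sym (proj2 E _ _ f)) (heq_trans K (proj2 E _ _ g))).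
Qed.

Lemma cat_iso_inj {a b : ob C} : F a = F b -> a = b.
Proof.
  intro E.
  assert (K : heq (idm a) (idm b)).
  { apply cat_iso_unique. rewrite !fmap_id. now apply heq_idm. }
  exact (proj1 (heq_bounds K)).
Qed.

Lemma cat_iso_hom {a b : ob C} (g : hom (F a) (F b)) : exists f, fmap F f = g.
Proof.
  destruct H as [G [E1 E2]].
  exists (cast (proj1 E1 a) (proj1 E1 b) (fmap G g)).
  apply heq_eq.
  exact (heq_trans (heq_fmap F (cast_heq _ _ _)) (proj2 E2 _ _ g)).
Qed.

End CatIso.
(** * Whiskering *)

Notation "g ⊚ f" := (comp1 g f) (at level 40, left associativity) : cat_scope.
Notation "o ◁ a" := (comp2 (idm o) a) (at level 39, right associativity) : cat_scope.
Notation "b ▷ f" := (comp2 b (idm f)) (at level 38, left associativity) : cat_scope.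

Section Whiskering.
Context {C : TwoCat}.

Lemma comp1_assoc {W X Y Z : ob2 C} (h : ob (hom2 Y Z)) (g : ob (hom2 X Y))
  (f : ob (hom2 W X)) : h ⊚ g ⊚ f = h ⊚ (g ⊚ f).
Proof. apply hcomp_assoc1. Qed.

Lemma comp1_id_r {X Y : ob2 C} (f : ob (hom2 X Y)) : f ⊚ id1 X = f.
Proof. apply hcomp_id_r1. Qed.

Lemma comp2_assoc {W X Y Z : ob2 C} {h h' : ob (hom2 Y Z)} {g g' : ob (hom2 X Y)}
  {f f' : ob (hom2 W X)} (c : hom h h') (b : hom g g') (a : hom f f') :
  heq (comp2 (comp2 c b) a) (comp2 c (comp2 b a)).
Proof. apply hcomp_assoc2. Qed.

Lemma heq_comp2 {X Y Z : ob2 C} {g g' k k' : ob (hom2 Y Z)} {f f' l l' : ob (hom2 X Y)}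
  {b : hom g g'} {a : hom f f'} {d : hom k k'} {c : hom l l'} :
  heq b d -> heq a c -> heq (comp2 b a) (comp2 d c).
Proof. intros [] []; constructor. Qed.

Lemma heq_lwhisk {X Y Z : ob2 C} (g : ob (hom2 Y Z)) {f f' l l' : ob (hom2 X Y)}
  {a : hom f f'} {c : hom l l'} : heq a c -> heq (g ◁ a) (g ◁ c).
Proof. intros []; constructor. Qed.

Lemma heq_rwhisk {X Y Z : ob2 C} (f : ob (hom2 X Y)) {g g' k k' : ob (hom2 Y Z)}
  {a : hom g g'} {c : hom k k'} : heq a c -> heq (a ▷ f) (c ▷ f).
Proof. intros []; constructor. Qed.

Lemma lwhisk_comp {X Y Z : ob2 C} (o : ob (hom2 Y Z)) {f g h : ob (hom2 X Y)}
  (b : hom g h) (a : hom f g) : o ◁ (b ∘ a) = (o ◁ b) ∘ (o ◁ a).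
Proof. now rewrite <- comp2_comp, comp_id_l. Qed.

Lemma lwhisk_lwhisk {W X Y Z : ob2 C} (q : ob (hom2 Y Z)) (p : ob (hom2 X Y))
  {f g : ob (hom2 W X)} (a : hom f g) : heq ((q ⊚ p) ◁ a) (q ◁ (p ◁ a)).
Proof. rewrite <- comp2_id. apply comp2_assoc. Qed.

Lemma rwhisk_rwhisk {W X Y Z : ob2 C} {b b' : ob (hom2 Y Z)} (a : hom b b')
  (p : ob (hom2 X Y)) (q : ob (hom2 W X)) : heq (a ▷ p ▷ q) (a ▷ (p ⊚ q)).
Proof. rewrite <- comp2_id. apply comp2_assoc. Qed.

Lemma lwhisk_rwhisk {W X Y Z : ob2 C} (q : ob (hom2 Y Z)) {b b' : ob (hom2 X Y)}
  (a : hom b b') (p : ob (hom2 W X)) : heq ((q ◁ a) ▷ p) (q ◁ (a ▷ p)).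
Proof. apply comp2_assoc. Qed.

Lemma interchange {X Y Z : ob2 C} {g g' : ob (hom2 Y Z)} {f f' : ob (hom2 X Y)}
  (b : hom g g') (a : hom f f') : (b ▷ f') ∘ (g ◁ a) = (g' ◁ a) ∘ (b ▷ f).
Proof. now rewrite <- !comp2_comp, !comp_id_l, !comp_id_r. Qed.

Lemma lwhisk_iso {X Y Z : ob2 C} (o : ob (hom2 Y Z)) {f g : ob (hom2 X Y)}
  {a : hom f g} : is_iso a -> is_iso (o ◁ a).
Proof. exact (is_iso_fmap (post X o) (f := a)). Qed.

Lemma rwhisk_iso {X Y Z : ob2 C} (o : ob (hom2 X Y)) {f g : ob (hom2 Y Z)}
  {a : hom f g} : is_iso a -> is_iso (a ▷ o).
Proof. exact (is_iso_fmap (pre o Z) (f := a)). Qed.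

(** * Strict limits in a 2-category, read off on 1-cells and 2-cells *)

(** A 2-cell between 1-cells into the limit is determined by its components, up to
    [heq]. As this applies to identities, so is a 1-cell into the limit. *)
Definition jointly_faithful {J : Type} {P : ob2 C} {Y : J -> ob2 C}
  (p : forall j, ob (hom2 P (Y j))) : Prop :=
  forall A (h h' g g' : ob (hom2 A P)) (c : hom h h') (d : hom g g'),
    (forall j, heq (p j ◁ c) (p j ◁ d)) -> heq c d.

Lemma jointly_faithful_inj {J : Type} {P : ob2 C} {Y : J -> ob2 C}
  {p : forall j, ob (hom2 P (Y j))} (H : jointly_faithful p) A (h g : ob (hom2 A P)) :
  (forall j, p j ⊚ h = p j ⊚ g) -> h = g.
Proof.
  intro E.
  assert (K : heq (idm h) (idm g)).
  { apply H. intro j. rewrite !comp2_id. now apply heq_idm. }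
  exact (proj1 (heq_bounds K)).
Qed.

(** The universal properties of strict limits are given in a form that survives
    reassociation: 2-cells are compared by [heq], and their boundaries need only be equal. *)
Record strict_product {J : Type} {P : ob2 C} {Y : J -> ob2 C}
  (p : forall j, ob (hom2 P (Y j))) : Prop := {
  sp_lift : forall A (f : forall j, ob (hom2 A (Y j))), exists h, forall j, p j ⊚ h = f j;
  sp_lift2 : forall A (h h' : ob (hom2 A P)) (x y : forall j, ob (hom2 A (Y j)))
    (a : forall j, hom (x j) (y j)),
    (forall j, p j ⊚ h = x j) -> (forall j, p j ⊚ h' = y j) ->
    exists c : hom h h', forall j, heq (p j ◁ c) (a j);
  sp_faithful : jointly_faithful p
}.

Lemma strict_product_iso {J : Type} {P : ob2 C} {Y : J -> ob2 C}
  {p : forall j, ob (hom2 P (Y j))} (H : strict_product p) A (h h' : ob (hom2 A P))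
  (c : hom h h') : (forall j, is_iso (p j ◁ c)) -> is_iso c.
Proof.
  intro I.
  destruct (dep_choice I) as [b Hb].
  destruct (sp_lift2 H (h := h') (h' := h) b) as [d Hd]; auto.
  exists d. split; apply heq_eq, (sp_faithful H); intro j; apply eq_heq;
    rewrite lwhisk_comp, comp2_id, (heq_eq (Hd j)); apply Hb.
Qed.

Record strict_pb {W X Y Z : ob2 C} (p : ob (hom2 W X)) (q : ob (hom2 W Y))
  (f : ob (hom2 X Z)) (g : ob (hom2 Y Z)) : Prop := {
  pb_comm : f ⊚ p = g ⊚ q;
  pb_lift : forall A (x : ob (hom2 A X)) (y : ob (hom2 A Y)), f ⊚ x = g ⊚ y ->
    exists w, p ⊚ w = x /\ q ⊚ w = y;
  pb_lift2 : forall A (w w' : ob (hom2 A W)) (a : hom (p ⊚ w) (p ⊚ w'))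
    (b : hom (q ⊚ w) (q ⊚ w')), heq (f ◁ a) (g ◁ b) ->
    exists c : hom w w', p ◁ c = a /\ q ◁ c = b;
  pb_faithful : forall A (h h' k k' : ob (hom2 A W)) (c : hom h h') (d : hom k k'),
    heq (p ◁ c) (p ◁ d) -> heq (q ◁ c) (q ◁ d) -> heq c d
}.

Lemma strict_pb_iso {W X Y Z : ob2 C} {p : ob (hom2 W X)} {q : ob (hom2 W Y)}
  {f : ob (hom2 X Z)} {g : ob (hom2 Y Z)} (H : strict_pb p q f g)
  A (w w' : ob (hom2 A W)) (c : hom w w') : is_iso (p ◁ c) -> is_iso (q ◁ c) -> is_iso c.
Proof.
  intros [a [a1 a2]] [b [b1 b2]].
  destruct (pb_lift2 H (w := w') (w' := w) (a := a) (b := b)) as [d [d1 d2]].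
  { assert (K : forall V (k : ob (hom2 V Z)) (l l' : ob (hom2 A V)) (m : hom l l') m',
              m' ∘ m = idm _ -> k ◁ m' ∘ (k ◁ m) = idm _).
    { intros V k l l' m m' E. now rewrite <- lwhisk_comp, E, comp2_id. }
    assert (E : heq (f ◁ (p ◁ c)) (g ◁ (q ◁ c))).
    { apply (heq_trans (heq_sym (lwhisk_lwhisk _ _ _))).
      apply (heq_trans (heq_comp2 (heq_idm (pb_comm H)) (heq_refl c))).
      apply lwhisk_lwhisk. }
    apply (heq_cancel (f := f ◁ (p ◁ c)) (f' := g ◁ (q ◁ c))); auto.
    - apply lwhisk_iso. now exists a.
    - rewrite (K _ f _ _ _ _ a1), (K _ g _ _ _ _ b1). apply heq_idm.
      exact (proj1 (heq_bounds E)). }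
  exists d. split; apply heq_eq, (pb_faithful H); apply eq_heq;
    rewrite lwhisk_comp, comp2_id; rewrite ?d1, ?d2; auto.
Qed.

(** Lifting and uniqueness for the walking arrow give those for 1-cells, by way of
    identity 2-cells, and those for 2-cells. *)
Lemma strict_pullback_pb {W X Y Z : ob2 C} {p : ob (hom2 W X)} {q : ob (hom2 W Y)}
  {f : ob (hom2 X Z)} {g : ob (hom2 Y Z)} : strict_pullback p q f g -> strict_pb p q f g.
Proof.
  intro H.
  assert (F : forall A (h h' k k' : ob (hom2 A W)) (c : hom h h') (d : hom k k'),
    heq (p ◁ c) (p ◁ d) -> heq (q ◁ c) (q ◁ d) -> heq c d).
  { intros A h h' k k' c d. exact (pullback_cat_unique (H A) (c := c) (d := d)). }
  assert (I : forall A (h k : ob (hom2 A W)), p ⊚ h = p ⊚ k -> q ⊚ h = q ⊚ k -> h = k).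
  { intros A h k E1 E2.
    refine (proj1 (heq_bounds (F A _ _ _ _ (idm h) (idm k) _ _)));
      rewrite !comp2_id; now apply heq_idm. }
  constructor; auto.
  - assert (E := proj1 (proj1 (H W)) (id1 W)). simpl in E.
    now rewrite !comp1_id_r in E.
  - intros A x y E.
    destruct (pullback_cat_lift (H A) (u := idm x) (v := idm y)) as [w [w' [c [E1 E2]]]].
    { rewrite !fmap_id. now apply heq_idm. }
    exists w. split; [exact (proj1 (heq_bounds E1)) | exact (proj1 (heq_bounds E2))].
  - intros A w w' a b E.
    destruct (pullback_cat_lift (H A) (u := a) (v := b) E) as [v [v' [c [E1 E2]]]].
    assert (v = w) by
      (apply I; [exact (proj1 (heq_bounds E1)) | exact (proj1 (heq_bounds E2))]).
    assert (v' = w') by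
      (apply I; [exact (proj2 (heq_bounds E1)) | exact (proj2 (heq_bounds E2))]).
    subst. exists c. split; apply heq_eq; [exact E1 | exact E2].
Qed.

Record arrow_object {X P : ob2 C} {s t : ob (hom2 P X)} (k : hom s t) : Prop := {
  ao_lift : forall A (x y : ob (hom2 A X)) (u : hom x y),
    exists h, s ⊚ h = x /\ t ⊚ h = y /\ heq (k ▷ h) u;
  ao_inj : forall A (h h' : ob (hom2 A P)), heq (k ▷ h) (k ▷ h') -> h = h';
  ao_lift2 : forall A (h h' : ob (hom2 A P)) (a : hom (s ⊚ h) (s ⊚ h'))
    (b : hom (t ⊚ h) (t ⊚ h')), b ∘ (k ▷ h) = (k ▷ h') ∘ a ->
    exists c : hom h h', s ◁ c = a /\ t ◁ c = b;
  ao_faithful : forall A (h h' g g' : ob (hom2 A P)) (c : hom h h') (d : hom g g'),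
    h = g -> h' = g' -> heq (s ◁ c) (s ◁ d) -> heq (t ◁ c) (t ◁ d) -> heq c d
}.

Lemma strict_arrow_object_arrow {X P : ob2 C} {s t : ob (hom2 P X)} {k : hom s t} :
  strict_arrow_object k -> arrow_object k.
Proof.
  intro H. constructor.
  - intros A x y u. destruct (cat_iso_ob (H A) (existT _ x (existT _ y u))) as [h E].
    apply sigma_heq in E. exists h.
    split; [|split]; [exact (proj1 (heq_bounds E)) | exact (proj2 (heq_bounds E)) | exact E].
  - intros A h h' E. apply (cat_iso_inj (H A)). exact (heq_sigma E).
  - intros A h h' a b E.
    destruct (cat_iso_hom (H A) (a := h) (b := h')
                (@Build_ArrowMor _ (existT _ (s ⊚ h) (existT _ (t ⊚ h) (k ▷ h)))
                   (existT _ (s ⊚ h') (existT _ (t ⊚ h') (k ▷ h'))) a b E)) as [c Hc].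
    exists c. split; [exact (f_equal (@am_src _ _ _) Hc) | exact (f_equal (@am_tgt _ _ _) Hc)].
  - intros A h h' g g' c d E E' E1 E2. subst.
    apply (cat_iso_unique (H A)). apply eq_heq, ArrowMor_eq; now apply heq_eq.
Qed.

(** The inverses of the two components form a square with the two arrows because the components
    themselves do. *)
Lemma arrow_object_iso {X P : ob2 C} {s t : ob (hom2 P X)} {k : hom s t}
  (H : arrow_object k) A (h h' : ob (hom2 A P)) (c : hom h h') :
  is_iso (s ◁ c) -> is_iso (t ◁ c) -> is_iso c.
Proof.
  intros Hs Ht. generalize Hs Ht. intros [a [a1 a2]] [b [b1 b2]].
  destruct (ao_lift2 H (h := h') (h' := h) (a := a) (b := b)) as [d [d1 d2]].
  { apply (iso_epi Hs). rewrite !comp_assoc, a1, comp_id_r, (interchange k c).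
    now rewrite <- comp_assoc, b1, comp_id_l. }
  exists d. split; apply heq_eq, (ao_faithful H); auto; apply eq_heq;
    rewrite lwhisk_comp, comp2_id; rewrite ?d1, ?d2; auto.
Qed.

End Whiskering.
(** * Finite products *)

Section Limits.
Context {C : TwoCat} (HC : corepita C).

Lemma isofibration_pullback {X Y Z : ob2 C} (f : ob (hom2 X Z)) (g : ob (hom2 Y Z)) :
  isofibration1 f ->
  exists (W : ob2 C) (p : ob (hom2 W X)) (q : ob (hom2 W Y)), strict_pb p q f g.
Proof.
  intro H. destruct (proj1 (proj2 HC) X Y Z f g H) as [W [p [q Hpq]]].
  exists W, p, q. now apply strict_pullback_pb.
Qed.

Lemma arrow_object_exists (X : ob2 C) :
  exists (P : ob2 C) (s t : ob (hom2 P X)) (k : hom s t), arrow_object k.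
Proof.
  destruct (proj1 (proj2 (proj2 HC)) X) as [P [s [t [k H]]]].
  exists P, s, t, k. now apply strict_arrow_object_arrow.
Qed.

(** Pulling back over a terminal object gives binary products. *)
Lemma product_fin (n : nat) (Y : Fin.t n -> ob2 C) :
  exists (P : ob2 C) (p : forall j, ob (hom2 P (Y j))), strict_product p.
Proof.
  destruct HC as [[T HT] _].
  assert (T1 : forall A (f g : ob (hom2 A T)), f = g).
  { intros A f g. destruct (HT A) as [[x [_ Hx]] _]. now rewrite <- (Hx f I), <- (Hx g I). }
  assert (T2 : forall A (f f' g g' : ob (hom2 A T)) (a : hom f f') (b : hom g g'), heq a b).
  { intros A f f' g g' a b. destruct (T1 A f g), (T1 A f' g').
    destruct (proj2 (HT A) f f') as [x [_ Hx]].
    apply eq_heq. now rewrite <- (Hx a I), <- (Hx b I). }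
  assert (T3 : forall A, exists f : ob (hom2 A T), True).
  { intro A. destruct (HT A) as [[x _] _]. now exists x. }
  induction n as [|n IH].
  - exists T, (Fin.case0 _). constructor.
    + intros A f. destruct (T3 A) as [h _]. exists h. apply (Fin.case0).
    + intros A h h' x y a _ _. destruct (proj2 (HT A) h h') as [c _]. exists c.
      apply (Fin.case0).
    + intros A h h' g g' c d _. apply T2.
  - destruct (IH (fun j => Y (Fin.FS j))) as [Q [q Hq]].
    destruct (T3 Q) as [tQ _], (T3 (Y Fin.F1)) as [tY _].
    destruct (isofibration_pullback (f := tY) tQ) as [W [p [r H]]].
    (* Every 1-cell into a terminal object is an isofibration: identities are lifts. *)
    { intros A x d phi _. exists x, (idm x). split; [apply is_iso_id | apply T2]. }
    exists W, (fun j => Fin.caseS' j (fun j => ob (hom2 W (Y j))) p (fun j => q j ⊚ r)).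
    constructor.
    + intros A f. destruct (sp_lift Hq (fun j => f (Fin.FS j))) as [h Hh].
      destruct (pb_lift H (x := f Fin.F1) (y := h)) as [w [w1 w2]]; [apply T1|].
      exists w. intro j. apply (Fin.caseS' j); simpl; auto.
      intro j'. now rewrite comp1_assoc, w2.
    + intros A h h' x y a Hx Hy.
      assert (Ex := Hx Fin.F1). assert (Ey := Hy Fin.F1). simpl in Ex, Ey.
      destruct (sp_lift2 Hq (h := r ⊚ h) (h' := r ⊚ h') (fun j => a (Fin.FS j)))
        as [b Hb].
      { intro j. rewrite <- comp1_assoc. apply (Hx (Fin.FS j)). }
      { intro j. rewrite <- comp1_assoc. apply (Hy (Fin.FS j)). }
      destruct (pb_lift2 H (a := cast (eq_sym Ex) (eq_sym Ey) (a Fin.F1)) (b := b))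
        as [c [c1 c2]]; [apply T2|].
      exists c. intro j. apply (Fin.caseS' j); simpl.
      * rewrite c1. apply cast_heq.
      * intro j'. apply (heq_trans (lwhisk_lwhisk _ _ _)). rewrite c2. apply Hb.
    + intros A h h' g g' c d E. apply (pb_faithful H).
      * exact (E Fin.F1).
      * apply (sp_faithful Hq). intro j.
        apply (heq_trans (heq_sym (lwhisk_lwhisk _ _ _))).
        apply (heq_trans (E (Fin.FS j))). apply lwhisk_lwhisk.
Qed.

Lemma Finite_bijection (J : Type) : Finite J ->
  exists n (e : Fin.t n -> J) (d : J -> Fin.t n), (forall j, e (d j) = j) /\
    (forall i, d (e i) = i).
Proof.
  intros [l Hl].
  assert (K : exists n (e : Fin.t n -> J), (forall i i', e i = e i' -> i = i') /\
                (forall j, In j l -> exists i, e i = j)).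
  { clear Hl. induction l as [|a l [n [e [Hi Hs]]]].
    - exists 0, (Fin.case0 _). split; [intro i; exact (Fin.case0 (fun _ => _) i)|intros j []].
    - destruct (classic (exists i, e i = a)) as [Ha|Ha].
      + exists n, e. split; auto. intros j [<-|Hj]; auto.
      + exists (S n), (fun i => Fin.caseS' i (fun _ => J) a e). split.
        * intros i i'. pattern i; apply (Fin.caseS' i); pattern i';
            apply (Fin.caseS' i'); simpl; auto.
          -- intros k E. destruct Ha. now exists k.
          -- intros k E. destruct Ha. now exists k.
          -- intros k k' E. f_equal. auto.
        * intros j [<-|Hj]; [now exists Fin.F1|].
          destruct (Hs j Hj) as [i Ei]. now exists (Fin.FS i). }
  destruct K as [n [e [Hi Hs]]].
  destruct (dep_choice (fun j => Hs j (Hl j))) as [d Hd].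
  exists n, e, d. split; auto.
Qed.

Lemma product_exists (J : Type) (HJ : Finite J) (Y : J -> ob2 C) :
  exists (P : ob2 C) (p : forall j, ob (hom2 P (Y j))), strict_product p.
Proof.
  destruct (Finite_bijection HJ) as [n [e [d [ed de]]]].
  destruct (product_fin (fun i => Y (e i))) as [P [p H]].
  exists P, (fun j => eq_rect _ (fun k => ob (hom2 P (Y k))) (p (d j)) _ (ed j)).
  assert (K : forall i, eq_rect _ (fun k => ob (hom2 P (Y k))) (p (d (e i))) _ (ed (e i))
                        = p i).
  { intro i. generalize (ed (e i)). rewrite de. intro E.
    now rewrite (proof_irrelevance _ E eq_refl). }
  assert (R : forall Q : J -> Prop, (forall i, Q (e i)) -> forall j, Q j).
  { intros Q HQ j. rewrite <- (ed j). apply HQ. }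
  constructor.
  - intros A f. destruct (sp_lift H (fun i => f (e i))) as [h Hh].
    exists h. apply R. intro i. now rewrite K.
  - intros A h h' x y a Hx Hy.
    destruct (sp_lift2 H (h := h) (h' := h') (fun i => a (e i))) as [c Hc].
    + intro i. rewrite <- K. apply Hx.
    + intro i. rewrite <- K. apply Hy.
    + exists c. apply R. intro i. now rewrite K.
  - intros A h h' g g' c c' E. apply (sp_faithful H). intro i.
    rewrite <- K. apply E.
Qed.

End Limits.
(** * Isofibrations and 1-cells that are fully faithful on isomorphisms *)

Section Replete.
Context {C : TwoCat}.

(** The inclusion of a replete subgroupoid of an object has this property; so does the core
    of an object, and everything built from it below. *)
Definition iso_ff {X Y : ob2 C} (m : ob (hom2 X Y)) : Prop :=
  (forall A (h h' : ob (hom2 A X)) (a : hom (m ⊚ h) (m ⊚ h')), is_iso a ->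
     exists c : hom h h', m ◁ c = a) /\
  (forall A (h h' : ob (hom2 A X)) (c d : hom h h'), m ◁ c = m ◁ d -> c = d).

Lemma is_iso_left {D : Category} {a b c : ob D} (g : hom b c) (f : hom a b) :
  is_iso f -> is_iso (g ∘ f) -> is_iso g.
Proof.
  intros [f' [E1 E2]] H.
  rewrite <- (comp_id_r g), <- E2, <- comp_assoc.
  apply is_iso_comp; auto. now exists f.
Qed.

Lemma groupoidal_arrowwise {A X : ob2 C} (HA : groupoidal A) (f : ob (hom2 A X)) :
  arrowwise_iso f.
Proof. intros B g h a. apply is_iso_fmap, HA. Qed.

(** Conjugation by [u] turns the action of [f] on 2-cells into that of [f']. *)
Lemma arrowwise_iso_transport {A X : ob2 C} {f f' : ob (hom2 A X)} (u : hom f f') :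
  is_iso u -> arrowwise_iso f -> arrowwise_iso f'.
Proof.
  intros Hu Hf B g h a. apply (is_iso_left (f := u ▷ g)); [now apply rwhisk_iso|].
  change (is_iso ((f' ◁ a) ∘ (u ▷ g))). rewrite <- interchange.
  apply is_iso_comp; [now apply rwhisk_iso | apply Hf].
Qed.

Section Core.
Context {X K : ob2 C} {i : ob (hom2 K X)} (Hi : is_core i).

Lemma core_lift A (f : ob (hom2 A X)) : arrowwise_iso f -> exists g, i ⊚ g = f.
Proof.
  intro Hf. destruct Hi as [_ [_ [H _]]]. destruct (H A f Hf) as [g [E _]]. now exists g.
Qed.

Lemma core_arrowwise A (g : ob (hom2 A K)) : arrowwise_iso (i ⊚ g).
Proof.
  intros B h h' a.
  apply (heq_iso (heq_sym (lwhisk_lwhisk i g a))). apply (proj1 (proj2 Hi)).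
Qed.

Lemma core_inj A (g g' : ob (hom2 A K)) : i ⊚ g = i ⊚ g' -> g = g'.
Proof.
  intro E. destruct (proj1 (proj2 (proj2 Hi)) A (i ⊚ g) (core_arrowwise g)) as [k [_ U]].
  rewrite <- (U g eq_refl). now apply U.
Qed.

Lemma core_faithful A (g g' h h' : ob (hom2 A K)) (b : hom g g') (c : hom h h') :
  heq (i ◁ b) (i ◁ c) -> heq b c.
Proof.
  intro E. destruct Hi as [_ [H1 [_ H]]].
  destruct (H A (i ⊚ g) (i ⊚ g') (i ◁ b)) as [k [k' [d [_ U]]]];
    try apply core_arrowwise; [apply H1|].
  apply (heq_trans (heq_sym (U _ _ b (heq_refl _)))). apply U. now apply heq_sym.
Qed.

Lemma core_iso_ff : iso_ff i.
Proof.
  split.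
  - intros A g g' a Ha. destruct Hi as [_ [_ [_ H]]].
    destruct (H A (i ⊚ g) (i ⊚ g') a) as [k [k' [d [E _]]]];
      try apply core_arrowwise; auto.
    destruct (heq_bounds E) as [E1 E2]. apply core_inj in E1, E2. subst.
    exists d. now apply heq_eq.
  - intros A g g' c d E. apply heq_eq, core_faithful. now apply eq_heq.
Qed.

(** An object isomorphic to one of the core is arrow-wise invertible, hence lies in the core
    itself; the isomorphism then lifts because the core is full on isomorphisms. *)
Lemma core_isofibration : isofibration1 i.
Proof.
  intros A g d u Hu. simpl in *.
  destruct (core_lift (arrowwise_iso_transport Hu (core_arrowwise g))) as [g' E].
  subst d. destruct (proj1 core_iso_ff A g g' u Hu) as [b Hb].
  exists g', b. split; [|now apply eq_heq].
  apply Hi.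
Qed.

End Core.

(** The endpoint 1-cell of an arrow object is an isofibration: an arrow is transported along
    isomorphisms of its endpoints by conjugation. *)
Lemma endpoints_isofibration {X P X2 : ob2 C} {s t : ob (hom2 P X)} {k : hom s t}
  (Hk : arrow_object k) {r : forall b : bool, ob (hom2 X2 X)} (Hr : strict_product r)
  (st : ob (hom2 P X2)) : r true ⊚ st = s -> r false ⊚ st = t -> isofibration1 st.
Proof.
  intros <- <- A h d u Hu. simpl in *.
  set (a := cast (eq_sym (comp1_assoc (r true) st h)) eq_refl (r true ◁ u)).
  set (b := cast (eq_sym (comp1_assoc (r false) st h)) eq_refl (r false ◁ u)).
  assert (Ha : heq a (r true ◁ u)) by apply cast_heq.
  assert (Hb : heq b (r false ◁ u)) by apply cast_heq.
  assert (Ia : is_iso a) by (apply (heq_iso (heq_sym Ha)); now apply lwhisk_iso).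
  assert (Ib : is_iso b) by (apply (heq_iso (heq_sym Hb)); now apply lwhisk_iso).
  clearbody a b.
  destruct (iso_inv Ia) as [a' [_ [a1 a2]]].
  destruct (ao_lift Hk (b ∘ (k ▷ h) ∘ a')) as [h' [E1 [E2 E3]]].
  destruct (ao_lift2 Hk (h := h) (h' := h')
    (a := cast eq_refl (eq_sym E1) a) (b := cast eq_refl (eq_sym E2) b)) as [c [c1 c2]].
  { apply heq_eq.
    assert (M : heq (b ∘ (k ▷ h)) (cast eq_refl (eq_sym E2) b ∘ (k ▷ h)))
      by (apply heq_comp; [constructor | apply heq_sym, cast_heq]).
    apply (heq_trans (heq_sym M)).
    assert (N : heq (b ∘ (k ▷ h) ∘ a' ∘ a) ((k ▷ h') ∘ cast eq_refl (eq_sym E1) a))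
      by (apply heq_comp; [apply heq_sym, cast_heq | now apply heq_sym]).
    now rewrite comp_assoc, a1, comp_id_r in N. }
  exists h', c. split.
  - apply (arrow_object_iso Hk).
    + rewrite c1. now apply (heq_iso (heq_sym (cast_heq _ _ _))).
    + rewrite c2. now apply (heq_iso (heq_sym (cast_heq _ _ _))).
  - simpl. apply (sp_faithful Hr). intros [];
      apply (heq_trans (heq_sym (lwhisk_lwhisk _ _ _))).
    + rewrite c1. exact (heq_trans (cast_heq _ _ _) Ha).
    + rewrite c2. exact (heq_trans (cast_heq _ _ _) Hb).
Qed.

(** Lifts are found componentwise; they exist strictly, as a 1-cell into a product is determined
    by its components. *)
Lemma product_isofibration {J : Type} {P Q : ob2 C} {Y Z : J -> ob2 C}
  {p : forall j, ob (hom2 P (Y j))} {q : forall j, ob (hom2 Q (Z j))}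
  (Hp : strict_product p) (Hq : strict_product q)
  (m : forall j, ob (hom2 (Y j) (Z j))) (M : ob (hom2 P Q)) :
  (forall j, q j ⊚ M = m j ⊚ p j) -> (forall j, isofibration1 (m j)) -> isofibration1 M.
Proof.
  intros E Hm A h d u Hu. simpl in *.
  assert (B : forall j, q j ⊚ (M ⊚ h) = m j ⊚ (p j ⊚ h)).
  { intro j. now rewrite <- !comp1_assoc, E. }
  assert (L : forall j, exists v : {y : ob (hom2 A (Y j)) & hom (p j ⊚ h) y},
             is_iso (projT2 v) /\ heq (m j ◁ projT2 v) (q j ◁ u)).
  { intro j. destruct (Hm j A (p j ⊚ h) _ (cast (B j) eq_refl (q j ◁ u))) as [y [v [V1 V2]]].
    - apply (heq_iso (heq_sym (cast_heq _ _ _))). now apply lwhisk_iso.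
    - exists (existT _ y v). split; auto. exact (heq_trans V2 (cast_heq _ _ _)). }
  destruct (dep_choice L) as [v Hv].
  destruct (sp_lift Hp (fun j => projT1 (v j))) as [y Hy].
  destruct (sp_lift2 Hp (h := h) (h' := y) (fun j => projT2 (v j))) as [c Hc]; auto.
  exists y, c. split.
  - apply (strict_product_iso Hp). intro j. apply (heq_iso (heq_sym (Hc j))). apply Hv.
  - simpl. apply (sp_faithful Hq). intro j.
    apply (heq_trans (heq_sym (lwhisk_lwhisk _ _ _))).
    apply (heq_trans (heq_comp2 (heq_idm (E j)) (heq_refl c))).
    apply (heq_trans (lwhisk_lwhisk _ _ _)).
    apply (heq_trans (heq_lwhisk _ (Hc j))). apply Hv.
Qed.

Lemma product_iso_ff {J : Type} {P Q : ob2 C} {Y Z : J -> ob2 C}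
  {p : forall j, ob (hom2 P (Y j))} {q : forall j, ob (hom2 Q (Z j))}
  (Hp : strict_product p) (Hq : strict_product q)
  (m : forall j, ob (hom2 (Y j) (Z j))) (M : ob (hom2 P Q)) :
  (forall j, q j ⊚ M = m j ⊚ p j) -> (forall j, iso_ff (m j)) -> iso_ff M.
Proof.
  intros E Hm.
  assert (B : forall A (h : ob (hom2 A P)) j, q j ⊚ (M ⊚ h) = m j ⊚ (p j ⊚ h)).
  { intros A h j. now rewrite <- !comp1_assoc, E. }
  assert (B2 : forall A (h h' : ob (hom2 A P)) (c : hom h h') j,
             heq (q j ◁ (M ◁ c)) (m j ◁ (p j ◁ c))).
  { intros. apply (heq_trans (heq_sym (lwhisk_lwhisk _ _ _))).
    apply (heq_trans (heq_comp2 (heq_idm (E j)) (heq_refl c))). apply lwhisk_lwhisk. }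
  split.
  - intros A h h' a Ha.
    assert (L : forall j, exists v : hom (p j ⊚ h) (p j ⊚ h'), heq (m j ◁ v) (q j ◁ a)).
    { intro j. destruct (proj1 (Hm j) A (p j ⊚ h) (p j ⊚ h')
        (cast (B A h j) (B A h' j) (q j ◁ a))) as [v Hv].
      - apply (heq_iso (heq_sym (cast_heq _ _ _))). now apply lwhisk_iso.
      - exists v. rewrite Hv. apply cast_heq. }
    destruct (dep_choice L) as [v Hv].
    destruct (sp_lift2 Hp (h := h) (h' := h') v) as [c Hc]; auto.
    exists c. apply heq_eq, (sp_faithful Hq). intro j.
    apply (heq_trans (B2 _ _ _ c j)). rewrite (heq_eq (Hc j)). apply Hv.
  - intros A h h' c d Ecd. apply heq_eq, (sp_faithful Hp). intro j. apply eq_heq.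
    apply (proj2 (Hm j)). apply heq_eq.
    apply (heq_trans (heq_sym (B2 _ _ _ c j))). rewrite Ecd. apply B2.
Qed.

Lemma pullback_iso_ff {W X Y Z : ob2 C} {p : ob (hom2 W X)} {q : ob (hom2 W Y)}
  {f : ob (hom2 X Z)} {g : ob (hom2 Y Z)} (H : strict_pb p q f g) : iso_ff f -> iso_ff q.
Proof.
  intros [F1 F2].
  assert (B : forall A (h : ob (hom2 A W)), g ⊚ (q ⊚ h) = f ⊚ (p ⊚ h)).
  { intros A h. now rewrite <- !comp1_assoc, (pb_comm H). }
  assert (B2 : forall A (h h' : ob (hom2 A W)) (c : hom h h'),
             heq (g ◁ (q ◁ c)) (f ◁ (p ◁ c))).
  { intros. apply (heq_trans (heq_sym (lwhisk_lwhisk _ _ _))).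
    apply (heq_trans (heq_comp2 (heq_idm (eq_sym (pb_comm H))) (heq_refl c))).
    apply lwhisk_lwhisk. }
  split.
  - intros A h h' a Ha.
    destruct (F1 A (p ⊚ h) (p ⊚ h') (cast (B A h) (B A h') (g ◁ a))) as [v Hv].
    { apply (heq_iso (heq_sym (cast_heq _ _ _))). now apply lwhisk_iso. }
    destruct (pb_lift2 H (a := v) (b := a)) as [c [_ Hc]].
    { rewrite Hv. apply cast_heq. }
    now exists c.
  - intros A h h' c d E. apply heq_eq, (pb_faithful H); [|now apply eq_heq].
    apply eq_heq, F2, heq_eq. apply (heq_trans (heq_sym (B2 _ _ _ c))).
    rewrite E. apply B2.
Qed.

Section ArrowOfCore.
Context {X K PX PK : ob2 C} {i : ob (hom2 K X)} (Hi : is_core i)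
  {sX tX : ob (hom2 PX X)} {kX : hom sX tX} (HX : arrow_object kX)
  {sK tK : ob (hom2 PK K)} {kK : hom sK tK} (HK : arrow_object kK)
  {m : ob (hom2 PK PX)} (ms : sX ⊚ m = i ⊚ sK) (mt : tX ⊚ m = i ⊚ tK)
  (mk : heq (kX ▷ m) (i ◁ kK)).

Lemma core_arrow_src A (h : ob (hom2 A PK)) : sX ⊚ (m ⊚ h) = i ⊚ (sK ⊚ h).
Proof. now rewrite <- !comp1_assoc, ms. Qed.

Lemma core_arrow_tgt A (h : ob (hom2 A PK)) : tX ⊚ (m ⊚ h) = i ⊚ (tK ⊚ h).
Proof. now rewrite <- !comp1_assoc, mt. Qed.

Lemma core_arrow_src2 A (h h' : ob (hom2 A PK)) (c : hom h h') :
  heq (sX ◁ (m ◁ c)) (i ◁ (sK ◁ c)).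
Proof.
  apply (heq_trans (heq_sym (lwhisk_lwhisk _ _ _))).
  apply (heq_trans (heq_comp2 (heq_idm ms) (heq_refl c))). apply lwhisk_lwhisk.
Qed.

Lemma core_arrow_tgt2 A (h h' : ob (hom2 A PK)) (c : hom h h') :
  heq (tX ◁ (m ◁ c)) (i ◁ (tK ◁ c)).
Proof.
  apply (heq_trans (heq_sym (lwhisk_lwhisk _ _ _))).
  apply (heq_trans (heq_comp2 (heq_idm mt) (heq_refl c))). apply lwhisk_lwhisk.
Qed.

Lemma core_arrow_val A (h : ob (hom2 A PK)) : heq (kX ▷ (m ⊚ h)) (i ◁ (kK ▷ h)).
Proof.
  apply (heq_trans (heq_sym (rwhisk_rwhisk _ _ _))).
  apply (heq_trans (heq_rwhisk _ mk)). apply lwhisk_rwhisk.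
Qed.

Lemma core_arrow_groupoidal : groupoidal PK.
Proof. intros A h h' c. apply (arrow_object_iso HK); apply Hi. Qed.

(** An isomorphism between two arrows of the core is a square whose sides are isomorphisms, and
    these come from the core. *)
Lemma core_arrow_iso_ff : iso_ff m.
Proof.
  split.
  - intros A h h' a Ha.
    destruct (proj1 (core_iso_ff Hi) A (sK ⊚ h) (sK ⊚ h')
      (cast (core_arrow_src h) (core_arrow_src h') (sX ◁ a))) as [u Hu].
    { apply (heq_iso (heq_sym (cast_heq _ _ _))). now apply lwhisk_iso. }
    destruct (proj1 (core_iso_ff Hi) A (tK ⊚ h) (tK ⊚ h')
      (cast (core_arrow_tgt h) (core_arrow_tgt h') (tX ◁ a))) as [v Hv].
    { apply (heq_iso (heq_sym (cast_heq _ _ _))). now apply lwhisk_iso. }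
    assert (Hu' : heq (i ◁ u) (sX ◁ a)) by (rewrite Hu; apply cast_heq).
    assert (Hv' : heq (i ◁ v) (tX ◁ a)) by (rewrite Hv; apply cast_heq).
    destruct (ao_lift2 HK (a := u) (b := v)) as [c [c1 c2]].
    { apply heq_eq, (core_faithful Hi). rewrite !lwhisk_comp.
      apply (heq_trans (heq_comp (heq_sym (core_arrow_val h)) Hv')).
      rewrite <- interchange.
      apply heq_comp; [now apply heq_sym | apply core_arrow_val]. }
    exists c. apply heq_eq, (ao_faithful HX); auto.
    + apply (heq_trans (core_arrow_src2 c)). now rewrite c1.
    + apply (heq_trans (core_arrow_tgt2 c)). now rewrite c2.
  - intros A h h' c d E. apply heq_eq, (ao_faithful HK); auto; apply (core_faithful Hi).
    + apply (heq_trans (heq_sym (core_arrow_src2 c))). rewrite E. apply core_arrow_src2.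
    + apply (heq_trans (heq_sym (core_arrow_tgt2 c))). rewrite E. apply core_arrow_tgt2.
Qed.

(** With both endpoints moved into the core along the given isomorphisms, the arrow between
    them is obtained by conjugation inside the core. *)
Lemma core_arrow_isofibration : isofibration1 m.
Proof.
  intros A h d u Hu. simpl in *.
  destruct (core_isofibration Hi (x := sK ⊚ h)
    (phi := cast (core_arrow_src h) eq_refl (sX ◁ u))) as [x [a [Ia Ha]]].
  { apply (heq_iso (heq_sym (cast_heq _ _ _))). now apply lwhisk_iso. }
  destruct (core_isofibration Hi (x := tK ⊚ h)
    (phi := cast (core_arrow_tgt h) eq_refl (tX ◁ u))) as [y [b [Ib Hb]]].
  { apply (heq_iso (heq_sym (cast_heq _ _ _))). now apply lwhisk_iso. }
  simpl in *. apply (fun H => heq_trans H (cast_heq _ _ _)) in Ha, Hb.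
  destruct (iso_inv Ia) as [a' [_ [a1 a2]]].
  destruct (ao_lift HK (b ∘ (kK ▷ h) ∘ a')) as [h' [E1 [E2 E3]]]. subst x y.
  apply heq_eq in E3.
  assert (Eq : b ∘ (kK ▷ h) = (kK ▷ h') ∘ a) by now rewrite E3, comp_assoc, a1, comp_id_r.
  destruct (ao_lift2 HK Eq) as [c [c1 c2]].
  exists h', c. split.
  - apply (arrow_object_iso HK); [now rewrite c1 | now rewrite c2].
  - simpl. apply (ao_faithful HX); auto.
    + apply (ao_inj HX). apply (heq_trans (core_arrow_val h')).
      apply (heq_cancel (f := i ◁ a) (f' := sX ◁ u)); auto; [now apply lwhisk_iso|].
      rewrite interchange, <- lwhisk_comp, <- Eq, lwhisk_comp.
      apply heq_comp; auto. apply heq_sym, core_arrow_val.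
    + rewrite <- c1 in Ha. exact (heq_trans (core_arrow_src2 c) Ha).
    + rewrite <- c2 in Hb. exact (heq_trans (core_arrow_tgt2 c) Hb).
Qed.

End ArrowOfCore.
End Replete.
(** * Classifying diagrams and inverting 2-cells *)

Section Classifiers.
Context {C : TwoCat} (HC : corepita C).

Lemma core_exists (X : ob2 C) : exists (K : ob2 C) (i : ob (hom2 K X)), is_core i.
Proof. apply HC. Qed.

Lemma product_groupoidal {J : Type} {P : ob2 C} {Y : J -> ob2 C}
  {p : forall j, ob (hom2 P (Y j))} :
  strict_product p -> (forall j, groupoidal (Y j)) -> groupoidal P.
Proof. intros H G A h h' c. apply (strict_product_iso H). intro j. apply G. Qed.

Section Diagrams.
Context {V Ed : Type} (src tgt : Ed -> V).

Record Diagram (D : Category) := {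
  d_ob : V -> ob D;
  d_mor : forall e, hom (d_ob (src e)) (d_ob (tgt e))
}.

Definition map_diagram {D D' : Category} (F : Functor D D') (d : Diagram D) : Diagram D' :=
  {| d_ob := fun v => F (d_ob d v); d_mor := fun e => fmap F (d_mor d e) |}.

Lemma Diagram_eq (D : Category) (d d' : Diagram D) :
  (forall v, d_ob d v = d_ob d' v) -> (forall e, heq (d_mor d e) (d_mor d' e)) -> d = d'.
Proof.
  destruct d as [x u], d' as [x' u']; simpl. intros E H.
  assert (x = x') by now apply functional_extensionality. subst x'.
  f_equal. apply functional_extensionality_dep. intro e. now apply heq_eq.
Qed.

(** Fullness and faithfulness, on groupoidal stages, of the comparison from 1-cells into the
    base [X] of a diagram to isomorphisms of diagrams. *)
Definition diagram_ff {X E : ob2 C} (d : Diagram (hom2 X E)) : Prop :=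
  forall A (f g : ob (hom2 A X)) (a : forall v, hom (d_ob d v ⊚ f) (d_ob d v ⊚ g)),
    (forall v, is_iso (a v)) ->
    (forall e, a (tgt e) ∘ (d_mor d e ▷ f) = (d_mor d e ▷ g) ∘ a (src e)) ->
    exists! c : hom f g, forall v, d_ob d v ◁ c = a v.

(** The classifying object is the pullback of the endpoint 1-cell from a power of the arrow
    object, indexed by edges, along a 1-cell from a power of the core, indexed by vertices.
    The core makes it groupoidal. *)
Theorem diagram_classifier (HV : Finite V) (HEd : Finite Ed) (E : ob2 C) :
  exists (X : ob2 C) (d : Diagram (hom2 X E)), groupoidal X /\ diagram_ff d /\
    forall A, groupoidal A -> forall d' : Diagram (hom2 A E),
      exists f : ob (hom2 A X), map_diagram (pre f E) d = d'.
Proof.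
  destruct (core_exists E) as [K [i Hi]].
  destruct (arrow_object_exists HC E) as [P [s [t [k Hk]]]].
  assert (Hbool : Finite bool) by (exists (true :: false :: nil); intros []; simpl; auto).
  destruct (product_exists HC Hbool (fun _ => E)) as [E2 [r Hr]].
  destruct (sp_lift Hr (fun b : bool => if b then s else t)) as [st Est].
  assert (Es := Est true). assert (Et := Est false). simpl in Es, Et. clear Est.
  destruct (product_exists HC HV (fun _ => K)) as [N [n Hn]].
  destruct (product_exists HC HEd (fun _ => P)) as [B [b Hb]].
  destruct (product_exists HC HEd (fun _ => E2)) as [Z [z Hz]].
  destruct (sp_lift Hz (fun e => st ⊚ b e)) as [F HF].
  assert (Hends : forall e, exists g : ob (hom2 N E2),
             r true ⊚ g = i ⊚ n (src e) /\ r false ⊚ g = i ⊚ n (tgt e)).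
  { intro e. destruct (sp_lift Hr (fun b : bool =>
        if b then i ⊚ n (src e) else i ⊚ n (tgt e))) as [g Hg].
    exists g. split; [exact (Hg true) | exact (Hg false)]. }
  destruct (dep_choice Hends) as [ends Hends']. clear Hends.
  destruct (sp_lift Hz ends) as [G HG].
  destruct (isofibration_pullback HC (f := F) G) as [W [p [q H]]].
  { apply (product_isofibration Hb Hz (m := fun _ => st)); auto.
    intros _. exact (endpoints_isofibration Hk Hr Es Et). }
  (* The universal diagram: its objects come from the core, its edges from the arrow object,
     and the pullback makes the endpoints of the edges agree with the objects. *)
  set (o := fun v => i ⊚ (n v ⊚ q)).
  assert (Ez : forall e, st ⊚ (b e ⊚ p) = ends e ⊚ q).
  { intro e. rewrite <- comp1_assoc, <- HF, comp1_assoc, (pb_comm H), <- comp1_assoc.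
    now rewrite HG. }
  assert (Os : forall e, s ⊚ (b e ⊚ p) = o (src e)).
  { intro e. unfold o. rewrite <- Es, comp1_assoc, Ez, <- !comp1_assoc.
    now rewrite (proj1 (Hends' e)). }
  assert (Ot : forall e, t ⊚ (b e ⊚ p) = o (tgt e)).
  { intro e. unfold o. rewrite <- Et, comp1_assoc, Ez, <- !comp1_assoc.
    now rewrite (proj2 (Hends' e)). }
  set (m := fun e => cast (Os e) (Ot e) (k ▷ (b e ⊚ p))).
  assert (Em : forall e, heq (m e) (k ▷ (b e ⊚ p))) by (intro; apply cast_heq).
  assert (Eo : forall A (w w' : ob (hom2 A W)) (c : hom w w') v,
             heq (o v ◁ c) (i ◁ (n v ◁ (q ◁ c)))).
  { intros. apply (heq_trans (lwhisk_lwhisk _ _ _)). apply heq_lwhisk, lwhisk_lwhisk. }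
  assert (Osc : forall A (w w' : ob (hom2 A W)) (c : hom w w') e,
             heq (o (src e) ◁ c) (s ◁ (b e ◁ (p ◁ c)))).
  { intros. apply (heq_trans (heq_comp2 (heq_idm (eq_sym (Os e))) (heq_refl c))).
    apply (heq_trans (lwhisk_lwhisk _ _ _)). apply heq_lwhisk, lwhisk_lwhisk. }
  assert (Otc : forall A (w w' : ob (hom2 A W)) (c : hom w w') e,
             heq (o (tgt e) ◁ c) (t ◁ (b e ◁ (p ◁ c)))).
  { intros. apply (heq_trans (heq_comp2 (heq_idm (eq_sym (Ot e))) (heq_refl c))).
    apply (heq_trans (lwhisk_lwhisk _ _ _)). apply heq_lwhisk, lwhisk_lwhisk. }
  assert (Emw : forall A (w : ob (hom2 A W)) e, heq (m e ▷ w) (k ▷ (b e ⊚ (p ⊚ w)))).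
  { intros A w e. apply (heq_trans (heq_rwhisk _ (Em e))).
    apply (heq_trans (rwhisk_rwhisk _ _ _)).
    apply heq_comp2; [constructor | apply heq_idm, comp1_assoc]. }
  clearbody m.
  assert (GN : groupoidal N) by (apply (product_groupoidal Hn); intro; apply Hi).
  exists W, {| d_ob := o; d_mor := m |}. split; [|split].
  - intros A w w' c. apply (strict_pb_iso H); [|apply GN].
    apply (strict_product_iso Hb). intro e. apply (arrow_object_iso Hk).
    + apply (heq_iso (Osc _ _ _ c e)). apply (heq_iso (heq_sym (Eo _ _ _ c _))).
      apply lwhisk_iso, lwhisk_iso, GN.
    + apply (heq_iso (Otc _ _ _ c e)). apply (heq_iso (heq_sym (Eo _ _ _ c _))).
      apply lwhisk_iso, lwhisk_iso, GN.
  - intros A f g a Ia Na. simpl in *.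
    assert (Eo1 : forall (w : ob (hom2 A W)) v, o v ⊚ w = i ⊚ (n v ⊚ (q ⊚ w))).
    { intros w v. unfold o. now rewrite !comp1_assoc. }
    assert (Os1 : forall (w : ob (hom2 A W)) e, o (src e) ⊚ w = s ⊚ (b e ⊚ (p ⊚ w))).
    { intros w e. rewrite <- Os. now rewrite !comp1_assoc. }
    assert (Ot1 : forall (w : ob (hom2 A W)) e, o (tgt e) ⊚ w = t ⊚ (b e ⊚ (p ⊚ w))).
    { intros w e. rewrite <- Ot. now rewrite !comp1_assoc. }
    assert (L : forall v, exists u : hom (n v ⊚ (q ⊚ f)) (n v ⊚ (q ⊚ g)), heq (i ◁ u) (a v)).
    { intro v. destruct (proj1 (core_iso_ff Hi) A (n v ⊚ (q ⊚ f)) (n v ⊚ (q ⊚ g))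
        (cast (Eo1 f v) (Eo1 g v) (a v))) as [u Hu].
      - apply (heq_iso (heq_sym (cast_heq _ _ _))), Ia.
      - exists u. rewrite Hu. apply cast_heq. }
    destruct (dep_choice L) as [u Hu].
    destruct (sp_lift2 Hn (h := q ⊚ f) (h' := q ⊚ g) u) as [eta Heta]; auto.
    assert (L' : forall e, exists w : hom (b e ⊚ (p ⊚ f)) (b e ⊚ (p ⊚ g)),
               heq (s ◁ w) (a (src e)) /\ heq (t ◁ w) (a (tgt e))).
    { intro e. destruct (ao_lift2 Hk (h := b e ⊚ (p ⊚ f)) (h' := b e ⊚ (p ⊚ g))
        (a := cast (Os1 f e) (Os1 g e) (a (src e)))
        (b := cast (Ot1 f e) (Ot1 g e) (a (tgt e)))) as [w [w1 w2]].
      - apply heq_eq.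
        apply (heq_trans (heq_comp (heq_sym (Emw A f e)) (cast_heq _ _ _))).
        rewrite Na. apply heq_comp; [apply heq_sym, cast_heq | apply Emw].
      - exists w. rewrite w1, w2. split; apply cast_heq. }
    destruct (dep_choice L') as [w Hw].
    destruct (sp_lift2 Hb (h := p ⊚ f) (h' := p ⊚ g) w) as [gam Hgam]; auto.
    destruct (pb_lift2 H (a := gam) (b := eta)) as [c [c1 c2]].
    { apply (sp_faithful Hz). intro e.
      apply (heq_trans (heq_sym (lwhisk_lwhisk _ _ _))).
      apply (heq_trans (heq_comp2 (heq_idm (HF e)) (heq_refl gam))).
      apply (heq_trans (lwhisk_lwhisk _ _ _)).
      apply (heq_trans (heq_lwhisk _ (Hgam e))).
      apply (fun K => heq_trans K (lwhisk_lwhisk _ _ _)).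
      apply (fun K => heq_trans K (heq_comp2 (heq_idm (eq_sym (HG e))) (heq_refl eta))).
      apply (sp_faithful Hr). intros [];
        apply (heq_trans (heq_sym (lwhisk_lwhisk _ _ _)));
        apply (fun K => heq_trans K (lwhisk_lwhisk _ _ _)).
      - apply (heq_trans (heq_comp2 (heq_idm Es) (heq_refl _))).
        apply (heq_trans (proj1 (Hw e))).
        apply (fun K => heq_trans K
                 (heq_comp2 (heq_idm (eq_sym (proj1 (Hends' e)))) (heq_refl eta))).
        apply (fun K => heq_trans K (heq_sym (lwhisk_lwhisk _ _ _))).
        apply (heq_trans (heq_sym (Hu _))). apply heq_lwhisk, heq_sym, Heta.
      - apply (heq_trans (heq_comp2 (heq_idm Et) (heq_refl _))).
        apply (heq_trans (proj2 (Hw e))).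
        apply (fun K => heq_trans K
                 (heq_comp2 (heq_idm (eq_sym (proj2 (Hends' e)))) (heq_refl eta))).
        apply (fun K => heq_trans K (heq_sym (lwhisk_lwhisk _ _ _))).
        apply (heq_trans (heq_sym (Hu _))). apply heq_lwhisk, heq_sym, Heta. }
    exists c. split.
    + intro v. apply heq_eq. apply (heq_trans (Eo _ _ _ c v)). rewrite c2.
      apply (heq_trans (heq_lwhisk _ (Heta v))). apply Hu.
    + intros c' Hc'. apply heq_eq, (pb_faithful H).
      * rewrite c1. apply (sp_faithful Hb). intro e. apply (heq_trans (Hgam e)).
        apply (ao_faithful Hk); auto.
        -- apply (heq_trans (proj1 (Hw e))). rewrite <- Hc'. apply Osc.
        -- apply (heq_trans (proj2 (Hw e))). rewrite <- Hc'. apply Otc.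
      * rewrite c2. apply (sp_faithful Hn). intro v. apply (heq_trans (Heta v)).
        apply (core_faithful Hi). apply (heq_trans (Hu v)). rewrite <- Hc'. apply Eo.
  - intros A HA [x y]. simpl in *.
    destruct (dep_choice (fun v => core_lift Hi (groupoidal_arrowwise HA (x v)))) as [x' Hx].
    destruct (dep_choice (fun e => ao_lift Hk (y e))) as [y' Hy].
    destruct (sp_lift Hn x') as [x'' Hx''].
    destruct (sp_lift Hb y') as [y'' Hy''].
    destruct (pb_lift H (x := y'') (y := x'')) as [w [w1 w2]].
    { apply (jointly_faithful_inj (sp_faithful Hz)). intro e.
      rewrite <- !comp1_assoc, HF, HG, comp1_assoc, Hy''.
      apply (jointly_faithful_inj (sp_faithful Hr)).
      destruct (Hy e) as [y1 [y2 _]]. destruct (Hends' e) as [e1 e2].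
      intros []; rewrite <- !comp1_assoc.
      - now rewrite Es, e1, y1, comp1_assoc, Hx'', Hx.
      - now rewrite Et, e2, y2, comp1_assoc, Hx'', Hx. }
    exists w. apply Diagram_eq; simpl.
    + intro v. unfold o. now rewrite !comp1_assoc, w2, Hx'', Hx.
    + intro e. apply (heq_trans (Emw A w e)). rewrite w1, Hy''. apply Hy.
Qed.

Lemma diagram_ff_pullback {W X E : ob2 C} (m : ob (hom2 W X)) (d : Diagram (hom2 X E)) :
  groupoidal X -> iso_ff m -> diagram_ff d -> diagram_ff (map_diagram (pre m E) d).
Proof.
  intros GX [M1 M2] Hd A f g a Ia Na. simpl in *.
  set (a' := fun v => cast (comp1_assoc (d_ob d v) m f) (comp1_assoc (d_ob d v) m g) (a v)).
  assert (Ha : forall v, heq (a' v) (a v)) by (intro; apply cast_heq).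
  clearbody a'.
  destruct (Hd A (m ⊚ f) (m ⊚ g) a') as [c [Hc Uc]].
  - intro v. now apply (heq_iso (heq_sym (Ha v))).
  - intro e. apply heq_eq.
    apply (heq_trans (heq_comp (heq_sym (rwhisk_rwhisk _ _ _)) (Ha _))).
    rewrite Na. apply heq_comp; [apply heq_sym, Ha | apply rwhisk_rwhisk].
  - destruct (M1 A f g c (GX _ _ _ c)) as [c' Hc'].
    exists c'. split.
    + intro v. apply heq_eq. apply (heq_trans (lwhisk_lwhisk _ _ _)).
      rewrite Hc', Hc. apply Ha.
    + intros c'' Hc''. apply M2. rewrite Hc'. apply Uc. intro v. apply heq_eq.
      apply (heq_trans (heq_sym (lwhisk_lwhisk _ _ _))). rewrite Hc''.
      now apply heq_sym.
Qed.

End Diagrams.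

(** The pullback of the inclusion of the arrow object of the core into the arrow object of
    [E]: a 2-cell between 1-cells with groupoidal domain lies in the core exactly when it is
    invertible. *)
Theorem inverter (J : Type) (HJ : Finite J) (X E : ob2 C) (GX : groupoidal X)
  (f g : J -> ob (hom2 X E)) (a : forall j, hom (f j) (g j)) :
  exists (W : ob2 C) (m : ob (hom2 W X)), groupoidal W /\ iso_ff m /\
    (forall j, is_iso (a j ▷ m)) /\
    forall A, groupoidal A -> forall h : ob (hom2 A X), (forall j, is_iso (a j ▷ h)) ->
      exists h', m ⊚ h' = h.
Proof.
  destruct (core_exists E) as [K [i Hi]].
  destruct (arrow_object_exists HC E) as [P [s [t [k Hk]]]].
  destruct (arrow_object_exists HC K) as [PK [sK [tK [kK HK]]]].
  destruct (ao_lift Hk (i ◁ kK)) as [inc [incs [inct inck]]].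
  destruct (product_exists HC HJ (fun _ => PK)) as [B [b Hb]].
  destruct (product_exists HC HJ (fun _ => P)) as [Z [z Hz]].
  destruct (sp_lift Hz (fun j => inc ⊚ b j)) as [F HF].
  destruct (dep_choice (fun j => ao_lift Hk (a j))) as [a' Ha'].
  destruct (sp_lift Hz a') as [G HG].
  destruct (isofibration_pullback HC (f := F) G) as [W [p [q H]]].
  { apply (product_isofibration Hb Hz (m := fun _ => inc)); auto.
    intros _. exact (core_arrow_isofibration Hi Hk HK incs inct inck). }
  assert (Fff : iso_ff F).
  { apply (product_iso_ff Hb Hz (m := fun _ => inc)); auto.
    intros _. exact (core_arrow_iso_ff Hi Hk HK incs inct inck). }
  assert (Ev : forall A (h : ob (hom2 A X)) j, heq (k ▷ (a' j ⊚ h)) (a j ▷ h)).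
  { intros A h j. apply (heq_trans (heq_sym (rwhisk_rwhisk _ _ _))).
    apply heq_rwhisk, Ha'. }
  exists W, q. split; [|split; [|split]].
  - intros A w w' c. apply (strict_pb_iso H); [|apply GX].
    apply (product_groupoidal Hb). intros _. exact (core_arrow_groupoidal Hi HK).
  - exact (pullback_iso_ff H Fff).
  - intro j. apply (heq_iso (Ev _ q j)).
    assert (Eq : a' j ⊚ q = inc ⊚ (b j ⊚ p)).
    { now rewrite <- HG, comp1_assoc, <- (pb_comm H), <- comp1_assoc, HF, comp1_assoc. }
    rewrite Eq. apply (heq_iso (heq_sym (core_arrow_val inck _))).
    apply lwhisk_iso. apply Hi.
  - intros A GA h Ih.
    assert (L : forall j, exists y, inc ⊚ y = a' j ⊚ h).
    { intro j.
      destruct (core_lift Hi (groupoidal_arrowwise GA (f j ⊚ h))) as [x Ex].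
      destruct (core_lift Hi (groupoidal_arrowwise GA (g j ⊚ h))) as [y Ey].
      destruct (proj1 (core_iso_ff Hi) A x y (cast (eq_sym Ex) (eq_sym Ey) (a j ▷ h)))
        as [u Hu].
      { now apply (heq_iso (heq_sym (cast_heq _ _ _))). }
      destruct (ao_lift HK u) as [v [_ [_ Hv]]]. exists v.
      apply (ao_inj Hk). apply (heq_trans (core_arrow_val inck v)).
      apply (heq_trans (heq_lwhisk _ Hv)). rewrite Hu.
      apply (heq_trans (cast_heq _ _ _)). apply heq_sym, Ev. }
    destruct (dep_choice L) as [y Hy].
    destruct (sp_lift Hb y) as [y' Hy'].
    destruct (pb_lift H (x := y') (y := h)) as [w [_ Hw]].
    + apply (jointly_faithful_inj (sp_faithful Hz)). intro j.
      now rewrite <- !comp1_assoc, HF, HG, comp1_assoc, Hy', Hy.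
    + now exists w.
Qed.

End Classifiers.
(** * Generalized elements of subobjects *)

Section Elements.
Context {D : Category}.

Definition El {X : ob D} (m : Sub X) {Z : ob D} (x : hom Z X) : Prop :=
  exists k, sub_arr m ∘ k = x.

Definition represents {X : ob D} (m : Sub X) (S : forall Z, hom Z X -> Prop) : Prop :=
  forall Z (x : hom Z X), El m x <-> S Z x.

Lemma El_comp {X : ob D} (m : Sub X) {Z W : ob D} (x : hom Z X) (y : hom W Z) :
  El m x -> El m (x ∘ y).
Proof. intros [k <-]. exists (k ∘ y). now rewrite comp_assoc. Qed.

Lemma El_arr {X : ob D} (m : Sub X) : El m (sub_arr m).
Proof. exists (idm _). apply comp_id_r. Qed.

Lemma sub_le_El {X : ob D} (m n : Sub X) :
  sub_le m n <-> forall Z (x : hom Z X), El m x -> El n x.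
Proof.
  split.
  - intros [k E] Z x [l <-]. rewrite <- E, comp_assoc. now exists (k ∘ l).
  - intro H. exact (H _ _ (El_arr m)).
Qed.

Lemma sub_pullback_El {X Y : ob D} (f : hom X Y) (m : Sub Y) (n : Sub X) :
  sub_pullback f m n <-> represents n (fun Z x => El m (f ∘ x)).
Proof.
  split.
  - intros [k [E H]] Z x. split.
    + intros [l <-]. exists (k ∘ l). now rewrite <- !comp_assoc, E.
    + intros [l El]. destruct (H Z x l) as [h [[h1 _] _]]; [now symmetry|]. now exists h.
  - intro H. destruct (proj1 (H _ _) (El_arr n)) as [k Hk].
    exists k. split; [now symmetry|]. intros v a b E.
    destruct (proj2 (H _ a)) as [h Hh]; [now exists b|].
    exists h. split.
    + split; auto. apply (@sub_mono _ _ m). now rewrite <- comp_assoc, Hk, comp_assoc, Hh, E.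
    + intros h' [E1 _]. apply (@sub_mono _ _ n). congruence.
Qed.

Lemma is_equalizer_El {X Y : ob D} (m : Sub X) (f g : hom X Y) :
  is_equalizer (sub_arr m) f g <-> represents m (fun Z x => f ∘ x = g ∘ x).
Proof.
  split.
  - intros [E H] Z x. split.
    + intros [k <-]. now rewrite <- !comp_assoc, E.
    + intro K. destruct (H Z x K) as [h [Hh _]]. now exists h.
  - intro H. split; [apply H, El_arr|]. intros v a E. apply H in E. destruct E as [h Hh].
    exists h. split; auto. intros h' E'. apply (@sub_mono _ _ m). congruence.
Qed.

Lemma represents_le_antisym {X : ob D} {m n : Sub X} {S : forall Z, hom Z X -> Prop} :
  represents n S -> sub_le m n -> sub_le n m -> represents m S.
Proof.
  intros H H1 H2 Z x. rewrite <- (H Z x). rewrite sub_le_El in H1, H2. split; auto.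
Qed.

Definition full_sub (X : ob D) : Sub X.
Proof.
  refine {| sub_ob := X; sub_arr := idm X |}.
  intros c f g. now rewrite !comp_id_l.
Defined.

Lemma El_full (X Z : ob D) (x : hom Z X) : El (full_sub X) x.
Proof. exists x. apply comp_id_l. Qed.

Definition pairing {n} {X : Fin.t n -> ob D} (Q : Product X) {Y : ob D}
  (f : forall i, hom Y (X i)) : hom Y (pr_ob Q) :=
  proj1_sig (constructive_indefinite_description _ (pr_spec Q f)).

Lemma pr_pairing {n} {X : Fin.t n -> ob D} (Q : Product X) {Y : ob D}
  (f : forall i, hom Y (X i)) i : pr Q i ∘ pairing Q f = f i.
Proof.
  exact (proj1 (proj2_sig (constructive_indefinite_description _ (pr_spec Q f))) i).
Qed.

Lemma product_ext {n} {X : Fin.t n -> ob D} (Q : Product X) {Y : ob D}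
  (f g : hom Y (pr_ob Q)) : (forall i, pr Q i ∘ f = pr Q i ∘ g) -> f = g.
Proof.
  intro H. destruct (pr_spec Q (fun i => pr Q i ∘ g)) as [h [_ U]].
  rewrite <- (U f H). now apply U.
Qed.

Lemma pairing_unique {n} {X : Fin.t n -> ob D} (Q : Product X) {Y : ob D}
  (f : forall i, hom Y (X i)) (h : hom Y (pr_ob Q)) :
  (forall i, pr Q i ∘ h = f i) -> pairing Q f = h.
Proof. intro H. apply product_ext. intro i. now rewrite pr_pairing. Qed.

Definition is_bin {A B X : ob D} (p : hom B A) (q : hom B X) : Prop :=
  forall Z (a : hom Z A) (x : hom Z X), exists! h, p ∘ h = a /\ q ∘ h = x.

Lemma is_bin_ext {A B X : ob D} {p : hom B A} {q : hom B X} (H : is_bin p q)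
  {Z : ob D} {f g : hom Z B} : p ∘ f = p ∘ g -> q ∘ f = q ∘ g -> f = g.
Proof.
  intros E1 E2. destruct (H Z (p ∘ g) (q ∘ g)) as [h [_ U]].
  rewrite <- (U f (conj E1 E2)). now apply U.
Qed.

Definition fin2_case (P : Fin.t 2 -> Type) (a : P fst_ix) (b : P snd_ix) (i : Fin.t 2) : P i :=
  Fin.caseS' i P a (fun j => Fin.caseS' j (fun j => P (Fin.FS j)) b (Fin.case0 _)).

Lemma product_bin {X : Fin.t 2 -> ob D} (Q : Product X) : is_bin (pr Q fst_ix) (pr Q snd_ix).
Proof.
  intros Z a x.
  set (f := fin2_case (P := fun i => hom Z (X i)) a x).
  exists (pairing Q f). split.
  - now rewrite !pr_pairing.
  - intros h [E1 E2]. apply product_ext.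
    refine (fin2_case _ _); now rewrite pr_pairing, ?E1, ?E2.
Qed.

Definition bin_product {A B X : ob D} {p : hom B A} {q : hom B X} (H : is_bin p q)
  : Product (pair_family A X).
Proof.
  refine {| pr_ob := B; pr := fin2_case (P := fun i => hom B (pair_family A X i)) p q |}.
  intros Y f. destruct (H Y (f fst_ix) (f snd_ix)) as [h [[h1 h2] U]].
  exists h. split.
  - refine (fin2_case _ _); [exact h1 | exact h2].
  - intros h' E. apply U. split; [exact (E fst_ix) | exact (E snd_ix)].
Defined.

Definition to_terminal {X : Fin.t 0 -> ob D} (T : Product X) (Z : ob D) : hom Z (pr_ob T) :=
  pairing T (Fin.case0 _).

Lemma terminal_unique {X : Fin.t 0 -> ob D} (T : Product X) (Z : ob D)
  (f g : hom Z (pr_ob T)) : f = g.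
Proof. apply product_ext. intro i. exact (Fin.case0 (fun _ => _) i). Qed.

(** Power objects of a terminal object thus classify subobjects of [Z] itself. *)
Lemma terminal_bin {X : Fin.t 0 -> ob D} (T : Product X) (Z : ob D) :
  is_bin (to_terminal T Z) (idm Z).
Proof.
  intros W a x. exists x. split.
  - split; [apply terminal_unique | apply comp_id_l].
  - intros h [_ E]. now rewrite comp_id_l in E.
Qed.

Section FiniteLimits.
Context (HD : has_finite_limits D).

Lemma has_products {n} (X : Fin.t n -> ob D) : exists Q : Product X, True.
Proof.
  destruct (HD (discrete_diagram X) (discrete_finite n)) as [c Hc].
  unshelve refine (ex_intro _ {| pr_ob := apex c; pr := leg c |} I).
  intros Y f. exact (Hc (discrete_cone (D := discrete_diagram X) f)).
Qed.

Lemma has_pullbacks {x y z : ob D} (f : hom x z) (g : hom y z) :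
  exists w (p : hom w x) (q : hom w y), is_pullback p q f g.
Proof.
  destruct (HD (cospan_diagram f g) cospan_finite) as [c Hc].
  assert (E1 := leg_nat c (tt : @hom cospan cs_l cs_c)).
  assert (E2 := leg_nat c (tt : @hom cospan cs_r cs_c)). simpl in E1, E2.
  exists (apex c), (leg c cs_l), (leg c cs_r). split; [now rewrite E1, E2|].
  intros v a b E.
  destruct (Hc (cospan_cone (D := cospan_diagram f g) (p := a) (q := b) E)) as [h [h1 hu]].
  exists h. split; [split; [exact (h1 cs_l) | exact (h1 cs_r)]|].
  intros h' [H1 H2]. apply hu. intros []; simpl; auto.
  now rewrite <- E1, comp_assoc, H1.
Qed.

Lemma has_bin (A X : ob D) : exists B (p : hom B A) (q : hom B X), is_bin p q.
Proof.
  destruct (has_products (pair_family A X)) as [Q _].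
  exists (pr_ob Q), (pr Q fst_ix), (pr Q snd_ix). exact (product_bin Q).
Qed.

Lemma has_sub_pullback {X Y : ob D} (f : hom X Y) (m : Sub Y) : exists n, sub_pullback f m n.
Proof.
  destruct (has_pullbacks f (sub_arr m)) as [w [p [q H]]].
  unshelve refine (ex_intro _ {| sub_ob := w; sub_arr := p |} _).
  - intros c g h E. destruct (proj2 H c (p ∘ h) (q ∘ h)) as [k [_ U]].
    { now rewrite <- !comp_assoc, (proj1 H). }
    rewrite <- (U g), <- (U h); auto. split; auto.
    apply (@sub_mono _ _ m). now rewrite <- !comp_assoc, <- (proj1 H), !comp_assoc, E.
  - exists q. exact H.
Qed.

Lemma has_restriction {X Z : ob D} (m : Sub X) (x : hom Z X) :
  exists w : Sub Z, represents w (fun W u => El m (x ∘ u)).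
Proof. destruct (has_sub_pullback x m) as [n H]. exists n. now apply sub_pullback_El. Qed.

Lemma has_meet {X : ob D} (m n : Sub X) :
  exists c, represents c (fun Z x => El m x /\ El n x).
Proof.
  destruct (has_restriction n (sub_arr m)) as [w Hw].
  unshelve refine (ex_intro _ {| sub_ob := sub_ob w; sub_arr := sub_arr m ∘ sub_arr w |} _).
  - intros c f g E. rewrite !comp_assoc in E.
    now apply (@sub_mono _ _ m), (@sub_mono _ _ w) in E.
  - intros Z x. split.
    + intros [k <-]. simpl. rewrite comp_assoc. split; [now exists (sub_arr w ∘ k)|].
      apply Hw. now exists k.
    + intros [[y <-] H]. apply Hw in H. destruct H as [k <-].
      exists k. simpl. apply comp_assoc.
Qed.

(** A meet in the order of subobjects is computed on generalized elements because pullbacks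
    provide some meet which is. *)
Lemma order_meet_El {X : ob D} (m n c : Sub X) :
  (forall d, sub_le d c <-> sub_le d m /\ sub_le d n) ->
  represents c (fun Z x => El m x /\ El n x).
Proof.
  intro H. destruct (has_meet m n) as [c0 H0].
  apply (represents_le_antisym H0).
  - apply sub_le_El. intros Z x Hx. apply H0.
    destruct (proj1 (H c)) as [H1 H2]; [apply sub_le_El; auto|].
    rewrite sub_le_El in H1, H2. auto.
  - apply H. split; apply sub_le_El; intros Z x Hx; now apply H0 in Hx.
Qed.

End FiniteLimits.

(** ** Power objects *)

Definition classifies {X : Fin.t 2 -> ob D} (Q : Product X) (e : Sub (pr_ob Q))
  {R Y : ob D} (r1 : hom R (X fst_ix)) (r2 : hom R Y) (r : Sub R) (chi : hom Y (X snd_ix))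
  : Prop :=
  exists h : hom R (pr_ob Q),
    pr Q fst_ix ∘ h = r1 /\ pr Q snd_ix ∘ h = chi ∘ r2 /\ sub_pullback h e r.

Lemma power_classify {X : Fin.t 2 -> ob D} {Q : Product X} {e : Sub (pr_ob Q)}
  (He : is_power e) {R Y : ob D} {r1 : hom R (X fst_ix)} {r2 : hom R Y}
  (HR : is_bin r1 r2) (r : Sub R) : exists chi, classifies e r1 r2 r chi.
Proof.
  destruct (He Y (bin_product HR) r) as [chi [H _]]. exists chi. exact H.
Qed.

(** Two maps into a power object that classify the same relation are equal; the relation is
    compared on elements of the membership relation above the two maps. *)
Lemma power_ext {X : Fin.t 2 -> ob D} {Q : Product X} {e : Sub (pr_ob Q)}
  (HD : has_finite_limits D) (He : is_power e) {Y : ob D} (f g : hom Y (X snd_ix)) :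
  (forall Z (w w' : hom Z (pr_ob Q)) (y : hom Z Y), pr Q fst_ix ∘ w = pr Q fst_ix ∘ w' ->
     pr Q snd_ix ∘ w = f ∘ y -> pr Q snd_ix ∘ w' = g ∘ y -> (El e w <-> El e w')) ->
  f = g.
Proof.
  intro H.
  destruct (has_products HD (pair_family (X fst_ix) Y)) as [R _].
  assert (HQ := product_bin Q).
  destruct (HQ _ (pr R fst_ix) (f ∘ pr R snd_ix)) as [h [[h1 h2] _]].
  destruct (HQ _ (pr R fst_ix) (g ∘ pr R snd_ix)) as [k [[k1 k2] _]].
  destruct (has_sub_pullback HD h e) as [r Hr].
  destruct (He Y R r) as [chi [_ U]].
  rewrite <- (U f); [apply U|]; [exists k | exists h]; repeat split; auto.
  apply sub_pullback_El. apply sub_pullback_El in Hr.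
  intros Z x. rewrite (Hr Z x). apply (H _ _ _ (pr R snd_ix ∘ x)).
  - now rewrite <- !comp_assoc, h1, k1.
  - now rewrite <- !comp_assoc, h2.
  - now rewrite <- !comp_assoc, k2.
Qed.

End Elements.

Lemma preserves_bin {D D' : Category} {F : Functor D D'} (HF : preserves_finite_limits F)
  {A B X : ob D} {p : hom B A} {q : hom B X} :
  is_bin p q -> is_bin (fmap F p) (fmap F q).
Proof. intro H. exact (product_bin (map_product HF (bin_product H))). Qed.

Lemma preserves_sub_pullback {D D' : Category} {F : Functor D D'}
  (HF : preserves_finite_limits F) {X Y : ob D} {f : hom X Y} {m : Sub Y} {n : Sub X} :
  sub_pullback f m n -> sub_pullback (fmap F f) (map_sub HF m) (map_sub HF n).
Proof. intros [k H]. exists (fmap F k). now apply preserves_pullback. Qed.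
(** * Predicates definable stably under logical functors *)

(** A logical functor into a topos, along which a predicate on [D] is to be evaluated. *)
Record Target (D : Category) := {
  tg_cat : Category;
  tg_topos : is_topos tg_cat;
  tg_fun :> Functor D tg_cat;
  tg_log : logical tg_fun
}.
Arguments tg_cat {D} _.
Arguments tg_fun {D} _.

Definition tg_sub {D : Category} (t : Target D) {X : ob D} (m : Sub X) : Sub (t X) :=
  map_sub (log_lim (tg_log t)) m.

Section Definable.
Context {D : Category} (TD : is_topos D).

Definition stable_pred (X : ob D) : Type :=
  forall (t : Target D) (Z : ob (tg_cat t)), hom Z (t X) -> Prop.

(** Preservation of an operation of the internal logic by logical functors is part of its
    definability. *)
Definition definable {X : ob D} (S : stable_pred X) : Prop :=
  exists m : Sub X, forall t, represents (tg_sub t m) (S t).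

Lemma definable_iff {X : ob D} {S S' : stable_pred X} :
  definable S -> (forall t Z x, S t Z x <-> S' t Z x) -> definable S'.
Proof. intros [m Hm] H. exists m. intros t Z x. rewrite <- H. apply Hm. Qed.

Lemma definable_El {X : ob D} (m : Sub X) : definable (fun (t : Target D) Z x => El (tg_sub t m) x).
Proof. exists m. intros t Z x. reflexivity. Qed.

Lemma definable_top (X : ob D) : @definable X (fun t Z x => True).
Proof.
  exists (full_sub X). intros t Z x. split; auto. intros _. exists x. simpl.
  now rewrite fmap_id, comp_id_l.
Qed.

Lemma definable_pull {X Y : ob D} (f : hom X Y) {S : stable_pred Y} :
  definable S -> definable (fun (t : Target D) Z (x : hom Z (t X)) => S t Z (fmap t f ∘ x)).
Proof.
  intros [m Hm]. destruct (has_sub_pullback (proj1 TD) f m) as [n Hn].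
  exists n. intros t Z x. rewrite <- (Hm t Z _).
  apply (preserves_sub_pullback (log_lim (tg_log t))) in Hn.
  rewrite sub_pullback_El in Hn. apply Hn.
Qed.

(** The pullback of [n] along the inclusion of [m], composed with it, is a finite limit. *)
Lemma definable_and {X : ob D} {S S' : stable_pred X} :
  definable S -> definable S' -> definable (fun t Z x => S t Z x /\ S' t Z x).
Proof.
  intros [m Hm] [n Hn].
  destruct (has_sub_pullback (proj1 TD) (sub_arr m) n) as [w Hw].
  unshelve refine (ex_intro _ {| sub_ob := sub_ob w; sub_arr := sub_arr m ∘ sub_arr w |} _).
  - intros c f g E. rewrite !comp_assoc in E.
    now apply (@sub_mono _ _ m), (@sub_mono _ _ w) in E.
  - intros t Z x. rewrite <- (Hm t Z x), <- (Hn t Z x).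
    apply (preserves_sub_pullback (log_lim (tg_log t))) in Hw.
    rewrite sub_pullback_El in Hw.
    split.
    + intros [k <-]. simpl. rewrite fmap_comp, comp_assoc.
      split; [now exists (fmap t (sub_arr w) ∘ k)|].
      apply Hw. now exists k.
    + intros [[y <-] H]. apply Hw in H. destruct H as [k <-].
      exists k. simpl. now rewrite fmap_comp, comp_assoc.
Qed.

(** The equalizer of [f] and [g] is the pullback of their graphs, so that it is preserved
    like pullbacks and products. *)
Lemma definable_eq {X Y : ob D} (f g : hom X Y) :
  definable (fun (t : Target D) Z (x : hom Z (t X)) => fmap t f ∘ x = fmap t g ∘ x).
Proof.
  destruct (has_bin (proj1 TD) X Y) as [B [p [q HB]]].
  destruct (HB X (idm X) f) as [a [[a1 a2] _]].
  destruct (HB X (idm X) g) as [b [[b1 b2] _]].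
  destruct (has_pullbacks (proj1 TD) a b) as [w [u [v H]]].
  assert (Euv : u = v).
  { now rewrite <- (comp_id_l u), <- a1, comp_assoc, (proj1 H), <- comp_assoc, b1, comp_id_l. }
  subst v.
  unshelve refine (ex_intro _ {| sub_ob := w; sub_arr := u |} _).
  - intros c k l E. destruct (proj2 H c (u ∘ l) (u ∘ l)) as [h [_ U]].
    { now rewrite <- !comp_assoc, (proj1 H). }
    rewrite <- (U k), <- (U l); auto.
  - intros t Z x.
    assert (Ht := preserves_pullback (log_lim (tg_log t)) H).
    assert (Bt := preserves_bin (log_lim (tg_log t)) HB).
    split.
    + intros [k <-]. simpl. rewrite <- a2, <- b2, !fmap_comp, !comp_assoc.
      f_equal. rewrite <- !comp_assoc. f_equal. apply Ht.
    + intro E. destruct (proj2 Ht Z x x) as [h [[Hh _] _]].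
      * apply (is_bin_ext Bt); rewrite <- !comp_assoc, <- !fmap_comp.
        -- now rewrite a1, b1.
        -- now rewrite a2, b2.
      * now exists h.
Qed.

(** The basic quantifier. Predicates on pairs are classified by maps from [X] to the power
    object of [A], and two of them coincide over [x] exactly when these maps agree on [x]. *)
Lemma definable_all_iff {A B X : ob D} {p : hom B A} {q : hom B X} (HB : is_bin p q)
  {S S' : stable_pred B} : definable S -> definable S' ->
  definable (fun (t : Target D) Z (x : hom Z (t X)) =>
    forall W (y : hom W Z) (b : hom W (t B)), fmap t q ∘ b = x ∘ y ->
      (S t W b <-> S' t W b)).
Proof.
  intros [m Hm] [n Hn].
  destruct (proj2 TD A) as [P [Q [e He]]].
  destruct (power_classify He HB m) as [f [h [h1 [h2 h3]]]].
  destruct (power_classify He HB n) as [g [k [k1 [k2 k3]]]]. simpl in *.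
  apply (definable_iff (definable_eq f g)). intros t Z x.
  assert (L := log_lim (tg_log t)).
  assert (Qt := product_bin (map_product L Q)).
  assert (Bt := preserves_bin L HB).
  assert (E1 : forall W (b : hom W (t B)), S t W b <-> El (tg_sub t e) (fmap t h ∘ b)).
  { intros W b. rewrite <- (Hm t W b). apply (preserves_sub_pullback L) in h3.
    rewrite (proof_irrelevance _ L (log_lim (tg_log t))) in h3.
    rewrite sub_pullback_El in h3. apply h3. }
  assert (E2 : forall W (b : hom W (t B)), S' t W b <-> El (tg_sub t e) (fmap t k ∘ b)).
  { intros W b. rewrite <- (Hn t W b). apply (preserves_sub_pullback L) in k3.
    rewrite (proof_irrelevance _ L (log_lim (tg_log t))) in k3.
    rewrite sub_pullback_El in k3. apply k3. }
  split.
  - intros E W y b Eb. rewrite E1, E2.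
    replace (fmap t k ∘ b) with (fmap t h ∘ b); [reflexivity|].
    apply (is_bin_ext Qt); simpl; rewrite <- !comp_assoc, <- !fmap_comp.
    + now rewrite h1, k1.
    + rewrite h2, k2, !fmap_comp, !comp_assoc, Eb, <- !comp_assoc. now rewrite E.
  - intro H.
    apply (power_ext (proj1 (tg_topos t)) (log_pow (tg_log t) He)); simpl.
    intros W w w' y F1 F2 F3.
    destruct (Bt W (fmap t (pr Q fst_ix) ∘ w) (x ∘ y)) as [b [[b1 b2] _]].
    assert (Ew : w = fmap t h ∘ b).
    { apply (is_bin_ext Qt); simpl; rewrite <- !comp_assoc, <- !fmap_comp.
      - now rewrite h1, b1.
      - now rewrite h2, fmap_comp, comp_assoc, b2, F2, comp_assoc. }
    assert (Ew' : w' = fmap t k ∘ b).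
    { apply (is_bin_ext Qt); simpl; rewrite <- !comp_assoc, <- !fmap_comp.
      - now rewrite k1, b1.
      - now rewrite k2, fmap_comp, comp_assoc, b2, F3, comp_assoc. }
    rewrite Ew, Ew'. fold (tg_sub t e). rewrite <- E1, <- E2. exact (H W y b b2).
Qed.

Lemma definable_all_imp {A B X : ob D} {p : hom B A} {q : hom B X} (HB : is_bin p q)
  {S S' : stable_pred B} : definable S -> definable S' ->
  definable (fun (t : Target D) Z (x : hom Z (t X)) =>
    forall W (y : hom W Z) (b : hom W (t B)), fmap t q ∘ b = x ∘ y ->
      S t W b -> S' t W b).
Proof.
  intros HS HS'.
  apply (definable_iff (definable_all_iff HB HS (definable_and HS HS'))).
  intros t Z x. split; intros H W y b E; specialize (H W y b E); tauto.
Qed.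

(** Quantification over the elements of a terminal object leaves quantification over later
    stages, and this is all that implication needs. *)
Lemma definable_imp {X : ob D} {S S' : stable_pred X} : definable S -> definable S' ->
  definable (fun (t : Target D) Z (x : hom Z (t X)) =>
    forall W (y : hom W Z), S t W (x ∘ y) -> S' t W (x ∘ y)).
Proof.
  intros HS HS'. destruct (has_products (proj1 TD) (Fin.case0 (fun _ => ob D))) as [T _].
  apply (definable_iff (definable_all_imp (terminal_bin (T := T) (Z := X)) HS HS')).
  intros t Z x. split.
  - intros H W y. apply (H W y). now rewrite fmap_id, comp_id_l.
  - intros H W y b E. rewrite fmap_id, comp_id_l in E. subst b. apply H.
Qed.

(** The power object of the terminal object is a subobject classifier, also after applying
    a logical functor. *)
Lemma subobject_classifier : exists (O : ob D) (g : Sub O), forall (t : Target D) Z (w : Sub Z),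
  exists chi : hom Z (t O),
    forall W (y : hom W Z), El w y <-> El (tg_sub t g) (chi ∘ y).
Proof.
  destruct (has_products (proj1 TD) (Fin.case0 (fun _ => ob D))) as [T _].
  destruct (proj2 TD (pr_ob T)) as [O [Q [e He]]].
  destruct (product_bin Q (to_terminal T O) (idm O)) as [s [[_ s2] _]]. simpl in s, s2.
  destruct (has_sub_pullback (proj1 TD) s e) as [g Hg].
  exists O, g. intros t Z w.
  assert (L := log_lim (tg_log t)).
  set (Tt := map_product L T).
  destruct (power_classify (log_pow (tg_log t) He) (terminal_bin (T := Tt) (Z := Z)) w)
    as [chi [h [_ [h2 h3]]]]. simpl in *.
  exists chi. intros W y.
  apply (preserves_sub_pullback (log_lim (tg_log t))) in Hg.
  apply sub_pullback_El in Hg. apply sub_pullback_El in h3. rewrite (h3 W y).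
  etransitivity; [|symmetry; apply Hg].
  replace (fmap t s ∘ (chi ∘ y)) with (h ∘ y); [reflexivity|].
  apply (is_bin_ext (product_bin (map_product L Q))); simpl.
  - apply (terminal_unique (T := Tt)).
  - rewrite <- !comp_assoc, <- fmap_comp, h2, s2, fmap_id. now rewrite comp_id_l, comp_id_r.
Qed.

(** Quantification over all subobjects of all later stages is quantification over the
    subobject classifier [O], with generic subobject [g]. Here [H] states the condition
    [Phi] on the pairs of a classifying map and an element of [X]. *)
Lemma definable_all_sub {O B X : ob D} {g : Sub O}
  (Hg : forall (t : Target D) Z (w : Sub Z), exists chi : hom Z (t O),
     forall W (y : hom W Z), El w y <-> El (tg_sub t g) (chi ∘ y))
  {u : hom B O} {v : hom B X} (HB : is_bin u v)
  {Phi : forall (t : Target D) (Z : ob (tg_cat t)), hom Z (t X) -> Sub Z -> Prop}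
  {H : stable_pred B} :
  definable H ->
  (forall (t : Target D) Z (b : hom Z (t B)) (w : Sub Z),
     (forall W (y : hom W Z), El w y <-> El (tg_sub t g) (fmap t u ∘ b ∘ y)) ->
     (H t Z b <-> Phi t Z (fmap t v ∘ b) w)) ->
  definable (fun (t : Target D) Z (x : hom Z (t X)) =>
    forall W (y : hom W Z) (w : Sub W), Phi t W (x ∘ y) w -> El w (idm W)).
Proof.
  intros HH E.
  apply (definable_iff (definable_all_imp HB HH (definable_pull u (definable_El g)))).
  intros t Z x. split.
  - intros K W y w Hw. destruct (Hg t W w) as [chi Hchi].
    destruct (preserves_bin (log_lim (tg_log t)) HB chi (x ∘ y)) as [b [[b1 b2] _]].
    apply Hchi. rewrite comp_id_r, <- b1. apply (K W y b b2).
    apply (E t W b w); [|now rewrite b2].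
    intros V z. now rewrite b1.
  - intros K W y b Eb Hb.
    destruct (has_restriction (proj1 (tg_topos t)) (tg_sub t g) (fmap t u ∘ b)) as [w Hw].
    rewrite <- (comp_id_r (fmap t u ∘ b)). apply Hw. apply (K W y w).
    rewrite <- Eb. now apply (E t W b w).
Qed.

(** The intersection of all subobjects. *)
Lemma definable_bot (X : ob D) :
  definable (fun (t : Target D) Z (x : hom Z (t X)) =>
    forall W (y : hom W Z) (w : Sub W), El w (idm W)).
Proof.
  destruct subobject_classifier as [O [g Hg]].
  destruct (has_bin (proj1 TD) O X) as [B [u [v HB]]].
  apply (definable_iff (definable_all_sub Hg HB (Phi := fun _ _ _ _ => True)
    (definable_top B) (fun _ _ _ _ _ => iff_refl True))).
  intros t Z x. split; intros K W y w; auto.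
Qed.

(** The intersection of all subobjects that contain both predicates. *)
Lemma definable_or {X : ob D} {S S' : stable_pred X} : definable S -> definable S' ->
  definable (fun (t : Target D) Z (x : hom Z (t X)) =>
    forall W (y : hom W Z) (w : Sub W),
      (forall V (u : hom V W), S t V (x ∘ y ∘ u) -> El w u) ->
      (forall V (u : hom V W), S' t V (x ∘ y ∘ u) -> El w u) -> El w (idm W)).
Proof.
  intros HS HS'.
  destruct subobject_classifier as [O [g Hg]].
  destruct (has_bin (proj1 TD) O X) as [B [u [v HB]]].
  assert (G := definable_pull u (definable_El g)).
  refine (definable_iff (definable_all_sub Hg HB
    (Phi := fun t Z x w => (forall V (u : hom V Z), S t V (x ∘ u) -> El w u) /\
                           (forall V (u : hom V Z), S' t V (x ∘ u) -> El w u))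
    (definable_and (definable_imp (definable_pull v HS) G)
       (definable_imp (definable_pull v HS') G)) _) _).
  - intros t Z b w Hw.
    assert (E : forall T : stable_pred X,
      (forall V (y : hom V Z), T t V (fmap t v ∘ (b ∘ y)) ->
         El (tg_sub t g) (fmap t u ∘ (b ∘ y))) <->
      (forall V (y : hom V Z), T t V (fmap t v ∘ b ∘ y) -> El w y)).
    { intro T. split; intros K V y; specialize (K V y);
        rewrite (Hw V y) in *; rewrite !comp_assoc in *; auto. }
    now rewrite (E S), (E S').
  - intros t Z x. split; intros K W y w; [intros K1 K2 | intros [K1 K2]];
      now apply (K W y w).
Qed.

(** The intersection of all subobjects that contain the image of [S] along [q]. *)
Lemma definable_ex {A B X : ob D} {p : hom B A} {q : hom B X} (HB : is_bin p q)
  {S : stable_pred B} : definable S ->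
  definable (fun (t : Target D) Z (x : hom Z (t X)) =>
    forall W (y : hom W Z) (w : Sub W),
      (forall V (u : hom V W) (b : hom V (t B)), fmap t q ∘ b = x ∘ y ∘ u ->
         S t V b -> El w u) -> El w (idm W)).
Proof.
  intro HS.
  destruct subobject_classifier as [O [g Hg]].
  destruct (has_bin (proj1 TD) O X) as [C [u [v HC]]].
  destruct (has_bin (proj1 TD) A C) as [E [r [s HE]]].
  destruct (HB E r (v ∘ s)) as [k [[k1 k2] _]].
  assert (G := definable_pull (u ∘ s) (definable_El g)).
  refine (definable_all_sub Hg HC
    (Phi := fun t Z x w => forall V (u : hom V Z) (b : hom V (t B)),
              fmap t q ∘ b = x ∘ u -> S t V b -> El w u)
    (definable_all_imp HE (definable_pull k HS) G) _).
  intros t Z c w Hw.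
  assert (Bt := preserves_bin (log_lim (tg_log t)) HB).
  assert (Et := preserves_bin (log_lim (tg_log t)) HE).
  split.
  - intros K V y b Eb Sb.
    destruct (Et V (fmap t p ∘ b) (c ∘ y)) as [d [[d1 d2] _]].
    apply Hw. rewrite comp_assoc, <- d2, <- comp_assoc, <- fmap_comp.
    apply (K V y d d2).
    replace (fmap t k ∘ d) with b; auto.
    apply (is_bin_ext Bt); rewrite <- comp_assoc, <- fmap_comp.
    + now rewrite k1, d1.
    + now rewrite k2, fmap_comp, comp_assoc, d2, Eb, comp_assoc.
  - intros K V y d Ed Sd.
    rewrite fmap_comp, comp_assoc, Ed, <- comp_assoc. apply Hw.
    apply (K V y (fmap t k ∘ d)); auto.
    now rewrite <- comp_assoc, <- fmap_comp, k2, fmap_comp, comp_assoc, Ed, comp_assoc.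
Qed.

End Definable.
(** * Kripke-Joyal semantics *)

Section Forcing.
Context {L : Signature} {D : Category} (M : Structure L D).

Definition Env (Z : ob D) (G : seq (sort L)) : Type :=
  forall i : Fin.t (len G), hom Z (st_sort M (item G i)).

Definition env_comp {Z W : ob D} {G : seq (sort L)} (r : Env Z G) (y : hom W Z) : Env W G :=
  fun i => r i ∘ y.

Definition env_cons {Z : ob D} {A : sort L} {G : seq (sort L)} (a : hom Z (st_sort M A))
  (r : Env Z G) : Env Z (seq_cons A G) :=
  fun i => Fin.caseS' i (fun i => hom Z (st_sort M (item (seq_cons A G) i))) a r.

Fixpoint eval {G : seq (sort L)} {Z : ob D} (r : Env Z G) {A : sort L} (t : term G A)
  : hom Z (st_sort M A) :=
  match t with
  | tvar _ i => r i
  | tapp f ts => st_fun M f ∘ pairing (st_dom M f) (fun i => eval r (ts i))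
  end.

(** Truth of a formula at generalized elements. False, disjunction and existence are given by
    their second-order encodings, quantifying over the subobjects [w] of later stages. *)
Fixpoint forces {G : seq (sort L)} (phi : formula G) : forall Z : ob D, Env Z G -> Prop :=
  match phi with
  | frel R ts => fun Z r =>
      El (st_rel M R) (pairing (st_arity M R) (fun i => eval r (ts i)))
  | feql t1 t2 => fun Z r => eval r t1 = eval r t2
  | ftop _ => fun Z r => True
  | fbot _ => fun Z r => forall W (y : hom W Z) (w : Sub W), El w (idm W)
  | fand p q => fun Z r => forces p r /\ forces q r
  | for_ p q => fun Z r => forall W (y : hom W Z) (w : Sub W),
      (forall V (u : hom V W), forces p (env_comp (env_comp r y) u) -> El w u) ->
      (forall V (u : hom V W), forces q (env_comp (env_comp r y) u) -> El w u) ->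
      El w (idm W)
  | fimp p q => fun Z r => forall W (y : hom W Z),
      forces p (env_comp r y) -> forces q (env_comp r y)
  | fall A p => fun Z r => forall W (y : hom W Z) (a : hom W (st_sort M A)),
      forces p (env_cons a (env_comp r y))
  | fex A p => fun Z r => forall W (y : hom W Z) (w : Sub W),
      (forall V (u : hom V W) (a : hom V (st_sort M A)),
         forces p (env_cons a (env_comp (env_comp r y) u)) -> El w u) -> El w (idm W)
  end.

Lemma env_ext {Z : ob D} {G : seq (sort L)} (r r' : Env Z G) : (forall i, r i = r' i) -> r = r'.
Proof. apply functional_extensionality_dep. Qed.

Lemma env_comp_comp {Z W V : ob D} {G : seq (sort L)} (r : Env Z G) (y : hom W Z)
  (u : hom V W) : env_comp (env_comp r y) u = env_comp r (y ∘ u).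
Proof. apply env_ext. intro i. apply comp_assoc. Qed.

Lemma env_comp_id {Z : ob D} {G : seq (sort L)} (r : Env Z G) : env_comp r (idm Z) = r.
Proof. apply env_ext. intro i. apply comp_id_r. Qed.

Lemma pairing_comp {n} {X : Fin.t n -> ob D} (Q : Product X) {Z W : ob D}
  (f : forall i, hom Z (X i)) (y : hom W Z) :
  pairing Q f ∘ y = pairing Q (fun i => f i ∘ y).
Proof. apply product_ext. intro i. now rewrite <- comp_assoc, !pr_pairing. Qed.

Lemma eval_comp {G : seq (sort L)} {Z W : ob D} (r : Env Z G) (y : hom W Z) {A : sort L}
  (t : term G A) : eval (env_comp r y) t = eval r t ∘ y.
Proof.
  induction t as [i|f ts IH]; simpl; auto.
  rewrite comp_assoc, pairing_comp. do 2 f_equal.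
  apply functional_extensionality_dep. intro i. apply IH.
Qed.

Definition ctx_env {G : seq (sort L)} (X : Ctx M G) : Env (pr_ob X) G := fun i => pr X i.

Definition sem {G : seq (sort L)} (phi : formula G) (X : Ctx M G) (Z : ob D)
  (x : hom Z (pr_ob X)) : Prop := forces phi (env_comp (ctx_env X) x).

(** Extending a context by a variable is taking a binary product with its sort. *)
Lemma ctx_cons_bin {A : sort L} {G : seq (sort L)} (Y : Ctx M (seq_cons A G)) (X : Ctx M G)
  (q : hom (pr_ob Y) (pr_ob X)) :
  (forall i, pr X i ∘ q = pr Y (Fin.FS i)) -> is_bin (pr Y Fin.F1) q.
Proof.
  intros Hq Z a x.
  set (r := env_cons a (env_comp (ctx_env X) x)).
  exists (pairing Y r). split.
  - split; [exact (pr_pairing Y r Fin.F1)|]. apply (product_ext (Q := X)). intro i.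
    rewrite <- comp_assoc, Hq. exact (pr_pairing Y r (Fin.FS i)).
  - intros h [<- <-]. apply (product_ext (Q := Y)). intro i.
    transitivity (r i); [exact (pr_pairing Y r i)|].
    unfold r. apply (Fin.caseS' i); [reflexivity|]. intro j. simpl.
    unfold env_comp, ctx_env. now rewrite <- comp_assoc, Hq.
Qed.

Lemma ctx_cons_env {A : sort L} {G : seq (sort L)} (Y : Ctx M (seq_cons A G)) (X : Ctx M G)
  (q : hom (pr_ob Y) (pr_ob X)) (Hq : forall i, pr X i ∘ q = pr Y (Fin.FS i))
  {Z : ob D} (b : hom Z (pr_ob Y)) :
  env_cons (pr Y Fin.F1 ∘ b) (env_comp (ctx_env X) (q ∘ b)) = env_comp (ctx_env Y) b.
Proof.
  apply env_ext. intro i. apply (Fin.caseS' i); [reflexivity|].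
  intro j. simpl. unfold env_comp, ctx_env. now rewrite <- comp_assoc, Hq.
Qed.

Lemma ctx_cons_exists (HD : has_finite_limits D) (A : sort L) {G : seq (sort L)}
  (X : Ctx M G) : exists (Y : Ctx M (seq_cons A G)) (q : hom (pr_ob Y) (pr_ob X)),
    forall i, pr X i ∘ q = pr Y (Fin.FS i).
Proof.
  destruct (has_products HD (fun i => st_sort M (item (seq_cons A G) i))) as [Y _].
  exists Y, (pairing X (fun i => pr Y (Fin.FS i))). intro i.
  exact (pr_pairing X (fun i => pr Y (Fin.FS i)) i).
Qed.

End Forcing.
Arguments sem {_ _ _ _} _ _ [_] _.

(** The image of a structure on the extended signature need not be definitionally of the form
    [extend], hence structures rather than interpretations are transported. *)
Definition push_structure {L : Signature} {D D' : Category} {F : Functor D D'}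
  (HF : logical F) (M : Structure L D) : Structure L D' :=
  {| st_sort := fun A => F (st_sort M A);
     st_dom := fun f => map_product (log_lim HF) (st_dom M f);
     st_fun := fun f => fmap F (st_fun M f);
     st_arity := fun R => map_product (log_lim HF) (st_arity M R);
     st_rel := fun R => map_sub (log_lim HF) (st_rel M R) |}.

Section Denotation.
Context {L : Signature} {D : Category} (TD : is_topos D) (M : Structure L D).

Definition push_ctx (t : Target D) {G : seq (sort L)} (X : Ctx M G)
  : Ctx (push_structure (tg_log t) M) G := map_product (log_lim (tg_log t)) X.

Lemma eval_push (t : Target D) {G : seq (sort L)} (X : Ctx M G) {Z : ob (tg_cat t)}
  (x : hom Z (t (pr_ob X))) {A : sort L} (s : term G A) :
  eval (env_comp (ctx_env (push_ctx t X)) x) s = fmap t (eval (ctx_env X) s) ∘ x.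
Proof.
  induction s as [i|f ts IH]; simpl; [reflexivity|].
  rewrite fmap_comp, comp_assoc. f_equal.
  apply (product_ext (Q := map_product (log_lim (tg_log t)) (st_dom M f))).
  intro i. etransitivity; [exact (pr_pairing (map_product _ (st_dom M f)) _ i)|].
  rewrite IH. simpl. rewrite <- comp_assoc, <- fmap_comp.
  do 2 f_equal. symmetry. exact (pr_pairing (st_dom M f) _ i).
Qed.

(** Each clause of the forcing relation is one of the definable operations, where binding a
    variable extends the context by a factor of a binary product. *)
Theorem forces_definable {G : seq (sort L)} (phi : formula G) (X : Ctx M G) :
  definable (fun t => sem phi (push_ctx t X)).
Proof.
  induction phi as [G R ts|G A t1 t2|G|G|G p IHp q IHq|G p IHp q IHq|G p IHp q IHq
                   |G A p IHp|G A p IHp].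
  - apply (definable_iff (definable_pull TD
      (pairing (st_arity M R) (fun i => eval (ctx_env X) (ts i)))
      (definable_El (st_rel M R)))).
    intros t Z x. unfold sem. simpl.
    match goal with |- El _ ?a <-> El _ ?b => replace b with a; [reflexivity|] end.
    apply (product_ext (Q := map_product (log_lim (tg_log t)) (st_arity M R))).
    intro i. etransitivity;
      [|symmetry; exact (eq_trans (pr_pairing (map_product _ (st_arity M R)) _ i)
                           (eval_push (X := X) x (ts i)))].
    simpl. rewrite <- comp_assoc, <- fmap_comp.
    do 2 f_equal. exact (pr_pairing (st_arity M R) _ i).
  - apply (definable_iff (definable_eq TD (eval (ctx_env X) t1) (eval (ctx_env X) t2))).
    intros t Z x. unfold sem. cbn [forces]. now rewrite !eval_push.
  - exact (definable_top _).
  - exact (definable_bot TD _).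
  - exact (definable_and TD (IHp X) (IHq X)).
  - apply (definable_iff (definable_or TD (IHp X) (IHq X))).
    intros t Z x. unfold sem. simpl.
    split; intros H W y w H1 H2; apply (H W y w); intros V u Hu;
      [apply H1 | apply H2 | apply H1 | apply H2];
      rewrite ?env_comp_comp in *; rewrite ?comp_assoc in *; exact Hu.
  - apply (definable_iff (definable_imp TD (IHp X) (IHq X))).
    intros t Z x. unfold sem. simpl.
    split; intros H W y; specialize (H W y); rewrite ?env_comp_comp in *; exact H.
  - destruct (ctx_cons_exists (proj1 TD) A X) as [Y [q Hq]].
    apply (definable_iff (definable_all_imp TD (ctx_cons_bin Hq)
      (definable_top _) (IHp Y))).
    intros t Z x. unfold sem. cbn [forces].
    assert (Hqt : forall i, pr (push_ctx t X) i ∘ fmap t q = pr (push_ctx t Y) (Fin.FS i)).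
    { intro i. simpl. now rewrite <- fmap_comp, Hq. }
    assert (Bt := ctx_cons_bin (M := push_structure (tg_log t) M)
                    (Y := push_ctx t Y) (X := push_ctx t X) Hqt).
    assert (Et : forall W (y : hom W Z) (b : hom W (t (pr_ob Y))), fmap t q ∘ b = x ∘ y ->
      env_cons (pr (push_ctx t Y) Fin.F1 ∘ b)
        (env_comp (env_comp (ctx_env (push_ctx t X)) x) y)
      = env_comp (ctx_env (push_ctx t Y)) b).
    { intros W y b Eb. rewrite env_comp_comp.
      refine (eq_trans _ (@ctx_cons_env _ _ (push_structure (tg_log t) M) _ _
                (push_ctx t Y) (push_ctx t X) _ Hqt W b)).
      do 2 f_equal. now symmetry. }
    split.
    + intros H W y a.
      destruct (Bt _ a (x ∘ y)) as [b [[<- b2] _]].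
      exact (eq_ind_r (fun r => forces p r) (H W y b b2 I) (Et W y b b2)).
    + intros H W y b Eb _.
      exact (eq_ind _ (fun r => forces p r) (H W y _) _ (Et W y b Eb)).
  - destruct (ctx_cons_exists (proj1 TD) A X) as [Y [q Hq]].
    apply (definable_iff (definable_ex TD (ctx_cons_bin Hq) (IHp Y))).
    intros t Z x. unfold sem. cbn [forces].
    assert (Hqt : forall i, pr (push_ctx t X) i ∘ fmap t q = pr (push_ctx t Y) (Fin.FS i)).
    { intro i. simpl. now rewrite <- fmap_comp, Hq. }
    assert (Bt := ctx_cons_bin (M := push_structure (tg_log t) M)
                    (Y := push_ctx t Y) (X := push_ctx t X) Hqt).
    assert (Et : forall W (y : hom W Z) (b : hom W (t (pr_ob Y))), fmap t q ∘ b = x ∘ y ->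
      env_cons (pr (push_ctx t Y) Fin.F1 ∘ b)
        (env_comp (env_comp (ctx_env (push_ctx t X)) x) y)
      = env_comp (ctx_env (push_ctx t Y)) b).
    { intros W y b Eb. rewrite env_comp_comp.
      refine (eq_trans _ (@ctx_cons_env _ _ (push_structure (tg_log t) M) _ _
                (push_ctx t Y) (push_ctx t X) _ Hqt W b)).
      do 2 f_equal. now symmetry. }
    split; intros H W y w Hw; apply (H W y w).
    + intros V u b Eb Hb. apply (Hw V u (pr (push_ctx t Y) Fin.F1 ∘ b)).
      rewrite env_comp_comp. rewrite comp_assoc in Eb.
      exact (eq_ind_r (fun r => forces p r) Hb (Et V (y ∘ u) b Eb)).
    + intros V u a Ha. rewrite env_comp_comp in Ha.
      destruct (Bt _ a (x ∘ (y ∘ u))) as [b [[<- b2] _]].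
      apply (Hw V u b); [now rewrite comp_assoc|].
      exact (eq_ind _ (fun r => forces p r) Ha _ (Et V (y ∘ u) b b2)).
Qed.

End Denotation.
(** ** Invariance under isomorphism *)

Section StructIso.
Context {L : Signature} {D : Category}.

Record StructIso (M N : Structure L D) := {
  si :> forall A, hom (st_sort M A) (st_sort N A);
  si_iso : forall A, is_iso (si A);
  si_fun : forall f Z (args : forall i, hom Z (st_sort M (item (dom f) i))),
    si (cod f) ∘ (st_fun M f ∘ pairing (st_dom M f) args)
    = st_fun N f ∘ pairing (st_dom N f) (fun i => si _ ∘ args i);
  si_rel : forall R Z (args : forall i, hom Z (st_sort M (item (arity R) i))),
    El (st_rel M R) (pairing (st_arity M R) args)
    <-> El (st_rel N R) (pairing (st_arity N R) (fun i => si _ ∘ args i))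
}.

Context {M N : Structure L D} (s : StructIso M N).

Definition env_map {Z : ob D} {G : seq (sort L)} (r : Env M Z G) : Env N Z G :=
  fun i => s _ ∘ r i.

Lemma env_map_comp {Z W : ob D} {G : seq (sort L)} (r : Env M Z G) (y : hom W Z) :
  env_map (env_comp r y) = env_comp (env_map r) y.
Proof. apply env_ext. intro i. symmetry. apply comp_assoc. Qed.

Lemma env_map_cons {Z : ob D} {A : sort L} {G : seq (sort L)} (a : hom Z (st_sort M A))
  (r : Env M Z G) : env_map (env_cons a r) = env_cons (s A ∘ a) (env_map r).
Proof. apply env_ext. intro i. now apply (Fin.caseS' i). Qed.

Lemma eval_iso {Z : ob D} {G : seq (sort L)} (r : Env M Z G) {A : sort L} (t : term G A) :
  eval (env_map r) t = s A ∘ eval r t.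
Proof.
  induction t as [i|f ts IH]; simpl; [reflexivity|].
  rewrite si_fun. do 2 f_equal. apply functional_extensionality_dep. intro i. apply IH.
Qed.

Lemma forces_iso {G : seq (sort L)} (phi : formula G) : forall Z (r : Env M Z G),
  forces phi r <-> forces phi (env_map r).
Proof.
  induction phi as [G R ts|G A t1 t2|G|G|G p IHp q IHq|G p IHp q IHq|G p IHp q IHq
                   |G A p IHp|G A p IHp]; intros Z r; simpl.
  - rewrite si_rel.
    replace (fun i => s _ ∘ eval r (ts i)) with (fun i => eval (env_map r) (ts i));
      [reflexivity|].
    apply functional_extensionality_dep. intro i. apply eval_iso.
  - rewrite !eval_iso. split; intro E; [now rewrite E|]. exact (iso_mono (si_iso s A) E).
  - reflexivity.
  - reflexivity.
  - now rewrite IHp, IHq.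
  - split; intros H W y w H1 H2; apply (H W y w); intros V u K;
      [apply H1 | apply H2 | apply H1 | apply H2];
      [apply IHp in K | apply IHq in K | apply IHp | apply IHq];
      now rewrite ?env_map_comp in *.
  - split; intros H W y K.
    + rewrite <- env_map_comp in *. apply IHq, H. now apply IHp.
    + apply IHq. rewrite env_map_comp. apply H. rewrite <- env_map_comp. now apply IHp.
  - split; intros H W y a.
    + destruct (si_iso s A) as [b [_ E]].
      specialize (H W y (b ∘ a)). apply IHp in H.
      now rewrite env_map_cons, env_map_comp, <- comp_assoc, E, comp_id_l in H.
    + apply IHp. rewrite env_map_cons, env_map_comp. apply H.
  - split; intros H W y w K; apply (H W y w); intros V u a Ka.
    + apply (K V u (s A ∘ a)). rewrite <- !env_map_comp, <- env_map_cons. now apply IHp.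
    + destruct (si_iso s A) as [b [_ E]]. apply (K V u (b ∘ a)). apply IHp.
      now rewrite env_map_cons, !env_map_comp, <- comp_assoc, E, comp_id_l.
Qed.

End StructIso.

Lemma logical_id (D : Category) : logical (fid D).
Proof.
  assert (L : preserves_finite_limits (fid D)).
  { intros J d c _ Hc c'.
    exact (Hc (@Build_Cone J D d (apex c') (leg c') (fun j k f => leg_nat c' f))). }
  exists L. intros X Q e He. exact He.
Qed.

(** * Denotations of formulas represent their forcing relation *)

Section FormDen.
Context {L : Signature} {D : Category} (TD : is_topos D) (M : Structure L D).

Lemma term_den_eval {G : seq (sort L)} (X : Ctx M G) {A : sort L} (t : term G A) :
  forall h, term_den M X t h <-> h = eval (ctx_env X) t.
Proof.
  induction t as [i|f ts IH]; intro h; simpl; [reflexivity|]. split.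
  - intros [k [Hk ->]]. f_equal. symmetry. apply pairing_unique. intro i.
    now apply IH.
  - intros ->. exists (pairing (st_dom M f) (fun i => eval (ctx_env X) (ts i))).
    split; auto. intro i. apply IH. exact (pr_pairing (st_dom M f) _ i).
Qed.

(** The case of the identity functor in [forces_definable]. *)
Lemma sem_representable {G : seq (sort L)} (phi : formula G) (X : Ctx M G) :
  exists m, represents m (sem phi X).
Proof.
  set (t := {| tg_topos := TD; tg_log := logical_id D |}).
  destruct (forces_definable TD phi X) as [m Hm]. exists m.
  intros Z x.
  assert (Hs : exists s : StructIso M (push_structure (tg_log t) M),
             forall A, s A = idm (st_sort M A)).
  { unshelve eexists (@Build_StructIso L D M (push_structure (tg_log t) M)
      (fun A => idm (st_sort M A)) _ _ _); [| | |reflexivity].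
    - intro A. apply is_iso_id.
    - intros f Z' args. simpl. rewrite comp_id_l. f_equal.
      apply pairing_unique. intro i. rewrite <- (comp_id_l (args i)).
      exact (pr_pairing (map_product (log_lim (logical_id D)) (st_dom M f))
               (fun i => idm (st_sort M _) ∘ args i) i).
    - intros R Z' args. simpl.
      match goal with |- El _ ?a <-> El _ ?b => replace a with b; [reflexivity|] end.
      symmetry. apply (pairing_unique (Q := st_arity M R)). intro i.
      rewrite <- (comp_id_l (args i)).
      exact (pr_pairing (map_product (log_lim (logical_id D)) (st_arity M R))
               (fun i => idm (st_sort M _) ∘ args i) i). }
  destruct Hs as [s Es].
  unfold sem. rewrite (forces_iso s).
  replace (env_map s (env_comp (ctx_env X) x)) with (env_comp (ctx_env (push_ctx t X)) x).
  - exact (Hm t Z x).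
  - apply env_ext. intro i. unfold env_map. rewrite Es. symmetry. apply comp_id_l.
Qed.

Lemma sem_ctx_cons {A : sort L} {G : seq (sort L)} {p : formula (seq_cons A G)}
  {X : Ctx M G} {Y : Ctx M (seq_cons A G)} {q : hom (pr_ob Y) (pr_ob X)}
  (Hq : forall i, pr X i ∘ q = pr Y (Fin.FS i)) {Z : ob D} (x : hom Z (pr_ob X))
  (a : hom Z (st_sort M A)) :
  exists b : hom Z (pr_ob Y), q ∘ b = x /\ pr Y Fin.F1 ∘ b = a /\
      (sem p Y b <-> forces p (env_cons a (env_comp (ctx_env X) x))).
Proof.
  destruct (ctx_cons_bin Hq a x) as [b [[<- <-] _]]. exists b. do 2 (split; auto).
  unfold sem. now rewrite <- (ctx_cons_env Hq b).
Qed.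

(** Each clause of [form_den] is a universal property, which the subobject representing the
    forcing relation has, and which determines a subobject up to isomorphism. *)
Theorem form_den_represents {G : seq (sort L)} (phi : formula G) :
  forall (X : Ctx M G) m, form_den M phi X m <-> represents m (sem phi X).
Proof.
  induction phi as [G R ts|G A t1 t2|G|G|G p IHp q IHq|G p IHp q IHq|G p IHp q IHq
                   |G A p IHp|G A p IHp]; intros X m.
  - simpl. split.
    + intros [k [Hk H]]. apply sub_pullback_El in H. intros Z x. rewrite (H Z x).
      unfold sem. simpl.
      match goal with |- El _ ?a <-> El _ ?b => replace b with a; [reflexivity|] end.
      symmetry. apply pairing_unique. intro i.
      rewrite eval_comp, <- comp_assoc. f_equal. now apply term_den_eval.
    + intro H. exists (pairing (st_arity M R) (fun i => eval (ctx_env X) (ts i))). split.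
      * intro i. apply term_den_eval. exact (pr_pairing (st_arity M R) _ i).
      * apply sub_pullback_El. intros Z x. rewrite (H Z x). unfold sem. simpl.
        match goal with |- El _ ?a <-> El _ ?b => replace a with b; [reflexivity|] end.
        rewrite pairing_comp. f_equal. apply functional_extensionality_dep. intro i.
        symmetry. apply eval_comp.
  - simpl. split.
    + intros [h1 [h2 [H1 [H2 H]]]]. apply term_den_eval in H1, H2. subst.
      apply is_equalizer_El in H. intros Z x. rewrite (H Z x). unfold sem. simpl.
      now rewrite !eval_comp.
    + intro H. exists (eval (ctx_env X) t1), (eval (ctx_env X) t2).
      do 2 (split; [now apply term_den_eval|]). apply is_equalizer_El.
      intros Z x. rewrite (H Z x). unfold sem. simpl. now rewrite !eval_comp.
  - simpl. split.
    + intros H Z x. split; [intros _; exact I|]. intros _.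
      exact (proj1 (sub_le_El _ _) (H (full_sub _)) Z x (El_full x)).
    + intros H n. apply sub_le_El. intros Z x _. now apply H.
  - assert (K : forall m0, represents m0 (sem (fbot G) X) -> forall n, sub_le m0 n).
    { intros m0 H0 n. apply sub_le_El. intros Z x Hx. apply H0 in Hx.
      destruct (has_restriction (proj1 TD) n x) as [w Hw].
      rewrite <- (comp_id_r x). apply Hw. apply (Hx Z (idm Z) w). }
    split; [|exact (K m)]. simpl. intro H.
    destruct (sem_representable (fbot G) X) as [m0 H0].
    apply (represents_le_antisym H0); [apply H | now apply K].
  - split.
    + intros [a [b [Ha [Hb H]]]]. apply IHp in Ha. apply IHq in Hb.
      intros Z x. rewrite (order_meet_El (proj1 TD) H x), (Ha Z x), (Hb Z x). reflexivity.
    + intro H. destruct (sem_representable p X) as [a Ha].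
      destruct (sem_representable q X) as [b Hb].
      exists a, b. split; [now apply IHp|]. split; [now apply IHq|].
      intro n. rewrite !sub_le_El. split.
      * intro K. split; intros Z x Hx; apply K in Hx; apply H in Hx; destruct Hx;
          [now apply Ha | now apply Hb].
      * intros [K1 K2] Z x Hx. apply H. split; [now apply Ha, K1 | now apply Hb, K2].
  - assert (K : forall a b m0, represents a (sem p X) -> represents b (sem q X) ->
               represents m0 (sem (for_ p q) X) ->
               forall n, sub_le m0 n <-> sub_le a n /\ sub_le b n).
    { intros a b m0 Ha Hb H0 n. rewrite !sub_le_El. split.
      - intro K. split; intros Z x Hx; apply K, H0; intros W y w H1 H2;
          [apply H1 | apply H2]; rewrite !env_comp_comp;
          [apply Ha | apply Hb]; now repeat apply El_comp.
      - intros [K1 K2] Z x Hx. apply H0 in Hx.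
        destruct (has_restriction (proj1 TD) n x) as [w Hw].
        rewrite <- (comp_id_r x). apply Hw. apply (Hx Z (idm Z) w); intros V u Hu;
          rewrite env_comp_id, env_comp_comp in Hu; apply Hw;
          [apply K1, Ha, Hu | apply K2, Hb, Hu]. }
    split.
    + intros [a [b [Ha [Hb H]]]]. apply IHp in Ha. apply IHq in Hb.
      destruct (sem_representable (for_ p q) X) as [m0 H0].
      specialize (K a b m0 Ha Hb H0).
      apply (represents_le_antisym H0); [apply H, K | apply K, H];
        apply sub_le_El; auto.
    + intro H. destruct (sem_representable p X) as [a Ha].
      destruct (sem_representable q X) as [b Hb].
      exists a, b. split; [now apply IHp|]. split; [now apply IHq|]. now apply K.
  - assert (K : forall a b m0, represents a (sem p X) -> represents b (sem q X) ->
               represents m0 (sem (fimp p q) X) ->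
               forall n c, (forall d, sub_le d c <-> sub_le d n /\ sub_le d a) ->
                 (sub_le n m0 <-> sub_le c b)).
    { intros a b m0 Ha Hb H0 n c Hc. apply (order_meet_El (proj1 TD)) in Hc.
      rewrite !sub_le_El. split.
      - intros K Z x Hx. apply Hc in Hx. destruct Hx as [H1 H2].
        apply K in H1. apply H0 in H1. apply Hb.
        specialize (H1 Z (idm Z)). rewrite env_comp_id in H1. apply H1. now apply Ha.
      - intros K Z x Hx. apply H0. intros W y Hy. rewrite env_comp_comp in *.
        apply Hb, K, Hc. split; [now apply El_comp | now apply Ha]. }
    split.
    + intros [a [b [Ha [Hb H]]]]. apply IHp in Ha. apply IHq in Hb.
      destruct (sem_representable (fimp p q) X) as [m0 H0].
      specialize (K a b m0 Ha Hb H0).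
      assert (E : forall n, sub_le n m <-> sub_le n m0).
      { intro n. destruct (has_meet (proj1 TD) n a) as [c Hc].
        assert (Hc' : forall d, sub_le d c <-> sub_le d n /\ sub_le d a).
        { intro d. rewrite !sub_le_El. split.
          - intro J. split; intros Z x Hx; now apply Hc, J.
          - intros [J1 J2] Z x Hx. apply Hc. auto. }
        now rewrite (H n c Hc'), (K n c Hc'). }
      apply (represents_le_antisym H0); apply E; apply sub_le_El; auto.
    + intro H. destruct (sem_representable p X) as [a Ha].
      destruct (sem_representable q X) as [b Hb].
      exists a, b. split; [now apply IHp|]. split; [now apply IHq|]. now apply K.
  - assert (K : forall (Y : Ctx M (seq_cons A G)) a (q : hom (pr_ob Y) (pr_ob X)) m0,
               represents a (sem p Y) -> (forall i, pr X i ∘ q = pr Y (Fin.FS i)) ->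
               represents m0 (sem (fall A p) X) ->
               forall n n', sub_pullback q n n' -> (sub_le n m0 <-> sub_le n' a)).
    { intros Y a q m0 Ha Hq H0 n n' Hn. apply sub_pullback_El in Hn.
      rewrite !sub_le_El. split.
      - intros K Z b Hb. apply Hn, K, H0 in Hb. apply Ha.
        specialize (Hb Z (idm Z) (pr Y Fin.F1 ∘ b)). rewrite env_comp_id in Hb.
        unfold sem. now rewrite <- (ctx_cons_env Hq b).
      - intros K Z x Hx. apply H0. intros W y c. rewrite env_comp_comp.
        destruct (sem_ctx_cons (p := p) Hq (x ∘ y) c) as [b [b1 [_ b3]]].
        apply b3, Ha, K, Hn. rewrite b1. now apply El_comp. }
    split.
    + intros [Y [a [q [Ha [Hq H]]]]]. apply IHp in Ha.
      destruct (sem_representable (fall A p) X) as [m0 H0].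
      assert (E : forall n, sub_le n m <-> sub_le n m0).
      { intro n. destruct (has_sub_pullback (proj1 TD) q n) as [n' Hn].
        now rewrite (H n n' Hn), (K Y a q m0 Ha Hq H0 n n' Hn). }
      apply (represents_le_antisym H0); apply E; apply sub_le_El; auto.
    + intro H. destruct (ctx_cons_exists (proj1 TD) A X) as [Y [q Hq]].
      destruct (sem_representable p Y) as [a Ha].
      exists Y, a, q. split; [now apply IHp|]. split; auto. now apply K.
  - assert (K : forall (Y : Ctx M (seq_cons A G)) a (q : hom (pr_ob Y) (pr_ob X)) m0,
               represents a (sem p Y) -> (forall i, pr X i ∘ q = pr Y (Fin.FS i)) ->
               represents m0 (sem (fex A p) X) ->
               forall n n', sub_pullback q n n' -> (sub_le m0 n <-> sub_le a n')).
    { intros Y a q m0 Ha Hq H0 n n' Hn. apply sub_pullback_El in Hn.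
      rewrite !sub_le_El. split.
      - intros K Z b Hb. apply Hn, K, H0. intros W y w Hw.
        apply (Hw W (idm W) (pr Y Fin.F1 ∘ (b ∘ y))).
        rewrite env_comp_id, env_comp_comp, (comp_assoc q b y).
        refine (eq_ind_r (fun r => forces p r) _ (ctx_cons_env Hq (b ∘ y))).
        apply Ha. now apply El_comp.
      - intros K Z x Hx. apply H0 in Hx.
        destruct (has_restriction (proj1 TD) n x) as [w Hw].
        rewrite <- (comp_id_r x). apply Hw. apply (Hx Z (idm Z) w). intros V u c Hc.
        rewrite env_comp_id, env_comp_comp in Hc. apply Hw.
        destruct (sem_ctx_cons (p := p) Hq (x ∘ u) c) as [b [b1 [_ b3]]].
        rewrite <- b1. now apply Hn, K, Ha, b3. }
    split.
    + intros [Y [a [q [Ha [Hq H]]]]]. apply IHp in Ha.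
      destruct (sem_representable (fex A p) X) as [m0 H0].
      assert (E : forall n, sub_le m n <-> sub_le m0 n).
      { intro n. destruct (has_sub_pullback (proj1 TD) q n) as [n' Hn].
        now rewrite (H n n' Hn), (K Y a q m0 Ha Hq H0 n n' Hn). }
      apply (represents_le_antisym H0); apply E; apply sub_le_El; auto.
    + intro H. destruct (ctx_cons_exists (proj1 TD) A X) as [Y [q Hq]].
      destruct (sem_representable p Y) as [a Ha].
      exists Y, a, q. split; [now apply IHp|]. split; auto. now apply K.
Qed.

Theorem st_satisfies_forces (phi : sentence L) :
  st_satisfies M phi <-> forall Z (r : Env M Z seq_nil), forces phi r.
Proof.
  split.
  - intros [X [m [Hm H]]] Z r. apply form_den_represents in Hm.
    replace r with (env_comp (ctx_env X) (pairing X r)).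
    + apply Hm. exact (proj1 (sub_le_El _ _) (H (full_sub _)) Z _ (El_full _)).
    + apply env_ext. intro i. exact (Fin.case0 (fun _ => _) i).
  - intro H. destruct (has_products (proj1 TD) (fun i => st_sort M (item seq_nil i))) as [X _].
    destruct (sem_representable phi X) as [m Hm]. exists X, m.
    split; [now apply form_den_represents|].
    intro n. apply sub_le_El. intros Z x _. apply Hm, H.
Qed.

End FormDen.
(** * Higher-order structures *)

Section PowerIso.
Context {D : Category} (HD : has_finite_limits D).

(** Membership in the first power object, transported along [s], is a relation, and the second
    power object classifies it. *)
Lemma power_map {X X' : Fin.t 2 -> ob D} {Q : Product X} {Q' : Product X'}
  {e : Sub (pr_ob Q)} {e' : Sub (pr_ob Q')} (He' : is_power e')
  (s : hom (X fst_ix) (X' fst_ix)) : is_iso s ->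
  exists s' : hom (X snd_ix) (X' snd_ix),
    forall Z (w : hom Z (pr_ob Q)) (w' : hom Z (pr_ob Q')),
      pr Q' fst_ix ∘ w' = s ∘ (pr Q fst_ix ∘ w) ->
      pr Q' snd_ix ∘ w' = s' ∘ (pr Q snd_ix ∘ w) -> (El e w <-> El e' w').
Proof.
  intro Hs.
  assert (HR : is_bin (s ∘ pr Q fst_ix) (pr Q snd_ix)).
  { intros Z a x. destruct Hs as [s0 [E1 E2]].
    destruct (product_bin Q (s0 ∘ a) x) as [h [[h1 h2] U]].
    exists h. split.
    - split; auto. now rewrite comp_assoc, h1, <- comp_assoc, E2, comp_id_l.
    - intros h' [F1 F2]. apply U. split; auto.
      now rewrite <- F1, <- !comp_assoc, E1, comp_id_l. }
  destruct (power_classify He' HR e) as [chi [h [h1 [h2 h3]]]].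
  exists chi. intros Z w w' E1 E2. apply sub_pullback_El in h3. rewrite (h3 Z w).
  replace w' with (h ∘ w); [reflexivity|].
  apply (is_bin_ext (product_bin Q')).
  - now rewrite E1, <- comp_assoc, h1, comp_assoc.
  - now rewrite E2, <- comp_assoc, h2, comp_assoc.
Qed.

(** The comparison maps in the two directions classify membership itself when composed, hence
    are inverse by extensionality. *)
Lemma power_iso {X X' : Fin.t 2 -> ob D} {Q : Product X} {Q' : Product X'}
  {e : Sub (pr_ob Q)} {e' : Sub (pr_ob Q')} (He : is_power e) (He' : is_power e')
  (s : hom (X fst_ix) (X' fst_ix)) : is_iso s ->
  exists s' : hom (X snd_ix) (X' snd_ix), is_iso s' /\
    forall Z (w : hom Z (pr_ob Q)) (w' : hom Z (pr_ob Q')),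
      pr Q' fst_ix ∘ w' = s ∘ (pr Q fst_ix ∘ w) ->
      pr Q' snd_ix ∘ w' = s' ∘ (pr Q snd_ix ∘ w) -> (El e w <-> El e' w').
Proof.
  intro Hs. destruct (iso_inv Hs) as [s0 [Hs0 [I1 I2]]].
  destruct (power_map (e := e) He' Hs) as [f Hf].
  destruct (power_map (e := e') He Hs0) as [g Hg].
  exists f. split; [|exact Hf]. exists g. split.
  - apply (power_ext HD He). intros Z w w' y E1 E2 E3.
    destruct (product_bin Q' (s ∘ (pr Q fst_ix ∘ w')) (f ∘ (pr Q snd_ix ∘ w')))
      as [v [[v1 v2] _]].
    rewrite (Hf Z w' v v1 v2). symmetry. apply Hg.
    + now rewrite v1, <- comp_assoc, I1, comp_id_l.
    + rewrite v2, E2, E3. now rewrite comp_id_l, !comp_assoc.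
  - apply (power_ext HD He'). intros Z w w' y E1 E2 E3.
    destruct (product_bin Q (s0 ∘ (pr Q' fst_ix ∘ w')) (g ∘ (pr Q' snd_ix ∘ w')))
      as [v [[v1 v2] _]].
    rewrite (Hg Z w' v v1 v2). symmetry. apply Hf.
    + now rewrite v1, <- comp_assoc, I2, comp_id_l.
    + rewrite v2, E2, E3. now rewrite comp_id_l, !comp_assoc.
Qed.

Context {L : Signature} {N N' : Structure (up L) D}
  (PN : forall A n, is_power (Q := st_arity N (inr (A, n))) (st_rel N (inr (A, n))))
  (PN' : forall A n, is_power (Q := st_arity N' (inr (A, n))) (st_rel N' (inr (A, n))))
  (b : forall A : sort L, hom (st_sort N (A, 0)) (st_sort N' (A, 0)))
  (b_iso : forall A, is_iso (b A))
  (b_fun : forall (f : fsym L) Z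
     (args : forall i : Fin.t (len (dom f)), hom Z (st_sort N (item (dom f) i, 0))),
     b (cod f) ∘ (st_fun N f ∘ pairing (st_dom N f) args)
     = st_fun N' f ∘ pairing (st_dom N' f) (fun i => b _ ∘ args i))
  (b_rel : forall (R : rsym L) Z
     (args : forall i : Fin.t (len (arity R)), hom Z (st_sort N (item (arity R) i, 0))),
     El (st_rel N (inl R)) (pairing (st_arity N (inl R)) args)
     <-> El (st_rel N' (inl R)) (pairing (st_arity N' (inl R)) (fun i => b _ ∘ args i))).

Fixpoint power_sort_iso (A : sort L) (n : nat)
  : {s : hom (st_sort N (A, n)) (st_sort N' (A, n)) | is_iso s} :=
  match n with
  | 0 => exist _ (b A) (b_iso A)
  | S n =>
      let s := power_sort_iso A n in
      let H := constructive_indefinite_description _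
                 (power_iso (@PN A n) (@PN' A n) (proj2_sig s)) in
      exist _ (proj1_sig H) (proj1 (proj2_sig H))
  end.

(** An isomorphism of structures extends to the power sorts, by induction on their order. *)
Lemma power_structures_iso : inhabited (StructIso N N').
Proof.
  constructor.
  unshelve refine (@Build_StructIso (up L) D N N'
    (fun A => match A return hom (st_sort N A) (st_sort N' A) with
              | (A, n) => proj1_sig (power_sort_iso A n) end) _ _ _).
  - intros [A n]. exact (proj2_sig (power_sort_iso A n)).
  - intros f Z args. exact (b_fun args).
  - intros [R|[A n]] Z args; [exact (b_rel args)|].
    set (s := fun A : sort (up L) => match A return hom (st_sort N A) (st_sort N' A) with
                | (A, n) => proj1_sig (power_sort_iso A n) end).
    refine (proj2 (proj2_sig (constructive_indefinite_description _
              (power_iso (@PN A n) (@PN' A n) (proj2_sig (power_sort_iso A n)))))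
              Z (pairing (st_arity N (inr (A, n))) args)
              (pairing (st_arity N' (inr (A, n))) (fun i => s _ ∘ args i)) _ _).
    + refine (eq_trans (pr_pairing (st_arity N' (inr (A, n)))
                          (fun i => s _ ∘ args i) fst_ix) _).
      exact (f_equal (fun a => s (A, n) ∘ a)
               (eq_sym (pr_pairing (st_arity N (inr (A, n))) args fst_ix))).
    + refine (eq_trans (pr_pairing (st_arity N' (inr (A, n)))
                          (fun i => s _ ∘ args i) snd_ix) _).
      exact (f_equal (fun a => s (A, S n) ∘ a)
               (eq_sym (pr_pairing (st_arity N (inr (A, n))) args snd_ix))).
Qed.

End PowerIso.

(** Power sorts are built by iterating a choice of power objects. *)
Lemma power_ext_exists {D : Category} (TD : is_topos D) {L : Signature} (M : Interp L D) :
  exists P : PowerExt M, True.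
Proof.
  destruct (dep_choice (proj2 TD)) as [P HP].
  set (pw := fun A => fix pw n := match n with 0 => P (in_sort M A) | S n => P (pw n) end).
  assert (H : forall x : sort L * nat,
    exists Qe : {Q : Product (fun i => up_ob (in_sort M) pw (mem_arity (fst x) (snd x) i))
                 & Sub (pr_ob Q)}, is_power (projT2 Qe)).
  { intros [A n]. simpl.
    set (X := up_ob (in_sort M) pw (A, n)).
    assert (E : pair_family X (P X)
                = (fun i => up_ob (in_sort M) pw (pair_family (A, n) (A, S n) i))).
    { apply functional_extensionality. refine (fin2_case _ _); [reflexivity|].
      now destruct n. }
    rewrite <- E. destruct (HP X) as [Q [e He]]. now exists (existT _ Q e). }
  destruct (dep_choice H) as [Qe HQe].
  exists {| pe_ob := pw : sort L -> nat -> ob D;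
            pe_prod := fun A n => projT1 (Qe (A, n));
            pe_mem := fun A n => projT2 (Qe (A, n));
            pe_power := fun A n => HQe (A, n) |}.
  exact I.
Qed.

Lemma forces_closed_iso {D : Category} {L : Signature} {N N' : Structure L D}
  (s : StructIso N N') (phi : sentence L) :
  (forall Z (r : Env N Z seq_nil), forces phi r)
  <-> (forall Z (r : Env N' Z seq_nil), forces phi r).
Proof.
  assert (U : forall (S : Structure L D) Z (r r' : Env S Z seq_nil), r = r').
  { intros S Z r r'. apply env_ext. intro i. exact (Fin.case0 (fun _ => _) i). }
  split; intros H Z r.
  - assert (r0 : Env N Z seq_nil) by (intro i; exact (Fin.case0 (fun _ => _) i)).
    rewrite (U _ _ r (env_map s r0)). apply (forces_iso s), H.
  - apply (forces_iso s), H.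
Qed.

(** The morphism is the inclusion of the subobject of a terminal object that the sentence
    denotes in [M]. Logical functors preserve this denotation, and the sentence holds when the
    subobject is everything, that is, when its inclusion is invertible. *)
Theorem sentence_detected {D : Category} (TD : is_topos D) {L : Signature} (M : Interp L D)
  (phi : sentence (up L)) :
  exists (x y : ob D) (m : hom x y), forall t : Target D,
    is_iso (fmap t m) <-> satisfies (push (tg_log t) M) phi.
Proof.
  destruct (power_ext_exists TD M) as [P _].
  destruct (has_products (proj1 TD) (fun i => st_sort (extend P) (item seq_nil i))) as [X _].
  destruct (forces_definable TD phi (X : Ctx (extend P) seq_nil)) as [m Hm].
  exists (sub_ob m), (pr_ob X), (sub_arr m). intro t.
  set (N := push_structure (tg_log t) (extend P)).
  assert (HN : forall P' : PowerExt (push (tg_log t) M), inhabited (StructIso N (extend P'))).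
  { intro P'. unshelve eapply (power_structures_iso (proj1 (tg_topos t)) (N := N) (N' := extend P')
      _ (fun A n => @pe_power _ _ _ P' A n) (b := fun A => idm (t (in_sort M A)))).
    - intros A n. exact (log_pow (tg_log t) (@pe_power _ _ _ P A n)).
    - intro A. apply is_iso_id.
    - intros f Z args. rewrite comp_id_l. simpl. f_equal.
      apply pairing_unique. intro i. rewrite <- (comp_id_l (args i)).
      exact (pr_pairing (in_seq (push (tg_log t) M) (occurs_dom f)) _ i).
    - intros R Z args. simpl.
      match goal with |- El _ ?a <-> El _ ?b => replace a with b; [reflexivity|] end.
      symmetry. apply pairing_unique. intro i. rewrite <- (comp_id_l (args i)).
      exact (pr_pairing (in_seq (push (tg_log t) M) (occurs_arity R)) _ i). }
  assert (E : is_iso (fmap t (sub_arr m)) <-> El (tg_sub t m) (idm _)).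
  { split.
    - intros [k [_ Hk]]. now exists k.
    - intros [k Hk]. simpl in Hk. exists k. split; auto.
      apply (@sub_mono _ _ (tg_sub t m)). simpl.
      now rewrite <- comp_assoc, Hk, comp_id_l, comp_id_r. }
  assert (E' : El (tg_sub t m) (idm _) <-> forall Z (r : Env N Z seq_nil), forces phi r).
  { split.
    - intros H Z r. set (x := pairing (push_ctx t (X : Ctx (extend P) seq_nil)) r).
      apply (El_comp x) in H. apply Hm in H. unfold sem in H.
      replace r with (env_comp (ctx_env (push_ctx t (X : Ctx (extend P) seq_nil))) (idm _ ∘ x));
        [exact H|].
      apply env_ext. intro i. exact (Fin.case0 (fun _ => _) i).
    - intro H. apply Hm, H. }
  rewrite E, E'. split.
  - intro H. destruct (power_ext_exists (tg_topos t) (push (tg_log t) M)) as [P' _].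
    exists P'. apply (st_satisfies_forces (tg_topos t)).
    destruct (HN P') as [s]. now apply (forces_closed_iso s).
  - intros [P' H]. destruct (HN P') as [s]. apply (forces_closed_iso s).
    exact (proj1 (st_satisfies_forces (tg_topos t) (extend P') phi) H).
Qed.

(** The morphism is the comparison of the cone with a product; a functor that preserves finite
    limits maps it to the comparison of the image cone with a product. *)
Lemma product_detected {D : Category} (HD : has_finite_limits D) {n} {Y : Fin.t n -> ob D}
  {P : ob D} (p : forall i, hom P (Y i)) :
  exists (x y : ob D) (m : hom x y), forall (D' : Category) (F : Functor D D'),
    preserves_finite_limits F ->
    (is_iso (fmap F m) <-> is_product (X := fun i => F (Y i)) (fun i => fmap F (p i))).
Proof.
  destruct (has_products HD Y) as [Q _].
  exists P, (pr_ob Q), (pairing Q p). intros D' F HF.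
  set (m := fmap F (pairing Q p)).
  assert (E : forall i, pr (map_product HF Q) i ∘ m = fmap F (p i)).
  { intro i. simpl. unfold m. now rewrite <- fmap_comp, pr_pairing. }
  split.
  - intros [k [K1 K2]] Z f. exists (k ∘ pairing (map_product HF Q) f). split.
    + intro i. rewrite <- E, comp_assoc, <- (comp_assoc m), K2, comp_id_l.
      exact (pr_pairing (map_product HF Q) f i).
    + intros h Hh. apply (iso_mono (f := m)); [now exists k|].
      rewrite <- comp_assoc, K2, comp_id_l.
      apply (pairing_unique (Q := map_product HF Q)). intro i.
      now rewrite <- comp_assoc, E.
  - intro H. destruct (H _ (pr (map_product HF Q))) as [k [Hk _]].
    exists k. split.
    + destruct (H _ (fun i => fmap F (p i))) as [l [_ U]].
      transitivity l; [symmetry|]; apply U.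
      * intro i. rewrite <- comp_assoc, Hk. apply E.
      * intro i. apply comp_id_r.
    + apply (product_ext (Q := map_product HF Q)). intro i.
      rewrite <- comp_assoc. refine (eq_trans (f_equal (fun a => a ∘ k) (E i)) _).
      now rewrite Hk, comp_id_r.
Qed.

(** The morphism is the diagonal of the kernel pair of [f]. *)
Lemma mono_detected {D : Category} (HD : has_finite_limits D) {a b : ob D} (f : hom a b) :
  exists (x y : ob D) (m : hom x y), forall (D' : Category) (F : Functor D D'),
    preserves_finite_limits F -> (is_iso (fmap F m) <-> is_mono (fmap F f)).
Proof.
  destruct (has_pullbacks HD f f) as [w [p [q H]]].
  destruct (proj2 H a (idm a) (idm a) eq_refl) as [d [[d1 d2] _]].
  exists a, w, d. intros D' F HF.
  apply (preserves_pullback HF) in H.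
  assert (E1 : fmap F p ∘ fmap F d = idm _) by now rewrite <- fmap_comp, d1, fmap_id.
  assert (E2 : fmap F q ∘ fmap F d = idm _) by now rewrite <- fmap_comp, d2, fmap_id.
  split.
  - intros [k [_ K]] c g h E. destruct (proj2 H c g h E) as [l [[<- <-] _]].
    rewrite <- (comp_id_l l), <- K, !comp_assoc, <- (comp_assoc (fmap F p)), E1.
    now rewrite <- (comp_assoc (fmap F q)), E2.
  - intro Hm. assert (E : fmap F p = fmap F q) by (apply Hm, H).
    exists (fmap F p). split; auto.
    destruct (proj2 H _ (fmap F p) (fmap F q) (proj1 H)) as [l [_ U]].
    rewrite <- (U (fmap F d ∘ fmap F p)), <- (U (idm _)); auto.
    + split; apply comp_id_r.
    + split; rewrite <- comp_assoc, ?E1, ?E2, comp_id_l; auto.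
Qed.
(** * Interpretations as diagrams *)

Section SignatureGraph.
Context {L : Signature}.

Inductive vertex : Type :=
| v_sort : sort L -> vertex
| v_seq : forall w : seq (sort L), occurs w -> vertex
| v_rel : rsym L -> vertex.

Inductive edge : Type :=
| e_proj : forall w : seq (sort L), occurs w -> Fin.t (len w) -> edge
| e_fun : fsym L -> edge
| e_rel : rsym L -> edge.

Definition e_src (e : edge) : vertex :=
  match e with
  | e_proj o _ => v_seq o
  | e_fun f => v_seq (occurs_dom f)
  | e_rel R => v_rel R
  end.

Definition e_tgt (e : edge) : vertex :=
  match e with
  | @e_proj w _ i => v_sort (item w i)
  | e_fun f => v_sort (cod f)
  | e_rel R => v_seq (occurs_arity R)
  end.

Lemma occurs_finite : Finite (fsym L) -> Finite (rsym L) ->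
  exists l : list {w : seq (sort L) | occurs w}, forall w o, In (exist _ w o) l.
Proof.
  intros [lf Hf] [lr Hr].
  exists (map (fun f => exist _ (dom f) (occurs_dom f)) lf
          ++ map (fun R => exist _ (arity R) (occurs_arity R)) lr).
  intros w o. apply in_or_app. destruct (o) as [[f E]|[R E]]; subst w; [left|right];
    apply in_map_iff; eexists; (split; [|eauto]); f_equal; apply proof_irrelevance.
Qed.

Lemma occurs_finite_type :
  Finite (fsym L) -> Finite (rsym L) -> Finite {w : seq (sort L) | occurs w}.
Proof.
  intros Hf Hr. destruct (occurs_finite Hf Hr) as [l Hl]. exists l. intros [w o]. apply Hl.
Qed.

Lemma vertex_finite :
  Finite (sort L) -> Finite (fsym L) -> Finite (rsym L) -> Finite vertex.
Proof.
  intros [ls Hs] Hf Hr. destruct (occurs_finite Hf Hr) as [lw Hw]. destruct Hr as [lr Hr].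
  exists (map v_sort ls ++ map (fun w => v_seq (proj2_sig w)) lw ++ map v_rel lr).
  intros [A|w o|R]; apply in_or_app; [left|right|right].
  - now apply in_map.
  - apply in_or_app. left. exact (in_map _ _ _ (Hw w o)).
  - apply in_or_app. right. now apply in_map.
Qed.

Lemma edge_finite : Finite (fsym L) -> Finite (rsym L) -> Finite edge.
Proof.
  intros Hf Hr. destruct (occurs_finite Hf Hr) as [lw Hw].
  destruct Hf as [lf Hf], Hr as [lr Hr].
  destruct (dep_choice (fun n => Fin_Finite n)) as [fin Hfin].
  exists (flat_map (fun w : {w : seq (sort L) | occurs w} =>
                      map (e_proj (proj2_sig w)) (fin _)) lw
          ++ map e_fun lf ++ map e_rel lr).
  intros [w o i|f|R]; apply in_or_app; [left|right|right].
  - apply in_flat_map. exists (exist _ w o). split; auto.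
    apply (in_map (e_proj o)), Hfin.
  - apply in_or_app. left. now apply in_map.
  - apply in_or_app. right. now apply in_map.
Qed.

Definition SigDiagram (D : Category) : Type := Diagram e_src e_tgt D.

Definition well_formed {D : Category} (d : SigDiagram D) : Prop :=
  (forall w (o : occurs w), is_product (X := fun i => d_ob d (v_sort (item w i)))
     (P := d_ob d (v_seq o)) (fun i => d_mor d (e_proj o i))) /\
  (forall R, is_mono (d_mor d (e_rel R))).

(** Defined by matching so that it computes on pairs of proofs, which [proj1] does not; the
    image of an interpretation given by a diagram is then convertible to one. *)
Definition wf_product {D : Category} {d : SigDiagram D} (H : well_formed d) :=
  let (h, _) := H in h.

Definition wf_mono {D : Category} {d : SigDiagram D} (H : well_formed d) :=
  let (_, h) := H in h.

Definition to_interp {D : Category} (d : SigDiagram D) (H : well_formed d) : Interp L D :=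
  @Build_Interp L D (fun A => d_ob d (v_sort A))
    (fun w o => {| pr_ob := d_ob d (v_seq o) : ob D;
                   pr := fun i => d_mor d (e_proj o i);
                   pr_spec := wf_product H o |})
    (fun f => d_mor d (e_fun f))
    (fun R => {| sub_arr := d_mor d (e_rel R); sub_mono := @wf_mono _ _ H R |}).

Definition of_interp {D : Category} (M : Interp L D) : SigDiagram D :=
  @Build_Diagram _ _ e_src e_tgt D
    (fun v => match v with
              | v_sort A => in_sort M A
              | v_seq o => pr_ob (in_seq M o)
              | v_rel R => sub_ob (in_rel M R)
              end)
    (fun e => match e with
              | e_proj o i => pr (in_seq M o) i
              | e_fun f => in_fun M f
              | e_rel R => sub_arr (in_rel M R)
              end).

Lemma of_interp_well_formed {D : Category} (M : Interp L D) : well_formed (of_interp M).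
Proof.
  split; simpl.
  - intros w o. exact (pr_spec (in_seq M o)).
  - intro R. exact (@sub_mono _ _ (in_rel M R)).
Qed.

Lemma to_interp_eq {D : Category} (d d' : SigDiagram D) H H' :
  d = d' -> to_interp (d := d) H = to_interp (d := d') H'.
Proof. intro E. subst d'. f_equal. apply proof_irrelevance. Qed.

(** Passing to the diagram only forgets proofs, so nothing is lost. *)
Lemma to_interp_of_interp {D : Category} (M : Interp L D) :
  to_interp (of_interp_well_formed M) = M.
Proof.
  destruct M as [s q f r].
  set (eta := fun (q : forall w : seq (sort L), occurs w -> Product (fun i => s (w i)))
    (K : forall w o, is_product (fun i => pr (q w o) i)) (w : seq (sort L)) (o : occurs w) =>
    {| pr_ob := pr_ob (q w o) : ob D; pr := fun i => pr (q w o) i; pr_spec := K w o |}).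
  assert (Eq : forall K, eta q K = q).
  { intro K. apply functional_extensionality_dep. intro w.
    apply functional_extensionality_dep. intro o. unfold eta.
    generalize (K w o). destruct (q w o) as [P p Hp]. simpl.
    intro K'. f_equal. apply proof_irrelevance. }
  assert (Er : forall (X : ob D) (m : Sub X) (K : is_mono (sub_arr m)),
             {| sub_arr := sub_arr m; sub_mono := K |} = m).
  { intros X [S m Hm] K. f_equal. apply proof_irrelevance. }
  set (K0 := fun w o => pr_spec (q w o)).
  revert f r. rewrite <- (Eq K0). intros f r.
  unfold to_interp. simpl. generalize (of_interp_well_formed
    {| in_sort := s; in_seq := eta q K0; in_fun := f; in_rel := r |}).
  intros [k1 k2]. simpl. rewrite (proof_irrelevance _ k1 K0).
  change (@Build_Interp L D s (eta q K0) f
            (fun R => {| sub_arr := sub_arr (r R); sub_mono := k2 R |})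
          = @Build_Interp L D s (eta q K0) f r).
  f_equal. apply functional_extensionality_dep. intro R. apply Er.
Qed.

Lemma map_diagram_well_formed {D D' : Category} (F : Functor D D')
  (HF : preserves_finite_limits F) (d : SigDiagram D) :
  well_formed d -> well_formed (map_diagram F d).
Proof.
  intros [H1 H2]. split.
  - intros w o. exact (preserves_product HF (H1 w o)).
  - intro R. exact (preserves_mono HF (H2 R)).
Qed.

Lemma push_to_interp {D D' : Category} (F : Functor D D') (HF : logical F)
  (d : SigDiagram D) (H : well_formed d) (H' : well_formed (map_diagram F d)) :
  push HF (to_interp H) = to_interp H'.
Proof.
  transitivity (to_interp (d := map_diagram F d)
    (conj (fun w o => preserves_product (log_lim HF) (wf_product H o))
          (fun R => preserves_mono (log_lim HF) (@wf_mono _ _ H R)))); [reflexivity|].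
  now apply to_interp_eq.
Qed.

Lemma wf_pairing {D : Category} {d : SigDiagram D} (H : well_formed d)
  w (o : occurs w) Z (f : forall i, hom Z (d_ob d (v_sort (item w i)))) :
  exists h : hom Z (d_ob d (v_seq o)), forall i, d_mor d (e_proj o i) ∘ h = f i.
Proof.
  exists (pairing (in_seq (to_interp H) o) f). intro i.
  exact (pr_pairing (in_seq (to_interp H) o) f i).
Qed.

Lemma wf_jointly_monic {D : Category} {d : SigDiagram D} (H : well_formed d)
  w (o : occurs w) Z (f g : hom Z (d_ob d (v_seq o))) :
  (forall i, d_mor d (e_proj o i) ∘ f = d_mor d (e_proj o i) ∘ g) -> f = g.
Proof. exact (product_ext (Q := in_seq (to_interp H) o) (f := f) (g := g)). Qed.

(** An isomorphism of interpretations is given on sorts only: on products it extends by the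
    induced morphisms, on relations by the restrictions that it comes with. *)
Lemma interp_iso_extend {D : Category} {d d' : SigDiagram D} {H : well_formed d}
  {H' : well_formed d'} (u : InterpIso (to_interp H) (to_interp H')) :
  exists a : forall v, hom (d_ob d v) (d_ob d' v),
    (forall A, a (v_sort A) = u A) /\ (forall v, is_iso (a v)) /\
    (forall e, a (e_tgt e) ∘ d_mor d e = d_mor d' e ∘ a (e_src e)).
Proof.
  set (ua := fun A => u A : hom (d_ob d (v_sort A)) (d_ob d' (v_sort A))).
  assert (Iso : forall A, is_iso (ua A)) by exact (ii_iso u).
  assert (Fun : forall f, exists h : hom (d_ob d (v_seq (occurs_dom f)))
                                         (d_ob d' (v_seq (occurs_dom f))),
    (forall i, d_mor d' (e_proj (occurs_dom f) i) ∘ h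
               = ua _ ∘ d_mor d (e_proj (occurs_dom f) i)) /\
    d_mor d' (e_fun f) ∘ h = ua _ ∘ d_mor d (e_fun f)) by exact (ii_fun u).
  assert (Rel : forall R, exists (h : hom (d_ob d (v_seq (occurs_arity R)))
                                          (d_ob d' (v_seq (occurs_arity R))))
                                 (k : hom (d_ob d (v_rel R)) (d_ob d' (v_rel R))),
    (forall i, d_mor d' (e_proj (occurs_arity R) i) ∘ h
               = ua _ ∘ d_mor d (e_proj (occurs_arity R) i)) /\
    is_iso k /\ d_mor d' (e_rel R) ∘ k = h ∘ d_mor d (e_rel R)) by exact (ii_rel u).
  change (exists a : forall v, hom (d_ob d v) (d_ob d' v),
    (forall A, a (v_sort A) = ua A) /\ (forall v, is_iso (a v)) /\
    (forall e, a (e_tgt e) ∘ d_mor d e = d_mor d' e ∘ a (e_src e))).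
  clearbody ua. clear u.
  assert (Hv : forall v : vertex, exists a : hom (d_ob d v) (d_ob d' v), is_iso a /\
    match v return hom (d_ob d v) (d_ob d' v) -> Prop with
    | v_sort A => fun a => a = ua A
    | @v_seq w o => fun a =>
        forall i, d_mor d' (e_proj o i) ∘ a = ua _ ∘ d_mor d (e_proj o i)
    | v_rel R => fun a => exists h : hom (d_ob d (v_seq (occurs_arity R)))
                                         (d_ob d' (v_seq (occurs_arity R))),
        (forall i, d_mor d' (e_proj (occurs_arity R) i) ∘ h
                   = ua _ ∘ d_mor d (e_proj (occurs_arity R) i)) /\
        d_mor d' (e_rel R) ∘ a = h ∘ d_mor d (e_rel R)
    end a).
  { intros [A|w o|R].
    - now exists (ua A).
    - destruct (wf_pairing H' o (Z := d_ob d (v_seq o))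
        (fun i => ua _ ∘ d_mor d (e_proj o i))) as [h Hh].
      destruct (dep_choice Iso) as [v Hv].
      destruct (wf_pairing H o (Z := d_ob d' (v_seq o))
        (fun i => v _ ∘ d_mor d' (e_proj o i))) as [k Hk].
      exists h. split; [exists k; split|exact Hh]; simpl in Hh, Hk.
      + apply (wf_jointly_monic H). intro i. simpl.
        rewrite <- comp_assoc, Hk, comp_assoc, Hh, <- comp_assoc, (proj1 (Hv _)).
        now rewrite comp_id_l, comp_id_r.
      + apply (wf_jointly_monic H'). intro i. simpl.
        rewrite <- comp_assoc, Hh, comp_assoc, Hk, <- comp_assoc, (proj2 (Hv _)).
        now rewrite comp_id_l, comp_id_r.
    - destruct (Rel R) as [h [k [h1 [h2 h3]]]]. exists k. split; auto. now exists h. }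
  destruct (dep_choice Hv) as [a Ha]. exists a.
  assert (Hs : forall A, a (v_sort A) = ua A) by (intro A; exact (proj2 (Ha (v_sort A)))).
  assert (Hp : forall w (o : occurs w) i,
             d_mor d' (e_proj o i) ∘ a (v_seq o) = ua _ ∘ d_mor d (e_proj o i))
    by (intros w o; exact (proj2 (Ha (v_seq o)))).
  assert (U : forall w (o : occurs w) (h : hom (d_ob d (v_seq o)) (d_ob d' (v_seq o))),
    (forall i, d_mor d' (e_proj o i) ∘ h = ua _ ∘ d_mor d (e_proj o i)) -> h = a (v_seq o)).
  { intros w o h Hh. apply (wf_jointly_monic H'). intro i. simpl in *. now rewrite Hh, Hp. }
  split; [exact Hs|split; [intro v; apply Ha|]].
  intros [w o i|f|R].
  - symmetry. refine (eq_trans (Hp w o i) _). now rewrite <- Hs.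
  - destruct (Fun f) as [h [h1 h2]]. simpl in *.
    rewrite Hs, <- (U _ _ h h1). now symmetry.
  - destruct (proj2 (Ha (v_rel R))) as [h [h1 h2]]. simpl in *. now rewrite <- (U _ _ h h1).
Qed.

Lemma natural_family_unique {D : Category} {d d' : SigDiagram D} (H' : well_formed d')
  (a b : forall v, hom (d_ob d v) (d_ob d' v)) :
  (forall e, a (e_tgt e) ∘ d_mor d e = d_mor d' e ∘ a (e_src e)) ->
  (forall e, b (e_tgt e) ∘ d_mor d e = d_mor d' e ∘ b (e_src e)) ->
  (forall A, a (v_sort A) = b (v_sort A)) -> forall v, a v = b v.
Proof.
  intros Na Nb E.
  assert (S : forall w (o : occurs w), a (v_seq o) = b (v_seq o)).
  { intros w o. apply (wf_jointly_monic H'). intro i.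
    assert (Ka := Na (e_proj o i)). assert (Kb := Nb (e_proj o i)). simpl in *.
    now rewrite <- Ka, <- Kb, E. }
  intros [A|w o|R]; auto.
  apply (proj2 H' R).
  assert (Ka := Na (e_rel R)). assert (Kb := Nb (e_rel R)). simpl in *.
  now rewrite <- Ka, <- Kb, S.
Qed.

End SignatureGraph.

(** * The cotensor *)

Lemma full_subcat_ob_eq {D : Category} {P : ob D -> Prop} (x y : ob (full_subcat P)) :
  proj1_sig x = proj1_sig y -> x = y.
Proof.
  destruct x as [x Hx], y as [y Hy]. simpl. intro E. subst y. f_equal. apply proof_irrelevance.
Qed.

(** The inverse sends an object to a chosen preimage, and a morphism to its unique preimage. *)
Lemma ff_surjective_equivalence {D D' : Category} (F : Functor D D') :
  (forall (a b : ob D) (g : hom (F a) (F b)), exists! f, fmap F f = g) ->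
  surjective_on_objects F -> is_equivalence F.
Proof.
  intros Hff Hs.
  destruct (dep_choice Hs) as [g Hg].
  assert (Hi : forall d, exists i : hom (F (g d)) d, is_iso i).
  { intro d. rewrite (Hg d). exists (idm d). apply is_iso_id. }
  destruct (dep_choice Hi) as [i Ii].
  destruct (dep_choice (fun d => iso_inv (Ii d))) as [j Hj].
  assert (J1 : forall d, j d ∘ i d = idm _) by (intro; apply Hj).
  assert (J2 : forall d, i d ∘ j d = idm _) by (intro; apply Hj).
  assert (Faith : forall (a b : ob D) (f f' : hom a b), fmap F f = fmap F f' -> f = f').
  { intros a b f f' E. destruct (Hff a b (fmap F f')) as [k [_ U]].
    rewrite <- (U f E). now apply U. }
  assert (Full : forall (a b : ob D), exists k : hom (F a) (F b) -> hom a b,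
             forall h, fmap F (k h) = h).
  { intros a b.
    destruct (dep_choice (B := fun _ => hom a b) (R := fun h k => fmap F k = h)) as [k Hk].
    - intro h. destruct (Hff a b h) as [f [Hf _]]. now exists f.
    - now exists k. }
  destruct (dep_choice (fun ab : ob D * ob D => Full (fst ab) (snd ab))) as [lift Hlift].
  set (lf := fun a b (h : hom (F a) (F b)) => lift (a, b) h : hom a b).
  assert (Hlf : forall a b (h : hom (F a) (F b)), fmap F (lf a b h) = h)
    by (intros a b h; exact (Hlift (a, b) h)).
  clearbody lf.
  unshelve refine (let G : Functor D' D :=
    @Build_Functor D' D g (fun a b f => lf (g a) (g b) (j b ∘ f ∘ i a)) _ _ in _).
  - intro a. apply Faith. now rewrite Hlf, fmap_id, comp_id_r.
  - intros a b c h f. apply Faith. rewrite fmap_comp, !Hlf, !comp_assoc.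
    rewrite <- (comp_assoc (i b)), J2, comp_id_l. reflexivity.
  - exists G. split.
    + unshelve eexists (@Build_NatTrans D D (fcomp G F) (fid D)
        (fun a => lf (g (F a)) a (i (F a))) _).
      * intros a b f. apply Faith. simpl. rewrite !fmap_comp, !Hlf, !comp_assoc.
        now rewrite <- (comp_assoc (i _)), J2, comp_id_l.
      * intro a. simpl. exists (lf a (g (F a)) (j (F a))).
        split; apply Faith; rewrite fmap_comp, !Hlf, fmap_id; auto.
    + unshelve eexists (@Build_NatTrans D' D' (fcomp F G) (fid D') (fun d => i d) _).
      * intros a b f. simpl. rewrite Hlf, !comp_assoc.
        now rewrite <- (comp_assoc (i _)), J2, comp_id_l.
      * exact Ii.
Qed.

Lemma finite_subset {U : Type} (P : U -> Prop) (l : list U) :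
  (forall x, P x -> In x l) -> Finite {x : U | P x}.
Proof.
  intro H.
  assert (K : exists l' : list {x : U | P x}, forall x p, In x l -> In (exist _ x p) l').
  { clear H. induction l as [|a l [l' Hl]].
    - exists nil. intros x p [].
    - destruct (classic (P a)) as [Ha|Ha].
      + exists (exist _ a Ha :: l'). intros x p [<-|Hx]; [left|right; auto].
        f_equal. apply proof_irrelevance.
      + exists l'. intros x p [<-|Hx]; [now destruct Ha|auto]. }
  destruct K as [l' Hl]. exists l'. intros [x p]. apply Hl. auto.
Qed.

Lemma finite_sum (U V : Type) : Finite U -> Finite V -> Finite (U + V).
Proof.
  intros [l Hl] [k Hk]. exists (map inl l ++ map inr k).
  intros [x|x]; apply in_or_app; [left|right]; now apply in_map.
Qed.

Section Cotensor.
Context {C : TwoCat} (HC : corepita C) {E : ob2 C} (HE : internal_topos E).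

(** This holds strictly, so that universal diagrams may be restricted in stages. *)
Lemma map_diagram_pre_pre {V Ed : Type} {src tgt : Ed -> V} {X Y Z : ob2 C}
  (m : ob (hom2 Y Z)) (f : ob (hom2 X Y)) (d : Diagram src tgt (hom2 Z E)) :
  map_diagram (pre f E) (map_diagram (pre m E) d) = map_diagram (pre (m ⊚ f) E) d.
Proof.
  apply Diagram_eq; simpl.
  - intro v. apply comp1_assoc.
  - intro e. apply rwhisk_rwhisk.
Qed.

(** The form in which [inverter] is applied: a family of conditions on 1-cells into [X], each
    detected by a 2-cell, is imposed universally. *)
Lemma invert_family {X : ob2 C} (GX : groupoidal X) (J : Type) (HJ : Finite J)
  (P : J -> forall A (GA : groupoidal A), ob (hom2 A X) -> Prop) :
  (forall j, exists (x y : ob (hom2 X E)) (m : hom x y),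
     forall A (GA : groupoidal A) (f : ob (hom2 A X)), is_iso (m ▷ f) <-> P j A GA f) ->
  exists (W : ob2 C) (m : ob (hom2 W X)), groupoidal W /\ iso_ff m /\
    (forall A (GA : groupoidal A) (f : ob (hom2 A W)) j, P j A GA (m ⊚ f)) /\
    forall A (GA : groupoidal A) (f : ob (hom2 A X)), (forall j, P j A GA f) ->
      exists f', m ⊚ f' = f.
Proof.
  intro H.
  assert (H' : forall j, exists q : {x : ob (hom2 X E) & {y : ob (hom2 X E) & hom x y}},
    forall A (GA : groupoidal A) (f : ob (hom2 A X)),
      is_iso (projT2 (projT2 q) ▷ f) <-> P j A GA f).
  { intro j. destruct (H j) as [x [y [m Hm]]]. now exists (existT _ x (existT _ y m)). }
  destruct (dep_choice H') as [q Hq].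
  destruct (inverter HC HJ GX (fun j => projT2 (projT2 (q j)))) as [W [m [GW [Hm [Inv Lift]]]]].
  exists W, m. split; [exact GW|]. split; [exact Hm|]. split.
  - intros A GA f j. apply Hq.
    apply (heq_iso (rwhisk_rwhisk _ _ _)). apply rwhisk_iso, Inv.
  - intros A GA f Hf. apply Lift; auto. intro j. apply (Hq j A GA f), Hf.
Qed.

End Cotensor.

Theorem theorem4p1p2 (C : TwoCat) (HC : corepita C)
  (L : Signature) (T : Theory L) (HT : finite_theory T)
  (E : ob2 C) (HE : internal_topos E) :
  inhabited (SemiStrictCotensor T HE).
Proof.
  destruct HT as [Fs [Ff [Fr [lT HlT]]]].
  destruct (diagram_classifier HC (@e_src L) (@e_tgt L) (vertex_finite Fs Ff Fr)
    (edge_finite Ff Fr) E) as [X0 [d0 [G0 [ff0 surj0]]]].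
  assert (T0 := proj1 HE X0 G0).
  (* Over [X1] the universal diagram becomes an interpretation. *)
  destruct (@invert_family C HC E X0 G0 ({w : seq (sort L) | occurs w} + rsym L)
    (finite_sum (occurs_finite_type Ff Fr) Fr)
    (fun j A GA f => match j with
     | inl (exist _ w o) => is_product (X := fun i => d_ob d0 (v_sort (item w i)) ⊚ f)
                              (P := d_ob d0 (v_seq o) ⊚ f)
                              (fun i => d_mor d0 (e_proj o i) ▷ f)
     | inr R => is_mono (d_mor d0 (e_rel R) ▷ f)
     end)) as [X1 [m1 [G1 [ff1 [inv1 lift1]]]]].
  { intros [[w o]|R].
    - destruct (product_detected (proj1 T0) (Y := fun i => d_ob d0 (v_sort (item w i)))
        (P := d_ob d0 (v_seq o)) (fun i => d_mor d0 (e_proj o i))) as [x [y [m Hm]]].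
      exists x, y, m. intros A GA f.
      exact (Hm _ (pre f E) (log_lim (proj2 HE A X0 f GA G0))).
    - destruct (mono_detected (proj1 T0) (d_mor d0 (e_rel R))) as [x [y [m Hm]]].
      exists x, y, m. intros A GA f.
      exact (Hm _ (pre f E) (log_lim (proj2 HE A X0 f GA G0))). }
  assert (wf1 : well_formed (map_diagram (pre m1 E) d0)).
  { assert (I := inv1 X1 G1 (id1 X1)). rewrite comp1_id_r in I.
    split; [intros w o; exact (I (inl (exist _ w o))) | intro R; exact (I (inr R))]. }
  set (M1 := to_interp wf1 : Interp L (hom2 X1 E)).
  (* Over [X2] this interpretation becomes a model. *)
  destruct (@invert_family C HC E X1 G1 {phi | T phi} (finite_subset HlT)
    (fun phi A GA f => satisfies (push (proj2 HE A X1 f GA G1) M1) (proj1_sig phi)))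
    as [X2 [m2 [G2 [ff2 [inv2 lift2]]]]].
  { intros [phi Hphi]. destruct (sentence_detected (proj1 HE X1 G1) M1 phi) as [x [y [m Hm]]].
    exists x, y, m. intros A GA f.
    exact (Hm {| tg_topos := proj1 HE A GA; tg_log := proj2 HE A X1 f GA G1 |}). }
  set (d1 := map_diagram (pre m1 E) d0). fold d1 in wf1.
  assert (wf2 : well_formed (map_diagram (pre m2 E) d1)).
  { apply map_diagram_well_formed; auto. apply (log_lim (proj2 HE X2 X1 m2 G2 G1)). }
  set (d2 := map_diagram (pre m2 E) d1). fold d2 in wf2.
  set (ev := to_interp wf2 : Interp L (hom2 X2 E)).
  assert (ev_m2 : push (proj2 HE X2 X1 m2 G2 G1) M1 = ev) by apply push_to_interp.
  assert (wfA : forall A (GA : groupoidal A) (f : ob (hom2 A X2)),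
             well_formed (map_diagram (pre f E) d2)).
  { intros A GA f. apply map_diagram_well_formed; auto.
    apply (log_lim (proj2 HE A X2 f GA G2)). }
  assert (ev_push : forall A (GA : groupoidal A) (f : ob (hom2 A X2)),
             push (proj2 HE A X2 f GA G2) ev = push (proj2 HE A X1 (m2 ⊚ f) GA G1) M1).
  { intros A GA f. unfold ev, M1. rewrite (push_to_interp _ _ (wfA A GA f)).
    assert (Ed : map_diagram (pre f E) d2 = map_diagram (pre (m2 ⊚ f) E) d1)
      by apply map_diagram_pre_pre.
    assert (wf' := wfA A GA f). rewrite Ed in wf'.
    rewrite (push_to_interp _ _ wf'). now apply to_interp_eq. }
  assert (ff : diagram_ff d2).
  { apply diagram_ff_pullback; auto. apply diagram_ff_pullback; auto. }
  assert (Mod : forall A (GA : groupoidal A) (f : ob (hom2 A X2)),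
             is_model T (push (proj2 HE A X2 f GA G2) ev)).
  { intros A GA f phi Hphi. rewrite ev_push. exact (inv2 A GA f (exist _ phi Hphi)). }
  assert (Mev : is_model T ev).
  { intros phi Hphi. rewrite <- ev_m2.
    assert (I := inv2 X2 G2 (id1 X2) (exist _ phi Hphi)). now rewrite comp1_id_r in I. }
  refine (inhabits {| sc_groupoidal := G2; sc_model := Mev; sc_univ := _ |}).
  intros A GA. exists (Mod A GA). intro K.
  assert (KS : surjective_on_objects K).
  { intros [M HM].
    destruct (surj0 A GA (of_interp M)) as [f0 Hf0].
    assert (wf0 := of_interp_well_formed M). rewrite <- Hf0 in wf0.
    destruct (lift1 A GA f0) as [f1 Hf1].
    { intros [[w o]|R]; [exact (proj1 wf0 w o) | exact (proj2 wf0 R)]. }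
    assert (E1 : push (proj2 HE A X1 f1 GA G1) M1 = M).
    { assert (Ed : map_diagram (pre f1 E) d1 = map_diagram (pre f0 E) d0)
        by (rewrite <- Hf1; apply map_diagram_pre_pre).
      assert (wf' := wf0). rewrite <- Ed in wf'.
      unfold M1. rewrite (push_to_interp _ _ wf'), <- (to_interp_of_interp M).
      apply to_interp_eq. now rewrite Ed. }
    destruct (lift2 A GA f1) as [f2 Hf2].
    { intros [phi Hphi]. simpl. rewrite E1. now apply HM. }
    exists f2. apply full_subcat_ob_eq. simpl.
    refine (eq_trans (ev_push A GA f2) _). now rewrite Hf2. }
  split; [|exact KS]. apply ff_surjective_equivalence; [|exact KS].
  intros f g u. simpl in f, g.
  (* The images of [ev] are, up to conversion, interpretations given by diagrams. *)
  change (InterpIso (to_interp (d := map_diagram (pre f E) d2) (conj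
    (fun w o => preserves_product (log_lim (proj2 HE A X2 f GA G2)) (wf_product wf2 o))
    (fun R => preserves_mono (log_lim (proj2 HE A X2 f GA G2)) (@wf_mono _ _ _ wf2 R))))
    (to_interp (d := map_diagram (pre g E) d2) (conj
    (fun w o => preserves_product (log_lim (proj2 HE A X2 g GA G2)) (wf_product wf2 o))
    (fun R => preserves_mono (log_lim (proj2 HE A X2 g GA G2)) (@wf_mono _ _ _ wf2 R))))) in u.
  destruct (interp_iso_extend u) as [a [Ha [Ia Na]]].
  destruct (ff A f g a Ia Na) as [c [Hc Uc]].
  exists c. split.
  - apply InterpIso_eq. intro S. simpl. refine (eq_trans (Hc (v_sort S)) (Ha S)).
  - intros c' Hc'. apply Uc.
    apply (natural_family_unique (d := map_diagram (pre f E) d2) (wfA A GA g)); auto.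
    + intro e. symmetry. simpl. apply interchange.
    + intro S. rewrite Ha. rewrite <- Hc'. reflexivity.
Qed.
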